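(* Consider the 2-block $m$-dimensional CSBM with parameters $n,p,q,\mu,\nu,\sigma$, let $\gamma=\frac{p-q}{p+q}$, and let $k=O(\log n)$ be a positive integer. Suppose $\gamma\geq c_0\,k\sqrt{\frac{\log n}{np}}$ for a sufficiently large absolute constant $c_0$ and $p\geq\frac{\log^3 n}{n}$. Then there is an absolute constant $C$ such that, after $k$ rounds of graph convolution with $\tilde A$, the data is linearly separable (i.e. there exist $w\in\mathbb{R}^m$, $b\in\mathbb{R}$ such that the entries of $\tilde A^k(Xw+b\mathbf 1)$ are positive on one class and negative on the other) with probability $1-n^{-\Omega(1)}$, provided $$\frac{\|\mu-\nu\|}{\sigma}\geq \Omega\!\left(\max\!\left(\sqrt{\frac{\log n}{n}},\ \Big(\frac{C}{\gamma\sqrt{np}}\Big)^k\sqrt{\log n}\right)\right).$$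
   Context: CSBM: $n$ is even; $V=\{1,\dots,n\}$ is partitioned into classes $S,T$ of size $n/2$. A random graph is drawn with each same-class pair an edge independently with probability $p$ and each cross-class pair an edge independently with probability $q$; $A$ is its adjacency matrix and $d=2|E|/n$ the empirical average degree. Independently, $X\in\mathbb{R}^{n\times m}$ has row $i$ equal to $\mu+g_i$ ($i\in S$) or $\nu+g_i$ ($i\in T$) with $g_i\sim\mathcal N(0,\sigma^2 I_m)$ i.i.d. The corrected convolution matrix is $\tilde A=\frac1dA-\frac1n\mathbf 1\mathbf 1^\top$ with $\mathbf 1$ the all-ones vector. Asymptotic notation is as $n\to\infty$ with absolute constants. *)

(* Defs.v *)
From HB Require Import structures.
From mathcomp Require Import all_boot all_order all_algebra.
From mathcomp Require Import all_classical all_reals all_analysis.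
Set Implicit Arguments. Unset Strict Implicit. Unset Printing Implicit Defensive.
Import Order.TTheory GRing.Theory Num.Theory.
Local Open Scope classical_set_scope.
Local Open Scope ring_scope.

Definition mutual_indep {d} {T : measurableType d} {R : realType}
  (P : probability T R) {I : finType} (J : {set I}) (X : I -> T -> R) : Prop :=
  forall B : I -> set R, (forall i, measurable (B i)) ->
    P (\big[setI/setT]_(i in J) (X i @^-1` B i))
    = \big[*%E/1%E]_(i in J) P (X i @^-1` B i).

(* Index set of the random ingredients: edge indicators e i j (used for i < j)
   and Gaussian noise coordinates Z i l. *)
Definition csbm_index (n m : nat) : finType := ('I_n * 'I_n + 'I_n * 'I_m)%type.

Definition csbm_family {T : Type} {R : Type} (n m : nat)
  (e : 'I_n -> 'I_n -> T -> R) (Z : 'I_n -> 'I_m -> T -> R)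
  : csbm_index n m -> T -> R :=
  fun x => match x with inl ij => e ij.1 ij.2 | inr il => Z il.1 il.2 end.

Definition csbm_relevant (n m : nat) : {set csbm_index n m} :=
  [set x : csbm_index n m | match x with inl ij => (ij.1 < ij.2)%N | inr _ => true end].

Definition csbm_model {d} {T : measurableType d} {R : realType}
  (P : probability T R) (n m : nat) (S : {set 'I_n}) (p q sigma : R)
  (e : 'I_n -> 'I_n -> T -> R) (Z : 'I_n -> 'I_m -> T -> R) : Prop :=
  [/\ (forall i j, measurable_fun setT (e i j)),
      (forall i l, measurable_fun setT (Z i l)),
      mutual_indep P (csbm_relevant n m) (csbm_family e Z),
      (forall i j : 'I_n, (i < j)%N ->
         let r := if (i \in S) == (j \in S) then p else q in
         P (e i j @^-1` [set 1]) = r%:E /\ P (e i j @^-1` [set 0]) = (1 - r)%:E)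
    & (forall i l B, measurable B -> P (Z i l @^-1` B) = normal_prob 0 sigma B)].

Section Realizations.
Context {T : Type} {R : realType} (n m : nat).

Definition adjacency (e : 'I_n -> 'I_n -> T -> R) (w : T) : 'M[R]_n :=
  \matrix_(i, j) (if (i < j)%N then (e i j w == 1)%:R
                  else if (j < i)%N then (e j i w == 1)%:R else 0).

Definition num_edges (e : 'I_n -> 'I_n -> T -> R) (w : T) : nat :=
  #|[set x : 'I_n * 'I_n | (x.1 < x.2)%N && (e x.1 x.2 w == 1)]|.

Definition avg_degree (e : 'I_n -> 'I_n -> T -> R) (w : T) : R :=
  (2 * num_edges e w)%:R / n%:R.

Definition conv_matrix (e : 'I_n -> 'I_n -> T -> R) (w : T) : 'M[R]_n :=
  (avg_degree e w)^-1 *: adjacency e w - (n%:R)^-1 *: const_mx 1.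

Definition features (S : {set 'I_n}) (mu nu : 'cV[R]_m)
  (Z : 'I_n -> 'I_m -> T -> R) (w : T) : 'M[R]_(n, m) :=
  \matrix_(i, l) ((if i \in S then mu l 0 else nu l 0) + Z i l w).

Definition separable_after (k : nat) (S : {set 'I_n}) (mu nu : 'cV[R]_m)
  (e : 'I_n -> 'I_n -> T -> R) (Z : 'I_n -> 'I_m -> T -> R) (w : T) : Prop :=
  exists (wv : 'cV[R]_m) (b : R),
    let y := iter k (fun v => conv_matrix e w *m v)
                    (features S mu nu Z w *m wv + b *: const_mx 1) in
    (forall i, i \in S -> 0 < y i 0) /\ (forall i, i \notin S -> y i 0 < 0)
    \/ (forall i, i \in S -> y i 0 < 0) /\ (forall i, i \notin S -> 0 < y i 0).

End Realizations.

Definition euclid_norm {R : realType} {m : nat} (v : 'cV[R]_m) : R :=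
  Num.sqrt (\sum_l v l 0 ^+ 2).

(* Main.v *)
Require Import Defs.
From HB Require Import structures.
From mathcomp Require Import all_boot all_order all_algebra.
From mathcomp Require Import all_classical all_reals all_analysis measurable_realfun.
From mathcomp Require Import ring lra zify.
Import Order.TTheory GRing.Theory Num.Theory.
Set Implicit Arguments. Unset Strict Implicit. Unset Printing Implicit Defensive.
Local Open Scope ring_scope.

(** Put [B = A - E A].  If [s] is the vector of class signs and [d] the
    empirical degree, then [A / d - J / n = g s s^T / n + N], where [g] is
    close to [gamma] and [N] is [B / d] up to small multiples of [J / n] and of
    the identity.  Two estimates on [B] carry the proof.

    Spectral norm: [||B|| = O(sqrt (n p))].  In [E tr B^(2L)], [L] of order
    [ln n], only closed walks using every edge at least twice contribute.
    Grouped by equality pattern, they compare with the same expansion for a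
    matrix of centred Bernoulli(1/3) entries whose size is of order [n p].  That
    matrix is dense, so a net and the union bound control its norm.

    Entries: [|B^j v|_oo <= Th^j] with [Th = O(sqrt (n p ln n))], for [v = s]
    and [v = 1] and all [j <= k].  Deleting row and column [i] from [B] makes
    the row independent of the remaining matrix, so Bernstein's inequality bounds
    [(B^(j+1) v)_i] by induction on [j].

    In the norm [sup_j |B^j x|_oo / Th^j] the matrix [N] is then smaller than
    [g / (8 k)], so [k] convolutions send [s] to a vector entrywise within a
    quarter of [g^k s], and the rows of the [k]-th power have Euclidean norm at most
    [(C / sqrt (n p))^k + O(g^k / sqrt n)].  Given the graph, the convolved noise
    is Gaussian with these row norms, and a union bound over the vertices
    concludes. *)

(** * Products of Bernoulli variables *)

(** The regime [n p] of order [ln^3 n] shapes the norm bound. A net applied directly to [B] is not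
    sharp, because sparse entries are far from subgaussian at the scale of their variance, and any
    loss would be raised to the power [k] in [(C / (gamma sqrt (n p)))^k]. The comparison matrix has
    entries of constant variance, for which a net is sharp up to constants. The parameter 1/3 is
    chosen for its skewness: a closed walk may use an edge three times, and domination pattern by
    pattern needs every centred moment of order at least 2 to be positive, whereas those of a fair
    coin vanish at odd orders. The logarithm in [Th] is affordable because it enters only through
    [Th / (n p)], which the hypothesis on [gamma] controls. A graph has finitely many
    configurations, so its analysis uses finite weighted sums; measure theory enters only with the
    Gaussian noise, through joint events with each configuration. *)

Section BernoulliProduct.
Variables (R : realType) (I : finType) (r : I -> R).
Hypothesis r01 : forall x, 0 <= r x <= 1.
Implicit Types (a : {ffun I -> bool}) (D : {set I}).

Definition bern (x : R) (b : bool) : R := if b then x else 1 - x.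

Definition cfg_weight a : R := \prod_x bern (r x) (a x).

Definition Ex (F : {ffun I -> bool} -> R) : R := \sum_a cfg_weight a * F a.

Lemma bern_ge0 x b : 0 <= bern (r x) b.
Proof. by case: b; move: (r01 x) => /andP[? ?] /=; rewrite ?subr_ge0. Qed.

Lemma cfg_weight_ge0 a : 0 <= cfg_weight a.
Proof. by apply: prodr_ge0 => x _; exact: bern_ge0. Qed.

Lemma Ex_prod (f : I -> bool -> R) :
  Ex (fun a => \prod_x f x (a x)) =
  \prod_x (r x * f x true + (1 - r x) * f x false).
Proof.
under [RHS]eq_bigr => x _.
  have -> : r x * f x true + (1 - r x) * f x false =
      \sum_b bern (r x) b * f x b by rewrite big_bool.
  over.
rewrite bigA_distr_bigA /Ex; apply: eq_bigr => a _.
by rewrite /cfg_weight -big_split.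
Qed.

Lemma eq_Ex F G : F =1 G -> Ex F = Ex G.
Proof. by move=> FG; apply: eq_bigr => a _; rewrite FG. Qed.

Lemma Ex1 : Ex (fun=> 1) = 1.
Proof.
have := Ex_prod (fun _ _ => 1).
under eq_Ex do rewrite big1 //.
by move=> ->; rewrite big1 // => x _; rewrite !mulr1 subrKC.
Qed.

Lemma ExZ c F : Ex (fun a => c * F a) = c * Ex F.
Proof. by rewrite /Ex mulr_sumr; apply: eq_bigr => a _; rewrite mulrCA. Qed.

Lemma Ex_cst c : Ex (fun=> c) = c.
Proof. by rewrite -[RHS]mulr1 -Ex1 -ExZ; apply: eq_Ex => a; rewrite mulr1. Qed.

Lemma ExD F G : Ex (fun a => F a + G a) = Ex F + Ex G.
Proof. by rewrite /Ex -big_split; apply: eq_bigr => a _; rewrite mulrDr. Qed.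

Lemma Ex_sum (J : Type) (s : seq J) (P : pred J) (F : J -> {ffun I -> bool} -> R) :
  Ex (fun a => \sum_(j <- s | P j) F j a) = \sum_(j <- s | P j) Ex (F j).
Proof.
rewrite /Ex exchange_big /=; apply: eq_bigr => a _; by rewrite mulr_sumr.
Qed.

Lemma le_Ex F G : (forall a, F a <= G a) -> Ex F <= Ex G.
Proof. by move=> FG; apply: ler_sum => a _; rewrite ler_wpM2l ?cfg_weight_ge0. Qed.

Definition Pr (A : pred {ffun I -> bool}) : R := Ex (fun a => (A a)%:R).

Lemma le_Pr (A B : pred {ffun I -> bool}) : subpred A B -> Pr A <= Pr B.
Proof.
move=> AB; apply: le_Ex => a; rewrite ler_nat.
by have := AB a; case: (A a) => // /(_ isT) ->.
Qed.

Lemma Pr_U (A B : pred {ffun I -> bool}) : Pr (predU A B) <= Pr A + Pr B.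
Proof.
rewrite /Pr -ExD; apply: le_Ex => a; rewrite -natrD ler_nat /=.
by case: (A a); case: (B a).
Qed.

Lemma Pr_exists (J : finType) (A : J -> pred {ffun I -> bool}) :
  Pr (fun a => [exists j, A j a]) <= \sum_j Pr (A j).
Proof.
rewrite /Pr -Ex_sum; apply: le_Ex => a.
case: existsP => [[j Aj]|_]; last by apply: sumr_ge0 => j _; rewrite ler0n.
by rewrite (bigD1 j) //= Aj lerDl; apply: sumr_ge0 => i _; rewrite ler0n.
Qed.

Lemma Ex_markov (F : {ffun I -> bool} -> R) (t : R) : 0 < t ->
  (forall a, 0 <= F a) -> Pr (fun a => t <= F a) <= Ex F / t.
Proof.
move=> t0 F0; rewrite mulrC -ExZ; apply: le_Ex => a.
case: (leP t (F a)) => tF /=; last by rewrite mulr_ge0 // invr_ge0 ltW.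
by rewrite mulrC ler_pdivlMr // mul1r.
Qed.

Definition mix D a a' : {ffun I -> bool} :=
  [ffun x => if x \in D then a' x else a x].

Lemma cfg_weight_mix D a a' :
  cfg_weight (mix D a a') * cfg_weight (mix D a' a) =
  cfg_weight a * cfg_weight a'.
Proof.
rewrite /cfg_weight -!big_split; apply: eq_bigr => x _ /=.
by rewrite !ffunE; case: ifP => // _; rewrite mulrC.
Qed.

(** Swapping the coordinates in [D] between two independent copies is an involution that preserves
    the product weight. This plays the role of conditioning on the coordinates outside [D]. *)
Lemma Ex_resample D F : Ex F = Ex (fun a => Ex (fun a' => F (mix D a a'))).
Proof.
transitivity (\sum_(p : {ffun I -> bool} * {ffun I -> bool})
    cfg_weight p.1 * cfg_weight p.2 * F p.1).
  rewrite -(pair_bigA _ (fun a a' => cfg_weight a * cfg_weight a' * F a)) /=.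
  apply: eq_bigr => a _; rewrite -[in LHS](mulr1 (_ * _)) -Ex1 /Ex !mulr_sumr.
  by apply: eq_bigr => a' _; ring.
pose h (p : {ffun I -> bool} * {ffun I -> bool}) := (mix D p.1 p.2, mix D p.2 p.1).
have hK : involutive h.
  move=> [a a']; rewrite /h /=; congr pair;
    by apply/ffunP => x; rewrite !ffunE; case: (x \in D).
rewrite (reindex_inj (inv_inj hK)) /= -(pair_bigA _ (fun a a' =>
  cfg_weight (mix D a a') * cfg_weight (mix D a' a) * F (mix D a a'))) /=.
apply: eq_bigr => a _; rewrite /Ex mulr_sumr; apply: eq_bigr => a' _.
by rewrite cfg_weight_mix mulrA.
Qed.

End BernoulliProduct.

(** * Moments and exponential moments of a centred Bernoulli variable *)

Section BernoulliMoments.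
Variable R : realType.
Implicit Types (x t y : R).

(** From [expR (- y) >= 1 - y], since [(1 + y + 2 y^2) (1 - y) = 1 + y^2 (1 - 2 y)]. *)
Lemma expR_le_quad y : y <= 2^-1 -> expR y <= 1 + y + 2 * y ^+ 2.
Proof.
move=> y2; have h : 0 < 1 - y by lra.
have : expR (- y) >= 1 - y by apply: expR_ge1Dx.
rewrite expRN -ler_pV2 ?inE ?unitfE ?invr_gt0 ?gt_eqF ?expR_gt0 ?invr_gt0 ?expR_gt0 //.
rewrite invrK => /le_trans; apply.
rewrite -[leLHS]mul1r ler_pdivrMr //; nra.
Qed.

Definition bern_moment x (k : nat) : R := x * (1 - x) ^+ k + (1 - x) * (- x) ^+ k.

Lemma bern_moment0 x : bern_moment x 0 = 1.
Proof. by rewrite /bern_moment !expr0 !mulr1 subrKC. Qed.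

Lemma bern_moment1 x : bern_moment x 1 = 0.
Proof. by rewrite /bern_moment !expr1; ring. Qed.

(** [x (1 - x)^k <= x (1 - x)] and [(1 - x) x^k <= x^2] add up to [x]. An edge used at least twice
    thus costs one factor of its probability, whatever its multiplicity. *)
Lemma bern_moment_le x k : 0 <= x <= 1 -> (1 < k)%N -> `|bern_moment x k| <= x.
Proof.
move=> /andP[x0 x1]; case: k => [|[|k]] // _.
apply: (le_trans (ler_normD _ _)); 
have nX (y z : R) j : `|y * z ^+ j| = `|y| * `|z| ^+ j by rewrite normrM normrX.
rewrite !nX normrN.
rewrite !(ger0_norm x0) ger0_norm ?subr_ge0 //.
have e1 : (1 - x) ^+ k.+2 <= 1 - x.
  by rewrite exprS ler_piMr ?subr_ge0 // exprn_ile1 //; lra.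
have e2 : x ^+ k.+2 <= x by rewrite exprS ler_piMr // exprn_ile1 //; lra.
have e3 := ler_wpM2l x0 e1.
have e4 : (1 - x) * x ^+ k.+2 <= (1 - x) * x by rewrite ler_wpM2l ?subr_ge0.
have e5 : x ^+ k.+2 <= x ^+ 2.
  by rewrite exprS exprS mulrA -expr2 ler_piMr ?sqr_ge0 // exprn_ile1.
have : (1 - x) * x ^+ k.+2 <= x ^+ 2.
  by apply: (le_trans _ e5); rewrite ler_piMl ?exprn_ge0 //; lra.
nra.
Qed.

(** The product equals [(2^k + 2 (-1)^k) / 3], in which [2^k] wins against the sign from order 2
    on. *)
Lemma bern_moment_third k : (1 < k)%N -> 1 <= 3 ^+ k * bern_moment (3^-1) k.
Proof.
move=> k1; rewrite /bern_moment mulrDr !(mulrCA (3 ^+ k)) -!exprMn.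
have -> : 3 * (1 - 3^-1) = 2 :> R by lra.
have -> : 3 * - 3^-1 = -1 :> R by lra.
have -> : 1 - 3^-1 = 2 / 3 :> R by lra.
case: k k1 => [|[|[|k]]] // _; first by rewrite !expr2; lra.
have h1 : 8 <= 2 ^+ k.+3 :> R.
  have : 1 <= 2 ^+ k :> R by rewrite exprn_ege1 // ler1n.
  by rewrite !exprS; lra.
have h2 : -1 <= (-1) ^+ k.+3 :> R.
  by rewrite -signr_odd; case: odd; rewrite ?expr1 ?expr0 //; lra.
lra.
Qed.

(** The linear terms cancel, and the quadratic ones leave [2 t^2] times the variance [x (1 - x)].
    The factor [x] in the exponent is what makes sparse rows concentrate. *)
Lemma bern_mgf_small x t : 0 <= x <= 1 -> `|t| <= 2^-1 ->
  x * expR (t * (1 - x)) + (1 - x) * expR (t * - x) <= expR (2 * t ^+ 2 * x).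
Proof.
move=> /andP[x0 x1] t2.
have [tl tr] : - 2^-1 <= t /\ t <= 2^-1 by move: t2; rewrite ler_norml => /andP.
have h1 : expR (t * (1 - x)) <= 1 + t * (1 - x) + 2 * (t * (1 - x)) ^+ 2.
  by apply: expR_le_quad; nra.
have h2 : expR (t * - x) <= 1 + t * - x + 2 * (t * - x) ^+ 2.
  by apply: expR_le_quad; nra.
have g1 := ler_wpM2l x0 h1.
have x1' : 0 <= 1 - x by lra.
have g2 := ler_wpM2l x1' h2.
apply: (le_trans (lerD g1 g2)); apply: (le_trans _ (expR_ge1Dx _)).
have t0 : 0 <= t ^+ 2 by apply: sqr_ge0.
rewrite !exprMn sqrrN; nra.
Qed.

(** For [|t| > 1/2] the crude [|t s| <= |t| <= 2 t^2] suffices. The dense matrix needs all [t], its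
    exponents being possibly of order [sqrt m]. *)
Lemma bern_mgf x t : 0 <= x <= 1 ->
  x * expR (t * (1 - x)) + (1 - x) * expR (t * - x) <= expR (2 * t ^+ 2).
Proof.
move=> x01; have [x0 x1] := andP x01; have [t2|t2] := leP `|t| 2^-1.
  apply: (le_trans (bern_mgf_small x01 t2)); rewrite ler_expR.
  by rewrite ler_piMr // mulr_ge0 // sqr_ge0.
have h s : `|s| <= 1 -> expR (t * s) <= expR (2 * t ^+ 2).
  move=> s1; rewrite ler_expR; apply: (le_trans (ler_norm _)); rewrite normrM.
  rewrite -(real_normK (num_real t)) expr2; have := normr_ge0 t; nra.
have h1 : expR (t * (1 - x)) <= expR (2 * t ^+ 2).
  by apply: h; rewrite ler_norml; apply/andP; split; lra.
have h2 : expR (t * - x) <= expR (2 * t ^+ 2).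
  by apply: h; rewrite ler_norml; apply/andP; split; lra.
nra.
Qed.

End BernoulliMoments.

(** * Linear forms in independent centred variables *)

Section LinearForms.
Variables (R : realType) (I : finType) (r : I -> R).
Hypothesis r01 : forall x, 0 <= r x <= 1.

Definition centered (a : {ffun I -> bool}) (x : I) : R := (a x)%:R - r x.

Lemma Ex_centered_prod (k : I -> nat) :
  Ex r (fun a => \prod_x centered a x ^+ k x) = \prod_x bern_moment (r x) (k x).
Proof.
rewrite (Ex_prod r (fun x b => (b%:R - r x) ^+ k x)); apply: eq_bigr => x _.
by rewrite /bern_moment sub0r.
Qed.

Lemma Ex_exp_linear (c : I -> R) :
  Ex r (fun a => expR (\sum_x c x * centered a x)) <= expR (2 * \sum_x c x ^+ 2).
Proof.
under eq_Ex do rewrite expR_sum.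
rewrite (Ex_prod r (fun x b => expR (c x * (b%:R - r x)))) mulr_sumr expR_sum.
apply: ler_prod => x _; rewrite sub0r; move: (r01 x) => /andP[x0 x1].
rewrite bern_mgf ?r01 // andbT.
by rewrite addr_ge0 // mulr_ge0 ?expR_ge0 ?subr_ge0.
Qed.

Lemma Ex_exp_linear_small (c : I -> R) : (forall x, `|c x| <= 2^-1) ->
  Ex r (fun a => expR (\sum_x c x * centered a x)) <=
  expR (2 * \sum_x c x ^+ 2 * r x).
Proof.
move=> c2; under eq_Ex do rewrite expR_sum.
rewrite (Ex_prod r (fun x b => expR (c x * (b%:R - r x)))) mulr_sumr expR_sum.
apply: ler_prod => x _; rewrite sub0r; move: (r01 x) => /andP[x0 x1].
rewrite mulrA bern_mgf_small ?r01 // andbT.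
by rewrite addr_ge0 // mulr_ge0 ?expR_ge0 ?subr_ge0.
Qed.

(* Bernstein's inequality for a linear form in the coordinates of [D] whose
   coefficients [c] may depend on the coordinates outside [D]. *)
Lemma Pr_linear_tail (D : {set I}) (G : pred {ffun I -> bool})
    (c : {ffun I -> bool} -> I -> R) (lam V t : R) :
  0 <= lam ->
  (forall a a' : {ffun I -> bool}, (forall x, x \notin D -> a x = a' x) -> G a = G a') ->
  (forall a a' : {ffun I -> bool}, (forall x, x \notin D -> a x = a' x) -> c a =1 c a') ->
  (forall a x, x \notin D -> c a x = 0) ->
  (forall a x, G a -> lam * `|c a x| <= 2^-1) ->
  (forall a, G a -> \sum_x c a x ^+ 2 * r x <= V) ->
  Pr r (fun a => G a && (t <= \sum_x c a x * centered a x)) <=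
  expR (2 * lam ^+ 2 * V - lam * t).
Proof.
move=> lam0 GD cD c0 c2 cV.
pose F a := (G a)%:R * expR (lam * (\sum_x c a x * centered a x)) * expR (- (lam * t)).
apply: (@le_trans _ _ (Ex r F)).
  apply: le_Ex => // a; rewrite /F; case: (G a) => /=; last by rewrite !mul0r.
  rewrite mul1r -expRD; case: (leP t) => tS; last by rewrite expR_ge0.
  apply: (le_trans _ (expR_ge1Dx _)).
  by rewrite lerDl subr_ge0 ler_wpM2l.
rewrite (Ex_resample r D) -[leRHS](Ex_cst r).
apply: le_Ex => // a; rewrite /F.
have mixE a' x : x \notin D -> mix D a a' x = a x.
  by move=> xD; rewrite ffunE (negbTE xD).
have eG a' : G (mix D a a') = G a by apply: GD => x; exact: mixE.
have ec a' : c (mix D a a') =1 c a by apply: cD => x; exact: mixE.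
under eq_Ex do rewrite eG.
case Ga : (G a) => /=; last first.
  by under eq_Ex do rewrite !mul0r; rewrite Ex_cst expR_ge0.
under eq_Ex do rewrite mul1r mulrC.
rewrite ExZ addrC expRD ler_wpM2l ?expR_ge0 //.
rewrite (@eq_Ex _ _ _ _ (fun a' => expR (\sum_x (lam * c a x) * centered a' x))); last first.
  move=> a'; congr expR; rewrite mulr_sumr; apply: eq_bigr => x _.
  rewrite ec mulrA; have [xD|xD] := boolP (x \in D); last by rewrite c0 // mulr0 !mul0r.
  by rewrite /centered ffunE xD.
apply: (le_trans (Ex_exp_linear_small _)).
  by move=> x; rewrite normrM ger0_norm // c2.
have -> : \sum_x (lam * c a x) ^+ 2 * r x = lam ^+ 2 * \sum_x c a x ^+ 2 * r x.
  by rewrite mulr_sumr; apply: eq_bigr => x _; rewrite exprMn mulrA.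
rewrite ler_expR mulrA; apply: ler_wpM2l; last exact: cV.
by rewrite mulr_ge0 ?sqr_ge0.
Qed.

End LinearForms.

(** * Closed walks and the trace *)

Section SymmetricMatrix.
Variables (R : realType) (n : nat).

Definition symmx (g : 'I_n * 'I_n -> R) : 'M[R]_n :=
  \matrix_(i, j) (if (i < j)%N then g (i, j) else if (j < i)%N then g (j, i) else 0).

Definition edge (i j : 'I_n) : 'I_n * 'I_n := if (i < j)%N then (i, j) else (j, i).

Lemma symmxE g i j : symmx g i j = if i == j then 0 else g (edge i j).
Proof.
rewrite mxE /edge; have [->|ij] := eqVneq i j; first by rewrite ltnn.
by case: ltngtP => // /val_inj e; rewrite e eqxx in ij.
Qed.

Lemma edge_sym i j : edge i j = edge j i.
Proof. by rewrite /edge; case: ltngtP => // /val_inj ->. Qed.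

Lemma edge_eqP (i j k l : 'I_n) :
  (edge i j == edge k l) =
  ((i == k) && (j == l)) || ((i == l) && (j == k)).
Proof.
rewrite /edge; case: (ltngtP i j) => ij; case: (ltngtP k l) => kl;
  rewrite ?xpair_eqE -?(inj_eq val_inj) /=; lia.
Qed.

Lemma symmx_sym g i j : symmx g i j = symmx g j i.
Proof. by rewrite !symmxE eq_sym edge_sym. Qed.

End SymmetricMatrix.

(** * Matrix powers as sums over walks *)

Section Walks.
Variables (R : comNzRingType).

Definition ffcons (T : Type) N (i : T) (u : {ffun 'I_N -> T}) : {ffun 'I_N.+1 -> T} :=
  [ffun t => if unlift ord0 t is Some t' then u t' else i].

Lemma big_ffun_cons (n N : nat) (F : {ffun 'I_N.+1 -> 'I_n} -> R) :
  \sum_u F u = \sum_i \sum_u F (ffcons i u).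
Proof.
rewrite pair_bigA /= (reindex (fun p : 'I_n * {ffun 'I_N -> 'I_n} => ffcons p.1 p.2)) //.
exists (fun u : {ffun 'I_N.+1 -> 'I_n} => (u ord0, [ffun t => u (lift ord0 t)])).
  move=> [i u] _ /=; rewrite ffunE unlift_none; congr pair.
  by apply/ffunP => t; rewrite !ffunE liftK.
move=> u _; apply/ffunP => t; rewrite ffunE /=.
by case: unliftP => [t' ->|->]; rewrite ?ffunE.
Qed.

Variables (n N : nat).
Definition src (V : Type) (u : {ffun 'I_N.+1 -> V}) (t : 'I_N) : V := u (widen_ord (leqnSn N) t).
Definition dst (V : Type) (u : {ffun 'I_N.+1 -> V}) (t : 'I_N) : V := u (lift ord0 t).

End Walks.

Lemma expmx_walk (R : comNzRingType) (n N : nat) (M : 'M[R]_n) i j :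
  (M ^+ N) i j = \sum_(u : {ffun 'I_N.+1 -> 'I_n})
    ((u ord0 == i) && (u ord_max == j))%:R * \prod_t M (src u t) (dst u t).
Proof.
elim: N i j => [|N IH] i j.
  rewrite expr0 mxE big_ffun_cons (bigD1 i) //= [X in _ + X]big1 ?addr0; last first.
    move=> k ki; apply: big1 => u _.
    by rewrite ffunE unlift_none (negbTE ki) mul0r.
  rewrite (bigD1 [ffun x => i]) //= [X in _ + X]big1 ?addr0; last first.
    by move=> u /eqP []; apply/ffunP => -[].
  rewrite big_ord0 mulr1 !ffunE unlift_none eqxx /=.
  by rewrite (_ : ord_max = ord0) ?unlift_none //; exact: val_inj.
rewrite exprS -mulmxE mxE big_ffun_cons [RHS](bigD1 i) //= [X in _ = _ + X]big1 ?addr0; last first.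
  move=> k ki; apply: big1 => u _.
  by rewrite ffunE unlift_none (negbTE ki) mul0r.
transitivity (\sum_k \sum_(u : {ffun 'I_N.+1 -> 'I_n}) (u ord0 == k)%:R *
   (M i k * (u ord_max == j)%:R * \prod_t M (src u t) (dst u t))).
  apply: eq_bigr => k _; rewrite IH mulr_sumr; apply: eq_bigr => u _.
  by case: (u ord0 == k); case: (u ord_max == j); rewrite /= ?(mul0r, mulr0, mul1r, mulr1).
rewrite exchange_big /=; apply: eq_bigr => u _.
rewrite (bigD1 (u ord0)) //= eqxx mul1r [X in _ + X = _]big1 ?addr0; last first.
  by move=> k; rewrite eq_sym => /negbTE ->; rewrite mul0r.
rewrite big_ord_recl ffunE unlift_none eqxx /=.
have -> : (ord_max : 'I_N.+2) = lift ord0 (ord_max : 'I_N.+1) by exact: val_inj.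
rewrite ffunE liftK -mulrA mulrCA; congr (_ * (_ * _)).
  rewrite /src /dst !ffunE liftK.
  by rewrite (_ : widen_ord _ _ = ord0) ?unlift_none //; exact: val_inj.
apply: eq_bigr => t _; rewrite /src /dst.
rewrite (_ : widen_ord _ _ = lift ord0 (widen_ord (leqnSn N) t)); last exact: val_inj.
by rewrite !ffunE !liftK.
Qed.

Lemma trace_walk (R : comNzRingType) (n N : nat) (M : 'M[R]_n) :
  \tr (M ^+ N) = \sum_(u : {ffun 'I_N.+1 -> 'I_n})
    (u ord0 == u ord_max)%:R * \prod_t M (src u t) (dst u t).
Proof.
rewrite /mxtrace; under eq_bigr do rewrite expmx_walk.
rewrite exchange_big /=; apply: eq_bigr => u _.
rewrite (bigD1 (u ord0)) //= eqxx /= [X in _ + X = _]big1 ?addr0 1?[u ord_max == _]eq_sym //.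
by move=> k; rewrite eq_sym => /negbTE ->; rewrite mul0r.
Qed.

(** * Equality patterns of maps *)

Section Kernels.
Variable T : finType.
Implicit Type V : finType.

(** The equality pattern of a map. As a set of pairs of arguments it does not mention the codomain,
    so walks on [n] and on [r'] vertices can share a pattern. *)
Definition ker V (u : {ffun T -> V}) : {set T * T} := [set x | u x.1 == u x.2].

Lemma kerE V (u : {ffun T -> V}) s t : (u s == u t) = ((s, t) \in ker u).
Proof. by rewrite inE. Qed.

Definition nvert V (u : {ffun T -> V}) : nat := #|[set u t | t : T]|.

Lemma nvert_ker V V' (u : {ffun T -> V}) (u' : {ffun T -> V'}) :
  ker u = ker u' -> nvert u = nvert u'.
Proof.
move=> K; rewrite /nvert.
have eqT s t : (u s == u t) = (u' s == u' t) by rewrite !kerE K.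
have sub V1 V2 (v : {ffun T -> V1}) (v' : {ffun T -> V2}) :
    (forall s t, (v s == v t) = (v' s == v' t)) ->
    (#|[set v t | t : T]| <= #|[set v' t | t : T]|)%N.
  move=> e; pose f x := if [pick t | v t == x] is Some t then Some (v' t) else None.
  have SI : injective (@Some V2) by move=> x y [].
  rewrite -(card_imset _ SI).
  have <- : #|f @: [set v t | t : T]| = #|[set v t | t : T]|.
    apply: card_in_imset => x y /imsetP[s _ ->] /imsetP[t _ ->]; rewrite /f.
    case: pickP => [s' /eqP <-|/(_ s)]; last by rewrite eqxx.
    case: pickP => [t' /eqP <-|/(_ t)]; last by rewrite eqxx.
    by case=> /eqP; rewrite -e => /eqP.
  apply/subset_leq_card/fintype.subsetP => y /imsetP[x /imsetP[s _ ->] ->].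
  rewrite /f; case: pickP => [s' _|/(_ s)]; last by rewrite eqxx.
  by apply: imset_f; apply: imset_f.
by apply/eqP; rewrite eqn_leq !sub.
Qed.

(** A map with the pattern of [u0] is the quotient map [rho] of [u0] onto its classes followed by an
    injection; [phi] is this correspondence. *)
Lemma card_ker V V0 (t0 : T) (u0 : {ffun T -> V0}) :
  #|[set u : {ffun T -> V} | ker u == ker u0]| = (#|V| ^_ nvert u0)%N.
Proof.
set m := nvert u0; pose A := [set u0 t | t : T].
have uA t : u0 t \in A by exact: imset_f.
pose rho t : 'I_m := enum_rank_in (uA t0) (u0 t).
have rhoE s t : (rho s == rho t) = (u0 s == u0 t).
  apply/eqP/eqP => [|e]; last by rewrite /rho e.
  by move/(congr1 (@enum_val _ _)); rewrite !enum_rankK_in.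
have rho_surj i : exists t, rho t == i.
  have /imsetP[t _ e] := enum_valP i; exists t.
  by rewrite /rho -e enum_valK_in.
rewrite -[X in (_ ^_ X)%N]card_ord -card_inj_ffuns.
pose phi (h : {ffun 'I_m -> V}) : {ffun T -> V} := [ffun t => h (rho t)].
have phi_inj : injective phi.
  move=> h h' e; apply/ffunP => i; have [t /eqP <-] := rho_surj i.
  by have := congr1 (fun f : {ffun T -> V} => f t) e; rewrite !ffunE.
rewrite -(card_imset _ phi_inj); apply: eq_card => u; rewrite inE.
apply/eqP/imsetP => [K|[h]].
  have uE s t : (u s == u t) = (rho s == rho t) by rewrite rhoE !kerE K.
  have xc i : rho (xchoose (rho_surj i)) = i by exact/eqP/(xchooseP (rho_surj i)).
  exists [ffun i => u (xchoose (rho_surj i))].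
    rewrite inE; apply/injectiveP => i j; rewrite !ffunE => /eqP.
    by rewrite uE !xc => /eqP.
  by apply/ffunP => t; rewrite !ffunE; apply/eqP; rewrite uE xc.
rewrite inE => /injectiveP hI ->; apply/setP => -[s t]; rewrite -!kerE !ffunE.
by rewrite (inj_eq hI) rhoE.
Qed.

End Kernels.

(** * Closed walks in which every edge recurs *)

Section GoodWalks.
Variable N : nat.
Implicit Type V : finType.

Definition same_edge V (u : {ffun 'I_N.+1 -> V}) (s t : 'I_N) : bool :=
  ((src u s == src u t) && (dst u s == dst u t)) ||
  ((src u s == dst u t) && (dst u s == src u t)).

(** Written with equalities of vertices alone, without the order that [edge] uses, so that it
    depends on the pattern only and makes sense over any vertex set. *)
Definition good V (u : {ffun 'I_N.+1 -> V}) : bool :=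
  [&& u ord0 == u ord_max, [forall t, src u t != dst u t] &
      [forall t, [exists t', (t' != t) && same_edge u t t']]].

Lemma good_ker V V' (u : {ffun 'I_N.+1 -> V}) (u' : {ffun 'I_N.+1 -> V'}) :
  ker u = ker u' -> good u = good u'.
Proof.
move=> K; have e s t : (u s == u t) = (u' s == u' t) by rewrite !kerE K.
rewrite /good e; congr [&& _, _ & _]; apply: eq_forallb => t.
  by rewrite /src /dst e.
by apply: eq_existsb => t'; rewrite /same_edge /src /dst !e.
Qed.

Variable n : nat.
Implicit Type u : {ffun 'I_N.+1 -> 'I_n}.

Definition step_edge u t : 'I_n * 'I_n := edge (src u t) (dst u t).

Definition mult u (x : 'I_n * 'I_n) : nat := #|[set t | step_edge u t == x]|.

Definition used u : {set 'I_n * 'I_n} := [set x | (0 < mult u x)%N].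

Lemma same_edgeE u s t : same_edge u s t = (step_edge u s == step_edge u t).
Proof. by rewrite edge_eqP. Qed.

Lemma sum_mult u : (\sum_x mult u x = N)%N.
Proof.
transitivity (\sum_x \sum_(t | step_edge u t == x) 1)%N.
  by apply: eq_bigr => x _; rewrite sum1dep_card.
rewrite -[RHS](card_ord N) -sum1_card.
by rewrite [RHS](partition_big (step_edge u) xpredT).
Qed.

Lemma good_mult u x : good u -> mult u x != 1%N.
Proof.
case/and3P=> _ _ /forallP h; apply/negP => /cards1P[t e].
have /eqP et : t \in [set t] by rewrite inE.
have : t \in [set t] by rewrite inE.
rewrite -e inE => /eqP ext.
have /existsP[t' /andP[t't]] := h t; rewrite same_edgeE => /eqP e'.
have : t' \in [set t] by rewrite -e inE -e' ext.
by rewrite inE (negbTE t't).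
Qed.

Lemma not_good_mult u : u ord0 == u ord_max -> (forall t, src u t != dst u t) ->
  ~~ good u -> exists x, mult u x = 1%N.
Proof.
move=> c nl; rewrite /good c /=.
have -> /= : [forall t, src u t != dst u t] by apply/forallP.
rewrite negb_forall => /existsP[t]; rewrite negb_exists => /forallP h.
exists (step_edge u t); apply/eqP/cards1P; exists t.
apply/setP => t'; rewrite !inE; have := h t'.
rewrite same_edgeE [step_edge u t == _]eq_sym negb_and negbK.
by have [->|_] := eqVneq t' t; rewrite ?eqxx //= => /negbTE.
Qed.

Lemma card_used u : good u -> (2 * #|used u| <= N)%N.
Proof.
move=> gu; apply: (@leq_trans (\sum_x mult u x)); last by rewrite sum_mult.
rewrite (bigID (mem (used u))) /=.
apply: (leq_trans _ (leq_addr _ _)); rewrite mulnC -sum_nat_const.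
apply: leq_sum => x; rewrite inE => x0; have := good_mult x gu; lia.
Qed.

(* Sending a vertex to the edge along which it is first reached is injective. *)
Lemma nvert_used u : (nvert u <= #|used u|.+1)%N.
Proof.
pose A := [set u t | t : 'I_N.+1]; pose A' := A :\ u ord0.
have -> : nvert u = #|A'|.+1.
  by rewrite /nvert (cardsD1 (u ord0)) imset_f //.
rewrite ltnS.
have ex x : x \in A' -> exists t, u t == x.
  by rewrite !inE => /andP[_ /imsetP[t _ ->]]; exists t.
pose first x : 'I_N.+1 := [arg min_(t < (odflt ord0 [pick t | u t == x]) | u t == x) t].
have firstP x : x \in A' -> u (first x) = x /\ forall t, u t = x -> (first x <= t)%N.
  move=> xA; rewrite /first; case: arg_minnP => [|t /eqP tx m].
    by case: pickP => [t //|h]; have [t] := ex _ xA; rewrite h.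
  by split=> // t' /eqP; exact: m.
pose arr x : 'I_n * 'I_n :=
  if unlift ord0 (first x) is Some t then step_edge u t else (x, x).
have arrP x : x \in A' -> exists t : 'I_N, [/\ first x = lift ord0 t,
    arr x = step_edge u t & x = dst u t].
  move=> xA; have [ux fx] := firstP x xA; rewrite /arr.
  case: unliftP => [t e|e]; first by exists t; split=> //; rewrite /dst -e.
  by move: xA; rewrite !inE -ux e eqxx.
have arr_inj : {in A' &, injective arr}.
  move=> x y xA yA; have [s [fs -> xs]] := arrP x xA; have [t [ft -> yt]] := arrP y yA.
  have [_ mx] := firstP x xA; have [_ my] := firstP y yA.
  move=> /eqP; rewrite edge_eqP => /orP[/andP[_ /eqP e]|/andP[/eqP e1 /eqP e2]].
    by rewrite xs yt.
  (* Had the two vertices been first reached along one edge in opposite directions, each would have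
     been visited before the other. *)
  have := mx (widen_ord (leqnSn N) t); rewrite -/(src u t) -e2 -xs => /(_ erefl).
  have := my (widen_ord (leqnSn N) s); rewrite -/(src u s) e1 -yt => /(_ erefl).
  by rewrite fs ft !lift0 /=; lia.
rewrite -(card_in_imset arr_inj); apply/subset_leq_card/fintype.subsetP => x /imsetP[y yA ->].
have [t [_ -> _]] := arrP y yA; rewrite inE /mult card_gt0; apply/set0Pn.
by exists t; rewrite inE.
Qed.

End GoodWalks.

(** * Expected products along walks and comparison of traces *)

Section WalkExpectation.
Variables (R : realType) (n N : nat) (r : 'I_n * 'I_n -> R).
Hypothesis r01 : forall x, 0 <= r x <= 1.
Implicit Type u : {ffun 'I_N.+1 -> 'I_n}.

Definition cmx (a : {ffun 'I_n * 'I_n -> bool}) : 'M[R]_n := symmx (centered r a).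

Definition walk_moment u : R :=
  Ex r (fun a => \prod_t cmx a (src u t) (dst u t)).

Lemma walk_moment_loop u : ~~ [forall t, src u t != dst u t] -> walk_moment u = 0.
Proof.
rewrite negb_forall => /existsP[t /negPn /eqP e]; rewrite /walk_moment.
rewrite -(Ex_cst r 0); apply: eq_Ex => a.
by rewrite (bigD1 t) //= symmxE e eqxx mul0r.
Qed.

Lemma walk_moment_noloop u : [forall t, src u t != dst u t] ->
  walk_moment u = \prod_x bern_moment (r x) (mult u x).
Proof.
move/forallP => h; rewrite -Ex_centered_prod; apply: eq_Ex => a.
transitivity (\prod_t centered r a (step_edge u t)).
  by apply: eq_bigr => t _; rewrite symmxE (negbTE (h t)).
rewrite (partition_big (step_edge u) xpredT) //=; apply: eq_bigr => x _.
rewrite (eq_bigr (fun=> centered r a x)); last by move=> t /eqP ->.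
by rewrite prodr_const /mult; congr (_ ^+ _); apply: eq_card => t; rewrite !inE.
Qed.

Lemma walk_moment_not_good u : u ord0 == u ord_max -> ~~ good u -> walk_moment u = 0.
Proof.
move=> c ng; have [nl|] := boolP [forall t, src u t != dst u t]; last first.
  exact: walk_moment_loop.
rewrite walk_moment_noloop //.
have [x x1] := not_good_mult c (fun t => forallP nl t) ng.
by rewrite (bigD1 x) //= x1 bern_moment1 mul0r.
Qed.

(** Each used edge contributes at most [p], and there are at least [nvert u - 1] of them. The
    exponent is in terms of vertices because the number of walks with a given pattern is too. *)
Lemma walk_moment_le u (p : R) : p <= 1 -> (forall x, r x <= p) -> good u ->
  walk_moment u <= p ^+ (nvert u).-1.
Proof.
move=> p1 rp gu; have [_ nl _] := and3P gu.
rewrite walk_moment_noloop //; apply: (le_trans (ler_norm _)); rewrite normr_prod.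
have p0 : 0 <= p.
  by have /andP[h _] := r01 (u ord0, u ord0); exact: (le_trans h).
apply: (@le_trans _ _ (\prod_(x in used u) p)); last first.
  rewrite prodr_const; apply: ler_wiXn2l; rewrite ?p0 ?p1 //.
  by have := nvert_used u; lia.
rewrite [leRHS]big_mkcond; apply: ler_prod => x _; rewrite normr_ge0 /= inE.
case: ltnP => [m0|]; last by rewrite leqn0 => /eqP ->; rewrite bern_moment0 normr1.
apply: (le_trans (bern_moment_le (r01 x) _)) => //.
by have := good_mult x gu; lia.
Qed.

Lemma trace_expectation :
  Ex r (fun a => \tr (cmx a ^+ N)) =
  \sum_(u : {ffun 'I_N.+1 -> 'I_n} | good u) walk_moment u.
Proof.
under eq_Ex do rewrite trace_walk.
rewrite Ex_sum [RHS]big_mkcond; apply: eq_bigr => u _; rewrite ExZ -/(walk_moment u).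
case: ifP => gu; first by case/and3P: gu => -> _ _; rewrite mul1r.
have [c|_] := boolP (u ord0 == u ord_max); last by rewrite mul0r.
by rewrite walk_moment_not_good ?gu // mulr0.
Qed.

End WalkExpectation.

(** The multiplicities sum to [N], so [3 ^+ N] can be shared out among the edges, each of
    multiplicity 0 or at least 2. *)
Lemma walk_moment_third (R : realType) (n N : nat) (u : {ffun 'I_N.+1 -> 'I_n}) :
  good u -> 1 <= 3 ^+ N * walk_moment (fun=> 3^-1 : R) u.
Proof.
move=> gu; have [_ nl _] := and3P gu; rewrite walk_moment_noloop //.
have -> : 3 ^+ N = \prod_x 3 ^+ mult u x :> R by rewrite prodrXr sum_mult.
rewrite -big_split /=; apply: (@le_trans _ _ (\prod_(x : 'I_n * 'I_n) 1)); first by rewrite big1.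
apply: ler_prod => x _; rewrite ler01 /=.
have := good_mult x gu; case: (mult u x) => [|[|k]] // _.
  by rewrite bern_moment0 mulr1.
exact: bern_moment_third.
Qed.

Lemma ffact_ge (r L m : nat) : (m <= L.+1)%N -> (L <= r)%N -> ((r - L) ^ m <= r ^_ m)%N.
Proof.
move=> mL Lr; elim: m mL => [|m IH] // mL; rewrite ffactnSr expnSr leq_mul //.
  by apply: IH; lia.
lia.
Qed.

Lemma ffact_le (n m : nat) : (n ^_ m <= n ^ m)%N.
Proof. by elim: m => [|m IH] //; rewrite ffactnSr expnSr leq_mul // leq_subr. Qed.

(* Both sides are sums over equality patterns [kap]; a pattern with [m] classes
   is realised by [n ^_ m] walks on [n] points, and [m <= L + 1]. *)
Lemma good_walk_comparison (R : realType) (n r' L : nat) (p : R) :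
  0 <= p -> 1 <= n%:R * p -> n%:R * p <= (r' - L)%:R -> (L <= r')%N ->
  \sum_(u : {ffun 'I_(2 * L).+1 -> 'I_n} | good u) p ^+ (nvert u).-1 <=
  n%:R * \sum_(u : {ffun 'I_(2 * L).+1 -> 'I_r'} | good u) 1.
Proof.
move=> p0 np1 npr Lr.
rewrite (partition_big (@ker _ 'I_n) xpredT) //= mulr_sumr.
rewrite [leRHS](partition_big (@ker _ 'I_r') xpredT) //=.
apply: ler_sum => kap _; rewrite -mulr_sumr.
have [u0 /andP[gu0 /eqP ku0]|h] :=
    pickP (fun u : {ffun 'I_(2 * L).+1 -> 'I_n} => good u && (ker u == kap)); last first.
  by rewrite big1 ?mulr_ge0 ?sumr_ge0 // => u; rewrite h.
set m := nvert u0.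
have mL : (m <= L.+1)%N.
  by have := nvert_used u0; have := card_used gu0; rewrite -/m; lia.
have m0 : (0 < m)%N.
  by rewrite card_gt0; apply/set0Pn; exists (u0 ord0); exact: imset_f.
have cnt (V : finType) : \sum_(u : {ffun 'I_(2 * L).+1 -> V} | good u && (ker u == kap)) 1 =
    (#|V| ^_ m)%:R :> R.
  rewrite -(card_ker V ord0 u0) sumr_const; congr (_%:R); apply: eq_card => u.
  rewrite !inE -ku0 unfold_in; case: eqP => [K|]; rewrite ?andbF // andbT.
  by rewrite (good_ker K).
rewrite (eq_bigr (fun=> p ^+ m.-1 * 1)); last first.
  by move=> u /andP[_ /eqP K]; rewrite mulr1 /m (@nvert_ker _ _ _ u u0) // K.
rewrite -mulr_sumr !cnt !card_ord.
(* The chain is [p^(m-1) n^_m <= n (n p)^(m-1) <= n (n p)^m <= n (r' - L)^m <= n r'^_m], the last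
   step using [m <= L + 1]. *)
apply: (@le_trans _ _ (n%:R * (n%:R * p) ^+ m)); last first.
  rewrite ler_wpM2l //; apply: (@le_trans _ _ ((r' - L)%:R ^+ m)).
    by rewrite lerXn2r ?nnegrE ?mulr_ge0.
  by rewrite -natrX ler_nat ffact_ge.
apply: (@le_trans _ _ (p ^+ m.-1 * n%:R ^+ m)).
  by rewrite ler_wpM2l ?exprn_ge0 // -natrX ler_nat ffact_le.
case: m m0 {mL cnt} => //= m _.
have -> : p ^+ m * n%:R ^+ m.+1 = n%:R * (n%:R * p) ^+ m by rewrite exprS exprMn; ring.
by rewrite ler_wpM2l // [leRHS]exprS ler_peMl // exprn_ge0 // mulr_ge0.
Qed.

Lemma trace_comparison (R : realType) (n r' L : nat) (r : 'I_n * 'I_n -> R) (p : R) :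
  (forall x, 0 <= r x <= p) -> p <= 1 -> 0 <= p ->
  1 <= n%:R * p -> n%:R * p <= (r' - L)%:R -> (L <= r')%N ->
  Ex r (fun a => \tr (cmx r a ^+ (2 * L))) <=
  n%:R * 3 ^+ (2 * L) *
    Ex (fun=> 3^-1) (fun a => \tr (cmx (fun _ : 'I_r' * 'I_r' => 3^-1) a ^+ (2 * L))).
Proof.
move=> rp p1 p0 np1 npr Lr; rewrite !trace_expectation.
apply: (@le_trans _ _ (\sum_(u : {ffun 'I_(2 * L).+1 -> 'I_n} | good u) p ^+ (nvert u).-1)).
  apply: ler_sum => u gu; apply: walk_moment_le => //.
    by move=> x; have /andP[-> h] := rp x; rewrite (le_trans h).
  by move=> x; have /andP[] := rp x.
apply: (le_trans (good_walk_comparison p0 np1 npr Lr)).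
rewrite -mulrA ler_wpM2l // mulr_sumr; apply: ler_sum => u gu.
exact: walk_moment_third.
Qed.

(** * Euclidean norm and operator bounds *)

Section EuclideanNorm.
Variable R : realType.

Definition dot n (u v : 'cV[R]_n) : R := \sum_i u i 0 * v i 0.

Section Dim.
Variable n : nat.
Implicit Types (u v w x y : 'cV[R]_n) (M : 'M[R]_n) (c nu : R).
Local Notation "'N2' v" := (euclid_norm v) (at level 10, v at level 9).

Lemma dotC u v : dot u v = dot v u.
Proof. by apply: eq_bigr => i _; rewrite mulrC. Qed.

Lemma dotDl u v w : dot (u + v) w = dot u w + dot v w.
Proof. by rewrite /dot -big_split; apply: eq_bigr => i _; rewrite mxE mulrDl. Qed.

Lemma dotDr u v w : dot w (u + v) = dot w u + dot w v.
Proof. by rewrite dotC dotDl !(dotC w). Qed.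

Lemma dotZl c u v : dot (c *: u) v = c * dot u v.
Proof. by rewrite /dot mulr_sumr; apply: eq_bigr => i _; rewrite mxE mulrA. Qed.

Lemma dotZr c u v : dot u (c *: v) = c * dot u v.
Proof. by rewrite dotC dotZl dotC. Qed.

Lemma dot_ge0 u : 0 <= dot u u.
Proof. by apply: sumr_ge0 => i _; rewrite -expr2 sqr_ge0. Qed.

Lemma enorm_ge0 u : 0 <= N2 u.
Proof. exact: sqrtr_ge0. Qed.

Lemma enorm_sqr u : N2 u ^+ 2 = dot u u.
Proof.
have -> : dot u u = \sum_l u l 0 ^+ 2 by apply: eq_bigr => i _; rewrite expr2.
by rewrite sqr_sqrtr // sumr_ge0 // => i _; rewrite sqr_ge0.
Qed.

Lemma dot_eq0 u : dot u u = 0 -> u = 0.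
Proof.
have h i : true -> 0 <= u i 0 * u i 0 by rewrite -expr2 sqr_ge0.
move=> u0; apply/colP => i; rewrite mxE.
by have /eqP := psumr_eq0P h u0 (i := i) isT; rewrite mulf_eq0 orbb => /eqP.
Qed.

Lemma cauchy_schwarz_sqr u v : dot u v ^+ 2 <= dot u u * dot v v.
Proof.
have [v0|v0] := eqVneq (dot v v) 0.
  have vi i : v i 0 = 0 by rewrite (dot_eq0 v0) mxE.
  have -> : dot u v = 0 by apply: big1 => i _; rewrite vi mulr0.
  by rewrite v0 mulr0 expr0n.
have v1 : 0 < dot v v by rewrite lt_neqAle eq_sym v0 dot_ge0.
have := dot_ge0 (dot v v *: u - dot u v *: v).
rewrite -scaleNr !(dotDl, dotDr) !(dotZl, dotZr) (dotC v u) => h.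
have : 0 <= dot v v * (dot u u * dot v v - dot u v ^+ 2) by apply: (le_trans h); nra.
by rewrite pmulr_rge0 // subr_ge0.
Qed.

Lemma cauchy_schwarz u v : `|dot u v| <= N2 u * N2 v.
Proof.
rewrite -(ler_pXn2r (n := 2)) ?nnegrE ?mulr_ge0 ?enorm_ge0 ?normr_ge0 //.
by rewrite real_normK ?num_real // exprMn !enorm_sqr cauchy_schwarz_sqr.
Qed.

Lemma enormZ c u : N2 (c *: u) = `|c| * N2 u.
Proof.
apply/eqP; rewrite -(eqrXn2 (n := 2)) ?mulr_ge0 ?enorm_ge0 ?normr_ge0 //.
by rewrite exprMn !enorm_sqr dotZl dotZr real_normK ?num_real // mulrA -expr2.
Qed.

Lemma enorm0 : N2 (0 : 'cV[R]_n) = 0.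
Proof. by rewrite -[0 : 'cV_n](scale0r 0) enormZ normr0 mul0r. Qed.

Lemma enormN u : N2 (- u) = N2 u.
Proof. by rewrite -scaleN1r enormZ normrN1 mul1r. Qed.

Lemma enormD u v : N2 (u + v) <= N2 u + N2 v.
Proof.
rewrite -(ler_pXn2r (n := 2)) ?nnegrE ?addr_ge0 ?enorm_ge0 //.
rewrite enorm_sqr dotDl !dotDr -!enorm_sqr (dotC v u).
have := le_trans (ler_norm _) (cauchy_schwarz u v); rewrite sqrrD; lra.
Qed.

Lemma enorm_eq0 u : N2 u = 0 -> u = 0.
Proof. by move=> u0; apply: dot_eq0; rewrite -enorm_sqr u0 expr0n. Qed.

Lemma enorm_entry u i : `|u i 0| <= N2 u.
Proof.
rewrite -(ler_pXn2r (n := 2)) ?nnegrE ?enorm_ge0 ?normr_ge0 //.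
rewrite real_normK ?num_real // enorm_sqr /dot (bigD1 i) //= -expr2 lerDl.
by apply: sumr_ge0 => j _; rewrite -expr2 sqr_ge0.
Qed.

Lemma enorm_le u c : 0 <= c -> (forall i, `|u i 0| <= c) -> N2 u <= Num.sqrt n%:R * c.
Proof.
move=> c0 uc; rewrite -(ler_pXn2r (n := 2)) ?nnegrE ?mulr_ge0 ?sqrtr_ge0 ?enorm_ge0 //.
rewrite enorm_sqr exprMn sqr_sqrtr ?ler0n // -[n in n%:R]card_ord mulr_natl -sumr_const.
apply: ler_sum => i _; rewrite -expr2 -(real_normK (num_real (u i 0))).
by rewrite lerXn2r ?nnegrE.
Qed.

Definition op_le M nu := forall x, N2 (M *m x) <= nu * N2 x.

Lemma op_le_exp M nu k x : 0 <= nu -> op_le M nu ->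
  N2 (M ^+ k *m x) <= nu ^+ k * N2 x.
Proof.
move=> nu0 h; elim: k => [|k IH]; first by rewrite !expr0 mul1mx mul1r.
rewrite exprS -mulmxE -mulmxA; apply: (le_trans (h _)).
by rewrite exprS -mulrA ler_wpM2l.
Qed.

Lemma dot_mulmx_sym M u v : M^T = M -> dot (M *m u) v = dot u (M *m v).
Proof.
move=> Ms; rewrite /dot.
under eq_bigr => i _ do rewrite mxE mulr_suml.
under [RHS]eq_bigr => i _ do rewrite mxE mulr_sumr.
rewrite exchange_big; apply: eq_bigr => i _; apply: eq_bigr => j _.
by rewrite -[M in LHS]Ms mxE; ring.
Qed.

Lemma trmx_exp M k : M^T = M -> (M ^+ k)^T = M ^+ k.
Proof.
move=> Ms; elim: k => [|k IH]; first by rewrite expr0 trmx1.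
by rewrite {1}exprS -mulmxE trmx_mul IH Ms mulmxE -exprSr.
Qed.

Definition frob2 M : R := \sum_i \sum_j M i j ^+ 2.

Lemma frob2_ge0 M : 0 <= frob2 M.
Proof. by apply: sumr_ge0 => i _; apply: sumr_ge0 => j _; rewrite sqr_ge0. Qed.

Lemma op_le_frob M : op_le M (Num.sqrt (frob2 M)).
Proof.
move=> x; rewrite -(ler_pXn2r (n := 2)) ?nnegrE ?mulr_ge0 ?sqrtr_ge0 ?enorm_ge0 //.
rewrite exprMn !enorm_sqr sqr_sqrtr ?frob2_ge0 // mulr_suml; apply: ler_sum => i _.
have -> : (M *m x) i 0 = dot (row i M)^T x.
  by rewrite mxE; apply: eq_bigr => j _; rewrite !mxE.
rewrite -expr2; apply: (le_trans (cauchy_schwarz_sqr _ _)).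
rewrite ler_wpM2r ?dot_ge0 //; apply: ler_sum => j _.
by rewrite !mxE expr2.
Qed.

Lemma trace_even_power M L : M^T = M -> \tr (M ^+ (2 * L)) = frob2 (M ^+ L).
Proof.
move=> Ms; rewrite mul2n -addnn exprD -mulmxE /mxtrace; apply: eq_bigr => i _.
rewrite mxE; apply: eq_bigr => j _.
by rewrite expr2 -{2}(trmx_exp L Ms) [_^T j i]mxE.
Qed.

(** Repeated squaring: [|M^K x|^2 = <x, M^(2K) x> <= |x| |M^(2K) x|] by symmetry and Cauchy-Schwarz.
    It stands in for diagonalisation and is the reason for exponents that are powers of two. *)
Lemma enorm_pow2 M t x : M^T = M ->
  N2 (M *m x) ^+ (2 ^ t) <= N2 x ^+ (2 ^ t).-1 * N2 (M ^+ (2 ^ t) *m x).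
Proof.
move=> Ms; elim: t => [|t IH]; first by rewrite !expr1 expr0 mul1r.
set K := (2 ^ t)%N in IH *.
have -> : (2 ^ t.+1 = K * 2)%N by rewrite expnSr.
have K0 : (0 < K)%N by rewrite expn_gt0.
rewrite exprM.
apply: (@le_trans _ _ ((N2 x ^+ K.-1 * N2 (M ^+ K *m x)) ^+ 2)).
  by rewrite lerXn2r ?nnegrE ?exprn_ge0 ?mulr_ge0 ?exprn_ge0 ?enorm_ge0.
rewrite exprMn -exprM enorm_sqr dot_mulmx_sym ?trmx_exp // mulmxA mulmxE -exprD addnn -muln2.
have -> : (K * 2).-1 = (K.-1 * 2).+1 by lia.
rewrite exprSr -mulrA ler_wpM2l ?exprn_ge0 ?enorm_ge0 //.
exact: le_trans (ler_norm _) (cauchy_schwarz _ _).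
Qed.

(** The trace is the squared Frobenius norm of [M^(2^t)], which bounds [|M^(2^t) x|]; [enorm_pow2]
    then allows a root to be taken. *)
Lemma op_le_trace M t nu : M^T = M -> 0 <= nu ->
  \tr (M ^+ (2 * 2 ^ t)) <= nu ^+ (2 * 2 ^ t) -> op_le M nu.
Proof.
move=> Ms nu0; rewrite trace_even_power // => h x.
have K0 : (0 < 2 ^ t)%N by rewrite expn_gt0.
rewrite -(ler_pXn2r K0) ?nnegrE ?mulr_ge0 ?enorm_ge0 //.
apply: (le_trans (enorm_pow2 _ _ Ms)).
have h1 : N2 (M ^+ (2 ^ t) *m x) <= nu ^+ (2 ^ t) * N2 x.
  apply: (le_trans (op_le_frob _ _)); rewrite ler_wpM2r ?enorm_ge0 //.
  rewrite -(ler_pXn2r (n := 2)) ?nnegrE ?sqrtr_ge0 ?exprn_ge0 //.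
  by rewrite sqr_sqrtr ?frob2_ge0 // -exprM mulnC.
apply: (le_trans (ler_wpM2l _ h1)); first by rewrite exprn_ge0 ?enorm_ge0.
by rewrite exprMn mulrCA ler_wpM2l ?exprn_ge0 // -exprSr prednK.
Qed.

Lemma trace_op_le M L nu : M^T = M -> 0 <= nu -> op_le M nu ->
  \tr (M ^+ (2 * L)) <= n%:R * (nu ^+ 2) ^+ L.
Proof.
move=> Ms nu0 h; rewrite trace_even_power // /frob2 exchange_big /=.
rewrite -[n in leRHS]card_ord mulr_natl -sumr_const; apply: ler_sum => j _.
have -> : \sum_i (M ^+ L) i j ^+ 2 = N2 (M ^+ L *m delta_mx j 0) ^+ 2.
  rewrite enorm_sqr; apply: eq_bigr => i _; rewrite -colE mxE.
  by rewrite expr2.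
rewrite -exprM mulnC exprM lerXn2r ?nnegrE ?exprn_ge0 ?enorm_ge0 //.
apply: (le_trans (op_le_exp _ _ nu0 h)).
have -> : N2 (delta_mx j 0 : 'cV[R]_n) = 1; last by rewrite mulr1.
apply/eqP; rewrite -(eqrXn2 (n := 2)) ?enorm_ge0 ?ler01 // enorm_sqr expr1n.
rewrite /dot (bigD1 j) //= big1 ?addr0.
  by rewrite !mxE !eqxx mulr1.
by move=> i /negbTE ij; rewrite !mxE ij mul0r.
Qed.

Lemma symmx_tr (g : 'I_n * 'I_n -> R) : (symmx g)^T = symmx g.
Proof. by apply/matrixP => i j; rewrite mxE symmx_sym. Qed.

(** Collecting both occurrences of each edge makes the bilinear form linear in independent
    variables. *)
Lemma dot_symmx (g : 'I_n * 'I_n -> R) x y :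
  dot x (symmx g *m y) = \sum_(e : 'I_n * 'I_n) (if (e.1 < e.2)%N then
     x e.1 0 * y e.2 0 + x e.2 0 * y e.1 0 else 0) * g e.
Proof.
transitivity (\sum_(i < n) \sum_(j < n) (if (i < j)%N then
    x i 0 * y j 0 + x j 0 * y i 0 else 0) * g (i, j)); last first.
  by rewrite pair_bigA; apply: eq_bigr => -[].
pose h (i j : 'I_n) := if (i < j)%N then g (i, j) else 0.
transitivity (\sum_i \sum_j (x i 0 * h i j * y j 0 + x i 0 * h j i * y j 0)).
  apply: eq_bigr => i _; rewrite mxE mulr_sumr; apply: eq_bigr => j _.
  by rewrite mxE /h; case: ltngtP => _; ring.
under eq_bigr do rewrite big_split.
rewrite big_split /= [X in _ + X]exchange_big /= -big_split; apply: eq_bigr => i _.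
rewrite -big_split; apply: eq_bigr => j _ /=; rewrite /h.
by case: ifP => _; ring.
Qed.

End Dim.
End EuclideanNorm.

(** * The dense comparison matrix *)

Section Grid.
Variables (R : realType) (m : nat).
Hypothesis m0 : (0 < m)%N.
Implicit Types (Y : 'M[R]_m) (u w : 'cV[R]_m).

(** A sign and a magnitude for each coordinate, in units of [1 / (4 sqrt m)]. Magnitudes up to [4 m]
    reach the whole unit ball because [sqrt m <= m]. *)
Definition gcode := {ffun 'I_m -> bool * 'I_(4 * m).+1}.

Definition gpoint (z : gcode) : 'cV[R]_m :=
  \col_i ((-1) ^+ (z i).1 * ((z i).2 : nat)%:R / (4 * Num.sqrt m%:R)).

(** Rounding a vector [u] of the unit ball gives magnitudes with [k_i <= k_i^2 <= 16 m u_i^2], which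
    sum to at most [16 m]. The constraint keeps the number of points exponential in [m]. *)
Definition grid : {set gcode} := [set z : gcode | (\sum_i (z i).2 <= 16 * m)%N].

Let sm : R := Num.sqrt m%:R.

Let sm_gt0 : 0 < sm.
Proof. by rewrite sqrtr_gt0 ltr0n. Qed.

Let sm2 : sm ^+ 2 = m%:R.
Proof. by rewrite sqr_sqrtr. Qed.

Let sm_le : sm <= m%:R.
Proof.
have : 1 <= sm.
  by rewrite -(ler_pXn2r (n := 2)) ?nnegrE ?(ltW sm_gt0) // sm2 expr1n ler1n.
by rewrite -sm2; have := sm_gt0; nra.
Qed.

(** Each coordinate is rounded towards 0: the norm does not grow, and the error is at most
    [1 / (4 sqrt m)] per coordinate. *)
Lemma grid_round u : euclid_norm u <= 1 -> exists z, [/\ z \in grid,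
  euclid_norm (gpoint z) <= 1 & euclid_norm (u - gpoint z) <= 4^-1].
Proof.
move=> u1.
have u1' : dot u u <= 1 by rewrite -enorm_sqr exprn_ile1 ?enorm_ge0.
pose k i := Num.truncn (4 * sm * `|u i 0|).
have kP i : (k i)%:R <= 4 * sm * `|u i 0| < (k i).+1%:R.
  by apply: Num.Theory.truncn_itv; rewrite !mulr_ge0 ?normr_ge0 // ltW.
have kb i : (k i < (4 * m).+1)%N.
  rewrite ltnS -(ler_nat R) natrM; have /andP[h _] := kP i; apply: (le_trans h).
  have h1 := le_trans (enorm_entry u i) u1; have h2 := normr_ge0 (u i 0).
  have := sm_le; have := sm_gt0; nra.
pose z : gcode := [ffun i => (u i 0 < 0, Ordinal (kb i))].
have gE i : gpoint z i 0 = (-1) ^+ (u i 0 < 0)%R * (k i)%:R / (4 * sm).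
  by rewrite mxE ffunE.
have uE i : u i 0 = (-1) ^+ (u i 0 < 0)%R * `|u i 0| by rewrite mulr_sign_norm.
have gn i : `|gpoint z i 0| <= `|u i 0|.
  rewrite gE !normrM normrX normrN1 expr1n mul1r normr_nat normfV.
  rewrite [`|_ * sm|]ger0_norm ?mulr_ge0 ?(ltW sm_gt0) // ler_pdivrMr ?mulr_gt0 //.
  by rewrite mulrC; have /andP[] := kP i.
exists z; split.
- rewrite inE -(ler_nat R) natr_sum natrM.
  apply: (@le_trans _ _ (\sum_i (16 * m%:R) * (u i 0 * u i 0))).
    apply: ler_sum => i _; rewrite ffunE /=.
    have /andP[h _] := kP i.
    have h2 : (k i)%:R ^+ 2 <= (4 * sm * `|u i 0|) ^+ 2 :> R.
      by rewrite lerXn2r ?nnegrE ?mulr_ge0 ?normr_ge0 // ltW.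
    apply: (@le_trans _ _ ((k i)%:R ^+ 2)).
      by rewrite -natrX ler_nat; case: (k i) => // j; rewrite expnS leq_pmulr.
    apply: (le_trans h2); rewrite !exprMn sm2 real_normK ?num_real // -expr2.
    by rewrite -natrX.
  rewrite -mulr_sumr ler_piMr ?mulr_ge0 //.
- apply: (le_trans _ u1); rewrite -(ler_pXn2r (n := 2)) ?nnegrE ?enorm_ge0 //.
  rewrite !enorm_sqr; apply: ler_sum => i _; rewrite -!expr2.
  rewrite -(real_normK (num_real (gpoint z i 0))) -(real_normK (num_real (u i 0))).
  by rewrite lerXn2r ?nnegrE ?normr_ge0.
- have -> : 4^-1 = Num.sqrt m%:R * (4 * sm)^-1.
    by rewrite -/sm; field; rewrite gt_eqF.
  apply: enorm_le; first by rewrite invr_ge0 mulr_ge0 // ltW.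
  move=> i; rewrite !mxE ffunE /= {1}uE -mulrA -mulrBr normrM normrX normrN1 expr1n mul1r.
  have /andP[h1 h2] := kP i; rewrite -[`|u i 0|](mulfK (x := 4 * sm)); last first.
    by rewrite mulf_neq0 ?gt_eqF.
  rewrite -mulrBl normrM [`|_^-1|]ger0_norm ?invr_ge0 ?mulr_ge0 ?(ltW sm_gt0) //.
  rewrite ler_piMl ?invr_ge0 ?mulr_ge0 ?(ltW sm_gt0) //.
  rewrite -natr1 in h2; rewrite mulrC ler_norml; apply/andP; split; lra.
Qed.

(** If [c] bounds the form on the unit ball, so does [b + c / 2], since rounding both arguments
    leaves two errors of norm at most 1/4. Iteration from the Frobenius norm tends to the fixed
    point [2 b]. *)
Lemma grid_op_le Y (b : R) :
  (forall z z', z \in grid -> z' \in grid ->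
     euclid_norm (gpoint z) <= 1 -> euclid_norm (gpoint z') <= 1 ->
     `|dot (gpoint z) (Y *m gpoint z')| <= b) ->
  op_le Y (2 * b).
Proof.
move=> gb.
pose bd (c : R) := forall u w, euclid_norm u <= 1 -> euclid_norm w <= 1 ->
  `|dot u (Y *m w)| <= c.
have bdS (c : R) : 0 <= c -> bd c -> bd (b + c / 2).
  move=> c0 bc u w u1 w1.
  have [z [zg z1 uz]] := grid_round u1; have [z' [zg' z1' wz]] := grid_round w1.
  have -> : dot u (Y *m w) = dot (gpoint z) (Y *m gpoint z') +
      (4^-1 * dot (4 *: (u - gpoint z)) (Y *m w) +
       4^-1 * dot (gpoint z) (Y *m (4 *: (w - gpoint z')))).
    rewrite -scalemxAr !dotZl !dotZr !mulKf ?pnatr_eq0 // mulmxBr.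
    by rewrite -(scaleN1r (gpoint z)) -(scaleN1r (Y *m gpoint z')) !dotDl !dotDr !dotZl !dotZr; ring.
  have h (v : 'cV[R]_m) : euclid_norm v <= 4^-1 -> euclid_norm (4 *: v) <= 1.
    by move=> v4; rewrite enormZ ger0_norm // mulrC -ler_pdivlMr // div1r.
  have b1 := gb _ _ zg zg' z1 z1'.
  have b2 := bc _ _ (h _ uz) w1; have b3 := bc _ _ z1 (h _ wz).
  apply: (le_trans (ler_normD _ _)).
  have : `|4^-1 * dot (4 *: (u - gpoint z)) (Y *m w) +
       4^-1 * dot (gpoint z) (Y *m (4 *: (w - gpoint z')))| <= 4^-1 * c + 4^-1 * c.
    apply: (le_trans (ler_normD _ _)); rewrite !normrM !(@ger0_norm _ 4^-1) ?invr_ge0 //.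
    by apply: lerD; apply: ler_wpM2l; rewrite ?invr_ge0.
  lra.
pose c0 := Num.sqrt (frob2 Y).
have c00 : 0 <= c0 by exact: sqrtr_ge0.
have bd0 : bd c0.
  move=> u w u1 w1; apply: (le_trans (cauchy_schwarz _ _)).
  apply: (@le_trans _ _ (1 * (c0 * 1))); last by rewrite mul1r mulr1.
  rewrite ler_pM ?enorm_ge0 //; apply: (le_trans (op_le_frob _ _)).
  by rewrite ler_wpM2l.
have b0 : 0 <= b.
  have : euclid_norm (0 : 'cV[R]_m) <= 1 by rewrite enorm0.
  case/grid_round => z [zg z1 _]; exact: (le_trans (normr_ge0 _) (gb _ _ zg zg z1 z1)).
have bdt t : bd (2 * b + c0 / 2 ^+ t).
  elim: t => [|t IH]; first by move=> u w u1 w1; rewrite expr0 divr1 (le_trans (bd0 _ _ u1 w1)) // lerDr mulr_ge0.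
  have -> : 2 * b + c0 / 2 ^+ t.+1 = b + (2 * b + c0 / 2 ^+ t) / 2.
    by rewrite exprS; field; rewrite expf_neq0 ?pnatr_eq0.
  by apply: bdS => //; rewrite addr_ge0 ?mulr_ge0 // invr_ge0 exprn_ge0.
have bd2 : bd (2 * b).
  move=> u w u1 w1; apply/ler_addgt0Pr => e e0.
  pose t := (Num.truncn (c0 / e)).+1.
  apply: (le_trans (bdt t _ _ u1 w1)); rewrite lerD2l ler_pdivrMr ?exprn_gt0 //.
  rewrite mulrC -ler_pdivrMr //; apply: (@le_trans _ _ t%:R).
    by apply/ltW/Num.Theory.truncnS_gt.
  by rewrite -natrX ler_nat ltnW // ltn_expl.
move=> x; have [x0|x0] := eqVneq (euclid_norm x) 0.
  by rewrite (enorm_eq0 x0) mulmx0 enorm0 mulr0.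
have [y0|y0] := eqVneq (euclid_norm (Y *m x)) 0.
  by rewrite y0 !mulr_ge0 // enorm_ge0.
have xp : 0 < euclid_norm x by rewrite lt_neqAle eq_sym x0 enorm_ge0.
have yp : 0 < euclid_norm (Y *m x) by rewrite lt_neqAle eq_sym y0 enorm_ge0.
have nrm (v : 'cV[R]_m) : euclid_norm v != 0 -> euclid_norm ((euclid_norm v)^-1 *: v) <= 1.
  by move=> v0; rewrite enormZ ger0_norm ?invr_ge0 ?enorm_ge0 // mulVf.
have := bd2 _ _ (nrm _ y0) (nrm _ x0).
rewrite -scalemxAr dotZl dotZr -enorm_sqr => /(le_trans (ler_norm _)).
have -> : (euclid_norm (Y *m x))^-1 * ((euclid_norm x)^-1 * euclid_norm (Y *m x) ^+ 2) =
  euclid_norm (Y *m x) / euclid_norm x by field; rewrite x0 y0.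
by rewrite ler_pdivrMr.
Qed.

(** Give a code the weight [1/2] to the power of the sum of its magnitudes. The total is at most
    [4^m], two signs times a geometric series per coordinate, and a grid code weighs at least
    [2^(-16 m)]. *)
Lemma card_grid : (#|grid|%:R : R) <= 2 ^+ (18 * m).
Proof.
have S (q : nat) : \sum_(k < q) (2^-1) ^+ k <= 2 :> R.
  suff -> : \sum_(k < q) (2^-1) ^+ k = 2 - 2 * (2^-1) ^+ q :> R.
    by rewrite gerBl mulr_ge0 // exprn_ge0 // invr_ge0.
  by elim: q => [|q IH]; rewrite ?big_ord0 ?big_ord_recr /= ?IH ?expr0 ?exprS; lra.
have tot : \sum_(z : gcode) \prod_i (2^-1) ^+ (z i).2 <= 4 ^+ m :> R.
  rewrite -(bigA_distr_bigA (fun _ (c : bool * 'I_(4 * m).+1) => (2^-1 : R) ^+ c.2)).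
  rewrite -[m in leRHS]card_ord -prodr_const; apply: ler_prod => i _.
  rewrite -(pair_bigA _ (fun (b : bool) (k : 'I_(4 * m).+1) => (2^-1 : R) ^+ k)) /=.
  rewrite big_bool /=; have s2 := S (4 * m).+1.
  have s0 : 0 <= \sum_(k < (4 * m).+1) (2^-1) ^+ k :> R.
    by apply: sumr_ge0 => k _; rewrite exprn_ge0 // invr_ge0.
  by apply/andP; split; lra.
suff h : #|grid|%:R * (2^-1) ^+ (16 * m) <= 4 ^+ m :> R.
  have -> : 2 ^+ (18 * m) = 4 ^+ m * 2 ^+ (16 * m) :> R.
    by rewrite (_ : 4 = 2 ^+ 2) -?exprM -?exprD; [congr (_ ^+ _); lia|rewrite -natrX].
  by rewrite -ler_pdivrMr ?exprn_gt0 // -exprVn.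
apply: le_trans tot; rewrite [leRHS](bigID (mem grid)) /=.
apply: (@le_trans _ _ (\sum_(z in grid) \prod_i (2^-1) ^+ (z i).2)); last first.
  by rewrite lerDl; apply: sumr_ge0 => z _; apply: prodr_ge0 => i _; rewrite exprn_ge0 // invr_ge0.
rewrite mulr_natl -sumr_const; apply: ler_sum => z; rewrite inE => zg.
rewrite prodrXr; apply: ler_wiXn2l => //; rewrite ?invr_ge0 ?invf_le1 //.
by rewrite ler1n.
Qed.

End Grid.

(** * Trace moments of the dense matrix *)

Section DenseMoment.
Variables (R : realType) (m : nat).
Hypothesis m0 : (0 < m)%N.
Let r : 'I_m * 'I_m -> R := fun=> 3^-1.
Let Y a := cmx r a.

Let r01 x : 0 <= r x <= 1.
Proof. by rewrite /r; apply/andP; split; lra. Qed.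

Lemma power_le_exp (y : R) q : (0 < q)%N ->
  `|y| ^+ q <= q%:R ^+ q * (expR y + expR (- y)).
Proof.
move=> q0; have q0' : 0 < q%:R :> R by rewrite ltr0n.
have h : `|y| / q%:R <= expR (`|y| / q%:R) by apply: (le_trans _ (expR_ge1Dx _)); lra.
have h1 : (`|y| / q%:R) ^+ q <= expR `|y|.
  apply: (@le_trans _ _ (expR (`|y| / q%:R) ^+ q)).
    by rewrite lerXn2r ?nnegrE ?expR_ge0 ?divr_ge0 ?normr_ge0 ?(ltW q0').
  by rewrite -expRM_natl mulrC divfK ?gt_eqF.
have h2 : expR `|y| <= expR y + expR (- y).
  have := expR_ge0 y; have := expR_ge0 (- y).
  have [y0|/ltW y0] := leP 0 y; first by rewrite (ger0_norm y0); lra.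
  by rewrite (ler0_norm y0); lra.
rewrite -ler_pdivrMl ?exprn_gt0 // mulrC -expr_div_n; exact: le_trans h1 h2.
Qed.

Lemma bilinear_mgf (x y : 'cV[R]_m) (lam : R) :
  euclid_norm x <= 1 -> euclid_norm y <= 1 ->
  Ex r (fun a => expR (lam * dot x (Y a *m y))) <= expR (8 * lam ^+ 2).
Proof.
move=> x1 y1; pose c (e : 'I_m * 'I_m) : R :=
  (if (e.1 < e.2)%N then x e.1 0 * y e.2 0 + x e.2 0 * y e.1 0 else 0).
have -> : Ex r (fun a => expR (lam * dot x (Y a *m y))) =
    Ex r (fun a => expR (\sum_e (lam * c e) * centered r a e)).
  apply: eq_Ex => a; rewrite dot_symmx mulr_sumr; congr expR.
  by apply: eq_bigr => e _; rewrite mulrA.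
apply: (le_trans (Ex_exp_linear r01 _)); rewrite ler_expR.
have h (v : 'cV[R]_m) : euclid_norm v <= 1 -> dot v v <= 1 :> R.
  by move=> v1; rewrite -enorm_sqr exprn_ile1 ?enorm_ge0.
have c4 : \sum_e c e ^+ 2 <= 4.
  apply: (@le_trans _ _ (\sum_e (2 * ((x e.1 0 * x e.1 0) * (y e.2 0 * y e.2 0)) +
       2 * ((y e.1 0 * y e.1 0) * (x e.2 0 * x e.2 0))))).
    apply: ler_sum => e _; rewrite /c.
    set p := x e.1 0; set q := y e.2 0; set s := x e.2 0; set t := y e.1 0.
    have := sqr_ge0 (p * q - s * t); have := sqr_ge0 (p * q); have := sqr_ge0 (s * t).
    by case: ifP => _; nra.
  rewrite big_split /= -!mulr_sumr.
  have E (u v : 'cV[R]_m) : \sum_(e : 'I_m * 'I_m) u e.1 0 * u e.1 0 * (v e.2 0 * v e.2 0) =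
      dot u u * dot v v :> R.
    rewrite -(pair_bigA _ (fun i j => u i 0 * u i 0 * (v j 0 * v j 0))) /=.
    by rewrite mulr_suml; apply: eq_bigr => i _; rewrite mulr_sumr.
  rewrite !E; have := h _ x1; have := h _ y1.
  have := dot_ge0 x; have := dot_ge0 y; nra.
have -> : \sum_e (lam * c e) ^+ 2 = lam ^+ 2 * \sum_e c e ^+ 2.
  by rewrite mulr_sumr; apply: eq_bigr => e _; rewrite exprMn.
have := sqr_ge0 lam; nra.
Qed.

(** [power_le_exp] is applied to [sqrt m] times the form: at this scale the exponential moment is
    [expR (8 m)], exponential in [m] like the number of pairs of grid points. *)
Lemma bilinear_moment (x y : 'cV[R]_m) :
  euclid_norm x <= 1 -> euclid_norm y <= 1 ->
  Ex r (fun a => `|dot x (Y a *m y)| ^+ (2 * m)) <=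
  2 * (4 * m%:R * expR 8) ^+ m.
Proof.
move=> x1 y1; set sm : R := Num.sqrt m%:R.
have mp : 0 < m%:R :> R by rewrite ltr0n.
have sm2 : sm ^+ 2 = m%:R by rewrite sqr_sqrtr // ltW.
have h a : `|dot x (Y a *m y)| ^+ (2 * m) <= (4 * m%:R) ^+ m *
   (expR (sm * dot x (Y a *m y)) + expR (- sm * dot x (Y a *m y))).
  have := @power_le_exp (sm * dot x (Y a *m y)) (2 * m).
  rewrite muln_gt0 /= m0 => /(_ isT).
  rewrite normrM exprMn exprM ger0_norm ?sqrtr_ge0 // sm2 -ler_pdivlMl ?exprn_gt0 //.
  rewrite mulNr mulrA => /le_trans; apply; rewrite ler_wpM2r ?addr_ge0 ?expR_ge0 //.
  rewrite natrM exprM -exprVn -exprMn; rewrite le_eqVlt; apply/orP; left; apply/eqP; congr (_ ^+ _).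
  by field; rewrite gt_eqF.
apply: (le_trans (le_Ex r01 h)); rewrite ExZ ExD.
have h1 := bilinear_mgf sm x1 y1; have h2 := bilinear_mgf (- sm) x1 y1.
rewrite sqrrN sm2 in h2; rewrite sm2 in h1.
have -> : (4 * m%:R * expR 8) ^+ m = (4 * m%:R) ^+ m * expR (8 * m%:R) :> R.
  by rewrite [LHS]exprMn -expRM_natl (mulrC m%:R).
rewrite mulrCA ler_wpM2l ?exprn_ge0 ?mulr_ge0 //; lra.
Qed.

(** [(dense_cst * m)^m] has to absorb [4^m] from [(2 b)^(2m)], the [2^(36 m)] pairs of grid points
    and the moment [2 (4 m expR 8)^m]; the leading 2 provides [2^m >= 2]. *)
Definition dense_cst : R := 2 * 2 ^+ 40 * expR 8.

(** With [x = (2 b)^2], [b] the maximum over the net, [x^L <= K^L (1 + (x / K)^m)] for [L <= m],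
    whether [x <= K] or not. Only the moment of order [2 m] is then needed, and there the maximum is
    bounded by the sum over the net. *)
Lemma dense_trace_moment L : (L <= m)%N ->
  Ex r (fun a => \tr (Y a ^+ (2 * L))) <= 2 * m%:R * (dense_cst * m%:R) ^+ L.
Proof.
move=> Lm; set K := dense_cst * m%:R.
have mp : 0 < m%:R :> R by rewrite ltr0n.
have K0 : 0 < K by rewrite !mulr_gt0 ?exprn_gt0 ?expR_gt0.
pose G := [set zz : gcode m * gcode m | [&& zz.1 \in grid m, zz.2 \in grid m,
   euclid_norm (gpoint R zz.1) <= 1 & euclid_norm (gpoint R zz.2) <= 1]].
pose f a (zz : gcode m * gcode m) := `|dot (gpoint R zz.1) (Y a *m gpoint R zz.2)|.
have [z0 [z0g z01 _]] : exists z, [/\ z \in grid m,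
  euclid_norm (gpoint R z) <= 1 & euclid_norm (0 - gpoint R z) <= 4^-1].
  by apply: grid_round => //; rewrite enorm0.
have zzG : (z0, z0) \in G by rewrite inE /= z0g z01.
have key a : \tr (Y a ^+ (2 * L)) <=
    m%:R * K ^+ L * (1 + K^-1 ^+ m * (4 ^+ m * \sum_(zz in G) f a zz ^+ (2 * m))).
  have [zm zmG zmax] : exists2 zm, zm \in G & forall zz, zz \in G -> f a zz <= f a zm.
    pose zm := [arg max_(i > (z0, z0) in G) f a i]%O.
    by exists zm; rewrite /zm; case: arg_maxP.
  set b := f a zm.
  have ob : op_le (Y a) (2 * b).
    apply: grid_op_le => // z z' zg zg' z1 z1'.
    by apply: (zmax (z, z')); rewrite inE /= zg zg' z1.
  have b0 : 0 <= b by exact: normr_ge0.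
  apply: (le_trans (trace_op_le L (symmx_tr _) _ ob)); first by rewrite mulr_ge0.
  rewrite -mulrA ler_wpM2l //; set x := (2 * b) ^+ 2.
  have x0 : 0 <= x by exact: sqr_ge0.
  apply: (@le_trans _ _ (K ^+ L * (1 + K^-1 ^+ m * x ^+ m))).
    have [xK|Kx] := lerP x K.
      apply: (@le_trans _ _ (K ^+ L)); first by rewrite lerXn2r ?nnegrE // ltW.
      by rewrite ler_peMr ?exprn_ge0 ?(ltW K0) // lerDl mulr_ge0 ?exprn_ge0 ?invr_ge0 ?(ltW K0) ?mulr_ge0.
    rewrite -exprMn; apply: (@le_trans _ _ (K ^+ L * (K^-1 * x) ^+ L)).
      by rewrite -exprMn mulrA divff ?gt_eqF // mul1r.
    rewrite ler_wpM2l ?exprn_ge0 ?(ltW K0) //.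
    apply: (@le_trans _ _ ((K^-1 * x) ^+ m)); last by rewrite lerDr.
    by rewrite ler_weXn2l // mulrC ler_pdivlMr // mul1r ltW.
  rewrite ler_wpM2l ?exprn_ge0 ?(ltW K0) // lerD2l ler_wpM2l ?exprn_ge0 ?invr_ge0 ?(ltW K0) //.
  have -> : x ^+ m = 4 ^+ m * b ^+ (2 * m).
    by rewrite exprM -exprMn; congr (_ ^+ _); rewrite /x; ring.
  rewrite ler_wpM2l ?exprn_ge0 //.
  rewrite (bigD1 zm) //= lerDl; apply: sumr_ge0 => zz _.
  by rewrite exprn_ge0 ?normr_ge0.
apply: (le_trans (le_Ex r01 key)); rewrite ExZ ExD Ex1 ExZ ExZ Ex_sum.
rewrite [leRHS](_ : _ = m%:R * K ^+ L * 2); last by ring.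
rewrite ler_wpM2l ?mulr_ge0 ?exprn_ge0 ?(ltW K0) //.
suff : K^-1 ^+ m * (4 ^+ m * \sum_(zz in G) Ex r (fun a => f a zz ^+ (2 * m))) <= 1 by lra.
have sumle : \sum_(zz in G) Ex r (fun a => f a zz ^+ (2 * m)) <=
    (2 ^+ (18 * m)) ^+ 2 * (2 * (4 * m%:R * expR 8) ^+ m).
  apply: (@le_trans _ _ (\sum_(zz in G) (2 * (4 * m%:R * expR 8) ^+ m))).
    by apply: ler_sum => zz; rewrite inE => /and4P[_ _ h1 h2]; exact: bilinear_moment.
  rewrite sumr_const -[leLHS]mulr_natl ler_wpM2r ?mulr_ge0 ?exprn_ge0 ?mulr_ge0 ?expR_ge0 //.
  apply: (@le_trans _ _ (#|grid m|%:R ^+ 2)).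
    rewrite -natrX ler_nat -mulnn -cardsX; apply/subset_leq_card/fintype.subsetP => -[z z'].
    by rewrite !inE /= => /and4P[-> ->].
  by rewrite lerXn2r ?nnegrE ?exprn_ge0 // card_grid.
rewrite exprVn ler_pdivrMl ?exprn_gt0 // mulr1.
apply: (le_trans (ler_wpM2l _ sumle)); first by rewrite exprn_ge0.
have two : 2 <= 2 ^+ m :> R.
  by rewrite -natrX ler_nat; case: m m0 => // k _; rewrite expnS leq_pmulr // expn_gt0.
have -> : K ^+ m = 4 ^+ m * ((2 ^+ (18 * m)) ^+ 2 * (2 ^+ m * (4 * m%:R * expR 8) ^+ m)).
  have -> : (2 ^+ (18 * m)) ^+ 2 = (2 ^+ 36) ^+ m :> R.
    by rewrite -!exprM; congr (_ ^+ _); lia.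
  by rewrite -!exprMn /K /dense_cst; congr (_ ^+ _); ring.
by rewrite !(ler_wpM2l, ler_wpM2r) ?exprn_ge0 ?mulr_ge0 ?expR_ge0.
Qed.

End DenseMoment.

(** * Norm and powers of the centred adjacency matrix *)

(** 27 is [3^2] for rescaling the Bernoulli(1/3) entries times 3 from [r' <= 3 n p]; [expR 4] beats
    the prefactor [n^2] in Markov's inequality, as [expR (4 L) >= n^4]. *)
Definition spec_cst (R : realType) : R := 27 * dense_cst R * expR 4.

Lemma spec_cst_gt0 (R : realType) : 0 < spec_cst R.
Proof. by rewrite /spec_cst /dense_cst !mulr_gt0 ?exprn_gt0 ?expR_gt0. Qed.

Section SpectralNorm.
Variables (R : realType) (n : nat) (r : 'I_n * 'I_n -> R) (p : R).
Hypothesis rp : forall x, 0 <= r x <= p.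
Hypotheses (p0 : 0 <= p) (p1 : p <= 1).

Let r01 x : 0 <= r x <= 1.
Proof. by have /andP[-> h] := rp x; rewrite (le_trans h). Qed.

Lemma spectral_tail (t : nat) : 1 <= n%:R * p -> (2 ^ t)%:R <= n%:R * p ->
  ln n%:R <= (2 ^ t)%:R :> R ->
  Pr r (fun a => (spec_cst R * (n%:R * p)) ^+ (2 ^ t) <= \tr (cmx r a ^+ (2 * 2 ^ t)))
    <= 6 / n%:R ^+ 2.
Proof.
set L := (2 ^ t)%N => np1 Lnp lnL.
have np0 : 0 < n%:R * p by lra.
have n0 : 0 < n%:R :> R.
  by have := ler0n R n; rewrite le_eqVlt => /orP[/eqP e|//]; move: np1; rewrite -e; lra.
(* [r' - L] is at least [n p], as the comparison of patterns requires, and [r' <= 3 n p] because 1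
   and [L] are at most [n p]. *)
pose r' := ((Num.truncn (n%:R * p)).+1 + L)%N.
have trP := Num.Theory.truncn_itv (ltW np0); have /andP[tr1 tr2] := trP.
have r'L : n%:R * p <= (r' - L)%:R by rewrite addnK ltW.
have r'0 : (0 < r')%N by rewrite /r'; lia.
have r'3 : r'%:R <= 3 * (n%:R * p).
  by rewrite /r' natrD -natr1; lra.
have cs0 : 0 < dense_cst R by rewrite /dense_cst !mulr_gt0 ?exprn_gt0 ?expR_gt0.
have ub : Ex r (fun a => \tr (cmx r a ^+ (2 * L))) <=
    6 * n%:R ^+ 2 * (27 * dense_cst R * (n%:R * p)) ^+ L.
  apply: (le_trans (trace_comparison rp p1 p0 np1 r'L (leq_addl _ _))).
  apply: (@le_trans _ _ (n%:R * 3 ^+ (2 * L) * (2 * r'%:R * (dense_cst R * r'%:R) ^+ L))).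
    rewrite ler_wpM2l ?mulr_ge0 ?exprn_ge0 //.
    exact: (dense_trace_moment R r'0 (leq_addl _ _)).
  have h : (dense_cst R * r'%:R) ^+ L <= (dense_cst R * (3 * (n%:R * p))) ^+ L.
    apply: lerXn2r; rewrite ?nnegrE; [| |by apply: ler_wpM2l; rewrite ?(ltW cs0)].
      by rewrite mulr_ge0 // ltW.
    by apply: mulr_ge0; [exact: ltW | rewrite mulr_ge0 // ltW].
  have -> : (27 * dense_cst R * (n%:R * p)) ^+ L =
      3 ^+ (2 * L) * (dense_cst R * (3 * (n%:R * p))) ^+ L.
    by rewrite exprM -exprMn; congr (_ ^+ _); ring.
  have -> : n%:R * 3 ^+ (2 * L) * (2 * r'%:R * (dense_cst R * r'%:R) ^+ L) =
     (2 * n%:R * r'%:R) * (3 ^+ (2 * L) * (dense_cst R * r'%:R) ^+ L) by ring.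
  have c0 : 0 <= dense_cst R * r'%:R by rewrite mulr_ge0 // ltW.
  apply: ler_pM; [by rewrite !mulr_ge0|by rewrite mulr_ge0 ?exprn_ge0| |].
    rewrite expr2; have := ler_wpM2l (ltW n0) r'3.
    by have := ler_wpM2l (ltW n0) (ler_wpM2l (ltW n0) p1); lra.
  by rewrite ler_wpM2l ?exprn_ge0.
have V0 : 0 < (spec_cst R * (n%:R * p)) ^+ L by rewrite exprn_gt0 // mulr_gt0 ?spec_cst_gt0.
apply: (le_trans (Ex_markov r01 V0 _)).
  by move=> a; rewrite trace_even_power ?frob2_ge0 // symmx_tr.
rewrite ler_pdivrMr //; apply: (le_trans ub).
have -> : (spec_cst R * (n%:R * p)) ^+ L = expR (L%:R * 4) * (27 * dense_cst R * (n%:R * p)) ^+ L.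
  by rewrite expRM_natl -exprMn /spec_cst; congr (_ ^+ _); ring.
rewrite [leRHS]mulrA ler_wpM2r //; first by rewrite exprn_ge0 // mulr_ge0 ?(ltW np0) // mulr_ge0 // ltW.
rewrite [leRHS]mulrAC ler_pdivlMr ?exprn_gt0 // -mulrA -exprD ler_wpM2l //.
rewrite -[X in X ^+ _]lnK ?posrE // -expRM_natl ler_expR; lra.
Qed.

Lemma spectral_op_le a t : 0 <= n%:R * p ->
  \tr (cmx r a ^+ (2 * 2 ^ t)) < (spec_cst R * (n%:R * p)) ^+ (2 ^ t) ->
  op_le (cmx r a) (Num.sqrt (spec_cst R * (n%:R * p))).
Proof.
move=> np0 h; apply: (@op_le_trace _ _ _ t); rewrite ?symmx_tr ?sqrtr_ge0 //.
have s0 : 0 <= spec_cst R * (n%:R * p) by rewrite mulr_ge0 ?(ltW (spec_cst_gt0 R)).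
by rewrite [leRHS]exprM sqr_sqrtr // ltW.
Qed.

Definition touching (i : 'I_n) : {set 'I_n * 'I_n} := [set e | (e.1 == i) || (e.2 == i)].

(** The entry is a linear form in the edges at [i] whose coefficients do not depend on these edges.
    The size restrictions on [x a] are also determined away from [i], so they can be part of the
    conditioning event. *)
Lemma row_tail (i : 'I_n) (x : {ffun 'I_n * 'I_n -> bool} -> 'cV[R]_n) (X V lam t : R) :
  0 <= lam -> 0 <= X -> 0 <= V -> lam * (2 * X) <= 2^-1 ->
  (forall a a' : {ffun 'I_n * 'I_n -> bool},
     (forall e, e \notin touching i -> a e = a' e) -> x a = x a') ->
  Pr r (fun a => ((dot (x a) (x a) <= V) && [forall l, `|x a l 0| <= X]) &&
                 (t <= (cmx r a *m x a) i 0))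
  <= expR (2 * lam ^+ 2 * (4 * p * V) - lam * t).
Proof.
move=> lam0 X0 V0 lamX xD.
pose d i j : R := (i == j :> 'I_n)%:R.
pose c a (e : 'I_n * 'I_n) : R :=
  if (e.1 < e.2)%N then d e.1 i * x a e.2 0 + d e.2 i * x a e.1 0 else 0.
have cE a : (cmx r a *m x a) i 0 = \sum_e c a e * centered r a e.
  rewrite -(_ : dot (delta_mx i 0) (cmx r a *m x a) = (cmx r a *m x a) i 0).
    rewrite dot_symmx; apply: eq_bigr => e _; congr (_ * _); rewrite /c.
    by case: ifP => // _; rewrite !mxE !andbT.
  rewrite /dot (bigD1 i) //= big1 ?addr0; first by rewrite mxE !eqxx mul1r.
  by move=> j /negbTE ji; rewrite mxE ji mul0r.
rewrite /Pr (@eq_Ex _ _ _ _ (fun a => (((dot (x a) (x a) <= V) && [forall l, `|x a l 0| <= X]) &&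
                 (t <= \sum_e c a e * centered r a e))%:R)); last by move=> a; rewrite cE.
apply: (@Pr_linear_tail _ _ _ r01 (touching i)
  (fun a => (dot (x a) (x a) <= V) && [forall l, `|x a l 0| <= X]) c lam _ t lam0).
- by move=> a a' /xD ->.
- by move=> a a' /xD e; rewrite /c e.
- move=> a e; rewrite inE negb_or /c /d => /andP[/negbTE -> /negbTE ->].
  by rewrite !mul0r addr0 if_same.
- move=> a e /andP[_ /forallP xX]; apply: le_trans lamX; rewrite ler_wpM2l //.
  rewrite /c; case: ifP => _; last by rewrite normr0 mulr_ge0.
  apply: (le_trans (ler_normD _ _)); rewrite !normrM /d.
  have := xX e.1; have := xX e.2.
  by case: eqP; case: eqP => _ _ ? ?; rewrite ?normr1 ?normr0; lra.
- move=> a /andP[xV _].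
  apply: (@le_trans _ _ (\sum_(e : 'I_n * 'I_n) p * (2 * (d e.1 i * x a e.2 0 ^+ 2 + d e.2 i * x a e.1 0 ^+ 2)))).
    apply: ler_sum => e _; have /andP[re0 rep] := rp e.
    rewrite [leRHS]mulrC; apply: ler_pM => //; first exact: sqr_ge0.
    rewrite /c /d; set y := x a e.2 0; set z := x a e.1 0.
    have := sqr_ge0 (y - z); have := sqr_ge0 y; have := sqr_ge0 z.
    by case: ifP => _; case: eqP => _; case: eqP => _ /=; nra.
  rewrite -mulr_sumr -mulr_sumr big_split /=.
  have E1 : \sum_(e : 'I_n * 'I_n) d e.1 i * x a e.2 0 ^+ 2 = dot (x a) (x a).
    rewrite -(pair_bigA _ (fun k l => d k i * x a l 0 ^+ 2)) /= (bigD1 i) //=.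
    rewrite [X in _ + X]big1 ?addr0 => [|k /negbTE ki].
      by apply: eq_bigr => l _; rewrite /d eqxx mul1r expr2.
    by apply: big1 => l _; rewrite /d ki mul0r.
  have E2 : \sum_(e : 'I_n * 'I_n) d e.2 i * x a e.1 0 ^+ 2 = dot (x a) (x a).
    rewrite -(pair_bigA _ (fun l k => d k i * x a l 0 ^+ 2)) /=.
    apply: eq_bigr => l _; rewrite (bigD1 i) //= big1 ?addr0 => [|k /negbTE ki].
      by rewrite /d eqxx mul1r expr2.
    by rewrite /d ki mul0r.
  rewrite E1 E2; have := ler_wpM2l p0 xV; lra.
Qed.

End SpectralNorm.

(** * Entries of powers by leaving one vertex out *)

Section LeaveOneOut.
Variables (R : realType) (n : nat) (B : 'M[R]_n).
Hypotheses (Bs : B^T = B) (B0 : forall i, B i i = 0).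
Implicit Types (v w : 'cV[R]_n) (i : 'I_n).

Definition off i w : 'cV[R]_n := \col_j (if j == i then 0 else w j 0).

(** Row and column [i] are set to zero, not removed, so that all these matrices act on the same
    space as [B]. *)
Definition loo i : 'M[R]_n := \matrix_(k, l) (if (k == i) || (l == i) then 0 else B k l).

Lemma offB i v w : off i (v - w) = off i v - off i w.
Proof. by apply/colP => j; rewrite !mxE; case: ifP => _; rewrite ?subr0. Qed.

Lemma enorm_off i w : euclid_norm (off i w) <= euclid_norm w.
Proof.
rewrite -(ler_pXn2r (n := 2)) ?nnegrE ?enorm_ge0 // !enorm_sqr.
apply: ler_sum => j _; rewrite !mxE; case: ifP => // _.
by rewrite mul0r -expr2 sqr_ge0.
Qed.

Lemma off_mulmx i w : off i (B *m w) = loo i *m off i w + w i 0 *: col i B.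
Proof.
apply/colP => k; rewrite !mxE; case: eqP => [->|/eqP ki].
  rewrite B0 mulr0 addr0; apply/esym/big1 => l _.
  by rewrite !mxE eqxx mul0r.
rewrite (bigD1 i) //= [X in _ = X + _](bigD1 i) //= !mxE eqxx mulr0 add0r addrC mulrC.
congr (_ + _); apply: eq_bigr => l /negbTE li.
by rewrite !mxE li (negbTE ki).
Qed.

Lemma loo_off i w : loo i *m off i w = loo i *m w.
Proof.
apply/colP => k; rewrite !mxE; apply: eq_bigr => l _; rewrite !mxE.
by have [->|] := eqVneq l i; rewrite ?orbT ?mul0r.
Qed.

Lemma off_loo i w : off i (loo i *m w) = loo i *m w.
Proof.
apply/colP => k; rewrite !mxE; case: eqP => // ->.
by apply/esym/big1 => l _; rewrite !mxE eqxx mul0r.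
Qed.

Lemma op_le_loo i nu : 0 <= nu -> op_le B nu -> op_le (loo i) nu.
Proof.
move=> nu0 h w; have e : loo i *m w = off i (B *m off i w).
  rewrite off_mulmx mxE eqxx scale0r addr0 -loo_off.
  by congr (_ *m _); apply/colP => k; rewrite !mxE; case: eqP.
rewrite e; apply: (le_trans (enorm_off _ _)); apply: (le_trans (h _)).
by rewrite ler_wpM2l ?enorm_off.
Qed.

Lemma mulmx_row_dot i w : (B *m w) i 0 = dot (col i B) (off i w).
Proof.
rewrite mxE /dot; apply: eq_bigr => l _; rewrite !mxE.
case: eqP => [->|_]; first by rewrite B0 !mul0r.
by rewrite -[B in LHS]Bs mxE.
Qed.

Variables (nu Th : R) (v : 'cV[R]_n) (k : nat).
Hypotheses (nu0 : 0 <= nu) (hB : op_le B nu) (nuTh : 2 * nu <= Th).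
Hypothesis v1 : forall i, `|v i 0| <= 1.

Hypothesis hrow : forall i (j : nat), (j < k)%N ->
  dot (loo i ^+ j *m v) (loo i ^+ j *m v) <= n%:R * (Th ^+ 2) ^+ j ->
  (forall l, `|(loo i ^+ j *m v) l 0| <= 2 * Th ^+ j) ->
  `|(B *m (loo i ^+ j *m v)) i 0| <= Th ^+ j.+1 / 2.

(** [y j = B^j v] depends on row [i], so it is compared with [x j = loo^j v]. Away from [i] the
    difference obeys [D (l+1) = loo (D l) + (y l)_i col_i]; the induction hypothesis on [(y l)_i]
    and [2 nu <= Th] keep its norm below [Th^l]. Then [(B^(j+1) v)_i = (B x_j)_i + <col_i, D_j>],
    each term being at most half of [Th^(j+1)]. *)
Lemma power_entry_bound j i : (j <= k)%N -> `|(B ^+ j *m v) i 0| <= Th ^+ j.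
Proof.
have Th0 : 0 <= Th by apply: le_trans nuTh; rewrite mulr_ge0.
move: nu0 hB nuTh => nu0' hB' nuTh'.
elim/ltn_ind: j i => -[|j] IH i jk; first by rewrite !expr0 mul1mx.
have jk' : (j <= k)%N by lia.
pose y l := B ^+ l *m v; pose x l := loo i ^+ l *m v.
pose D l := off i (y l - x l).
have yS l : y l.+1 = B *m y l by rewrite /y exprS mulmxA.
have xS l : x l.+1 = loo i *m x l by rewrite /x exprS mulmxA.
have yb l : (l <= j)%N -> `|y l i 0| <= Th ^+ l by move=> lj; apply: IH => //; lia.
have cb : euclid_norm (col i B) <= nu.
  have := hB (delta_mx i 0); rewrite -colE => /le_trans; apply.
  rewrite ler_piMr //.
  rewrite -(ler_pXn2r (n := 2)) ?nnegrE ?enorm_ge0 // enorm_sqr expr1n.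
  rewrite /dot (bigD1 i) //= big1 ?addr0.
    by rewrite !mxE !eqxx mulr1.
  by move=> l /negbTE il; rewrite !mxE il mul0r.
have DS l : D l.+1 = loo i *m D l + y l i 0 *: col i B.
  rewrite /D yS xS offB off_mulmx off_loo offB mulmxBr !loo_off.
  by rewrite addrAC.
have Db l : (l <= j)%N -> euclid_norm (D l) <= Th ^+ l.
  elim: l => [|l IHl] lj.
    rewrite expr0 (_ : D 0%N = 0) ?enorm0 //.
    by apply/colP => s; rewrite !mxE subrr if_same.
  rewrite DS; apply: (le_trans (enormD _ _)).
  have h1 := op_le_loo i nu0 hB (D l); have h2 := IHl (ltnW lj).
  have h3 := yb l (ltnW lj); rewrite enormZ exprS.
  have h4 : `|y l i 0| * euclid_norm (col i B) <= Th ^+ l * nu.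
    by apply: ler_pM; rewrite ?normr_ge0 ?enorm_ge0.
  have h5 := ler_wpM2l nu0 h2; have := exprn_ge0 l Th0; nra.
(* The sup bound that [hrow] asks for: coordinate [i] of [x j] is 0, or [v i] when [j = 0], and
   elsewhere [x j = y j - D j]. *)
have xb l : `|x j l 0| <= 2 * Th ^+ j.
  have [li|li] := eqVneq l i.
    case: (j) (exprn_ge0 j Th0) => [|j'] T0 /=.
      by rewrite /x expr0 mul1mx expr0 (le_trans (v1 _)) //; lra.
    by rewrite xS -off_loo mxE li eqxx normr0 mulr_ge0.
  have h1 : x j l 0 = y j l 0 - D j l 0.
    have -> : D j l 0 = y j l 0 - x j l 0; last by ring.
    by rewrite /D [LHS]mxE (negbTE li) [LHS]mxE [X in _ + X]mxE.
  have h2 := le_trans (enorm_entry (D j) l) (Db j (leqnn j)).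
  rewrite h1; apply: (le_trans (ler_normB _ _)).
  have h3 : `|y j l 0| <= Th ^+ j by exact: IH.
  lra.
have xn : dot (x j) (x j) <= n%:R * (Th ^+ 2) ^+ j.
  rewrite -enorm_sqr -exprM mulnC exprM.
  have -> : n%:R * (Th ^+ j) ^+ 2 = (Th ^+ j * Num.sqrt n%:R) ^+ 2.
    by rewrite exprMn sqr_sqrtr ?ler0n // mulrC.
  rewrite lerXn2r ?nnegrE ?enorm_ge0 ?mulr_ge0 ?exprn_ge0 ?sqrtr_ge0 //.
  apply: (le_trans (op_le_exp _ _ nu0 (op_le_loo i nu0 hB))).
  apply: ler_pM; rewrite ?exprn_ge0 ?enorm_ge0 //.
    by rewrite lerXn2r ?nnegrE //; lra.
  by rewrite -[leRHS]mulr1; apply: enorm_le.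
have h := hrow jk xn xb.
have -> : (B ^+ j.+1 *m v) i 0 = (B *m x j) i 0 + dot (col i B) (D j).
  by rewrite -/(y j.+1) yS !mulmx_row_dot -dotDr /D offB addrC subrK.
apply: (le_trans (ler_normD _ _)).
have h2 : `|dot (col i B) (D j)| <= nu * Th ^+ j.
  apply: (le_trans (cauchy_schwarz _ _)); apply: ler_pM; rewrite ?enorm_ge0 //.
  exact: Db.
move: h; rewrite -/(x j) exprS; have := exprn_ge0 j Th0; nra.
Qed.

End LeaveOneOut.

(** * Probability that a row estimate fails *)

Section PowerTail.
Variables (R : realType) (n : nat) (r : 'I_n * 'I_n -> R) (p : R).
Hypothesis rp : forall x, 0 <= r x <= p.
Hypotheses (p0 : 0 <= p) (p1 : p <= 1).

Lemma cmx_diag a i : cmx r a i i = 0.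
Proof. by rewrite symmxE eqxx. Qed.

Lemma loo_cmx_off (i : 'I_n) (a a' : {ffun 'I_n * 'I_n -> bool}) :
  (forall e, e \notin touching i -> a e = a' e) -> loo (cmx r a) i = loo (cmx r a') i.
Proof.
move=> h; apply/matrixP => k l; rewrite [LHS]mxE [RHS]mxE; case: ifP => // /negbT.
rewrite negb_or => /andP[ki li]; rewrite !symmxE; case: ifP => // _.
rewrite /centered h // inE /edge; case: ifP => _ /=; by rewrite negb_or ?ki ?li.
Qed.

(** The failure of [hrow] at [(i, j)]. Keeping the two size conditions in the event lets Bernstein's
    inequality be applied with deterministic bounds. *)
Definition row_bad (Th : R) (v : 'cV[R]_n) (i : 'I_n) (j : nat)
    (a : {ffun 'I_n * 'I_n -> bool}) : bool :=
  let x := loo (cmx r a) i ^+ j *m v in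
  [&& dot x x <= n%:R * (Th ^+ 2) ^+ j, [forall l, `|x l 0| <= 2 * Th ^+ j] &
      Th ^+ j.+1 / 2 <= `|(cmx r a *m x) i 0|].

Lemma row_bad_tail (cT : R) (v : 'cV[R]_n) (i : 'I_n) (j : nat) :
  26 <= cT -> 0 < ln n%:R :> R -> 64 * ln n%:R <= n%:R * p ->
  Pr r (row_bad (cT * Num.sqrt (n%:R * p * ln n%:R)) v i j) <= 2 * expR (- (5 * ln n%:R)).
Proof.
move=> cT26 l0 l64; set l : R := ln n%:R in l0 l64 *; set Th := cT * _.
have np0 : 0 < n%:R * p by lra.
have nn0 : n%:R != 0 :> R by apply/eqP => e; move: np0; rewrite e mul0r ltxx.
have pn0 : p != 0 by apply/eqP => e; move: np0; rewrite e mulr0 ltxx.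
have sq0 : 0 < Num.sqrt (n%:R * p * l) by rewrite sqrtr_gt0 mulr_gt0.
have Th0 : 0 < Th by rewrite mulr_gt0 //; lra.
have r01 e : 0 <= r e <= 1 by have /andP[-> h] := rp e; rewrite (le_trans h).
pose x (sg : R) a := sg *: (loo (cmx r a) i ^+ j *m v).
pose ev sg a := ((dot (x sg a) (x sg a) <= n%:R * (Th ^+ 2) ^+ j) &&
   [forall l, `|x sg a l 0| <= 2 * Th ^+ j]) && (Th ^+ j.+1 / 2 <= (cmx r a *m x sg a) i 0).
have dotx sg a : sg = 1 \/ sg = -1 -> dot (x sg a) (x sg a) = dot (x 1 a) (x 1 a).
  by rewrite /x !dotZl !dotZr; case=> ->; ring.
have nx sg a s : sg = 1 \/ sg = -1 -> `|x sg a s 0| = `|x 1 a s 0|.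
  by rewrite /x; case=> ->; rewrite !mxE ?mulN1r ?normrN ?mul1r.
(* With [lam = s / Th^j] and [s = sqrt (l / (n p))], the quadratic term is [8 l] and the linear one
   [cT l / 2 >= 13 l], whence 26 and 5. [64 l <= n p] gives [s <= 1/8], the smallness needed for the
   coefficients. *)
have evP sg : sg = 1 \/ sg = -1 -> Pr r (ev sg) <= expR (- (5 * l)).
  move=> sgP; pose s := Num.sqrt (n%:R * p * l) / (n%:R * p).
  have s0 : 0 <= s by rewrite divr_ge0 ?sqrtr_ge0 // ltW.
  have s2 : s ^+ 2 = l / (n%:R * p).
    rewrite /s exprMn sqr_sqrtr ?mulr_ge0 ?(ltW np0) ?(ltW l0) // exprVn.
    by field; rewrite pn0 nn0.
  have s8 : s <= 8^-1.
    rewrite -(ler_pXn2r (n := 2)) ?nnegrE ?invr_ge0 // s2 ler_pdivrMr //; lra.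
  pose lam := s / Th ^+ j.
  have Tj0 : 0 < Th ^+ j by rewrite exprn_gt0.
  apply: (le_trans (@row_tail _ _ r p rp p0 p1 i (x sg) (2 * Th ^+ j) (n%:R * (Th ^+ 2) ^+ j) lam (Th ^+ j.+1 / 2) _ _ _ _ _)).
  - by rewrite divr_ge0 // ltW.
  - by rewrite mulr_ge0 // ltW.
  - by rewrite mulr_ge0 ?exprn_ge0 // ltW.
  - have -> : lam * (2 * (2 * Th ^+ j)) = 4 * s by rewrite /lam; field; rewrite gt_eqF.
    lra.
  - by move=> a a' h; rewrite /x (loo_cmx_off h).
  rewrite ler_expR.
  have -> : 2 * lam ^+ 2 * (4 * p * (n%:R * (Th ^+ 2) ^+ j)) = 8 * l.
    rewrite /lam exprMn s2 exprVn -exprM -exprM mulnC.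
    by field; rewrite nn0 pn0 expf_neq0 ?gt_eqF.
  have -> : lam * (Th ^+ j.+1 / 2) = cT / 2 * l.
    rewrite /lam exprS /s /Th.
    have -> : Num.sqrt (n%:R * p * l) / (n%:R * p) / Th ^+ j *
       (cT * Num.sqrt (n%:R * p * l) * Th ^+ j / 2) =
       cT / 2 * (Num.sqrt (n%:R * p * l) ^+ 2 / (n%:R * p)).
      by field; rewrite nn0 pn0 gt_eqF.
    rewrite sqr_sqrtr ?mulr_ge0 ?(ltW np0) ?(ltW l0) //.
    by congr (_ * _); field; rewrite nn0 pn0.
  nra.
apply: (@le_trans _ _ (Pr r (predU (ev 1) (ev (-1))))); last first.
  apply: (le_trans (Pr_U r01 _ _)); have := evP 1 (or_introl erefl).
  by have := evP (-1) (or_intror erefl); lra.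
apply: le_Pr => // a; rewrite /row_bad => /and3P[h1 /forallP h2 h3] /=.
have x1 : x 1 a = loo (cmx r a) i ^+ j *m v by rewrite /x scale1r.
have g sg : sg = 1 \/ sg = -1 ->
    (dot (x sg a) (x sg a) <= n%:R * (Th ^+ 2) ^+ j) && [forall l, `|x sg a l 0| <= 2 * Th ^+ j].
  move=> sgP; rewrite dotx // x1 h1; apply/forallP => s; rewrite nx // x1; exact: h2.
rewrite /ev !g; [|by right|by left] => /=.
move: h3; rewrite /x -!scalemxAr scale1r [X in _ || (_ <= X)]mxE mulN1r.
by rewrite ler_normr.
Qed.

End PowerTail.

(** * Powers of a perturbed rank-one matrix *)

Section RankOne.
Variables (R : realType) (n : nat).
Implicit Types u v x : 'cV[R]_n.

Lemma rank1_mulmx u x : (u *m u^T) *m x = dot u x *: u.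
Proof.
apply/colP => i; rewrite -mulmxA !mxE big_ord1 mulrC; congr (_ * _).
by rewrite mxE; apply: eq_bigr => j _; rewrite mxE.
Qed.

Lemma rank1_tr u : (u *m u^T)^T = u *m u^T.
Proof. by rewrite trmx_mul trmxK. Qed.

End RankOne.

(** * Iterates of signal plus noise *)

Section Perturbation.
Variables (R : realType) (n : nat) (B : 'M[R]_n) (s : 'cV[R]_n).
Variables (dinv e1 e2 g Th : R) (k : nat).
Hypotheses (n0 : (0 < n)%N) (Bs : B^T = B) (s1 : forall i, `|s i 0| = 1).
Hypotheses (dinv0 : 0 <= dinv) (g0 : 0 <= g) (Th0 : 0 <= Th).
Let one : 'cV[R]_n := const_mx 1.

Definition noise_mx : 'M[R]_n :=
  dinv *: B + (e1 / n%:R) *: (one *m one^T) - e2 *: 1%:M.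

Definition signal_mx : 'M[R]_n := (g / n%:R) *: (s *m s^T).

Local Notation Rm := noise_mx.
Local Notation M := signal_mx.
Local Notation A := (Rm + M).

(** [K] counts the applications of [B] that are still controlled. Each multiplication by the noise
    matrix spends one of them, and [s] and [one] start with [k]. *)
Definition star (K : nat) (c : R) (x : 'cV[R]_n) :=
  forall j i, (j <= K)%N -> `|(B ^+ j *m x) i 0| <= c * Th ^+ j.

Hypotheses (star_s : star k 1 s) (star_one : star k 1 one).

Definition eta : R := dinv * Th + `|e1| + `|e2|.

Lemma noise_mulmx x : Rm *m x = dinv *: (B *m x) + (e1 / n%:R * dot one x) *: one - e2 *: x.
Proof.
by rewrite /noise_mx mulmxBl mulmxDl -!scalemxAl rank1_mulmx mul1mx scalerA.
Qed.

Lemma signal_mulmx x : M *m x = (g / n%:R * dot s x) *: s.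
Proof. by rewrite /signal_mx -scalemxAl rank1_mulmx scalerA. Qed.

Lemma starW K K' c x : (K' <= K)%N -> star K c x -> star K' c x.
Proof. by move=> KK h j i jK; apply: h; lia. Qed.

Lemma star_entry K c x i : star K c x -> `|x i 0| <= c.
Proof. by move/(_ 0%N i isT); rewrite !expr0 mul1mx mulr1. Qed.

Lemma starD K c c' x y : star K c x -> star K c' y -> star K (c + c') (x + y).
Proof.
move=> hx hy j i jK; rewrite mulmxDr mxE mulrDl.
by apply: (le_trans (ler_normD _ _)); rewrite lerD ?hx ?hy.
Qed.

Lemma starZ K c b x : star K c x -> star K (`|b| * c) (b *: x).
Proof.
move=> hx j i jK; rewrite -scalemxAr mxE normrM -mulrA.
by rewrite ler_wpM2l ?normr_ge0 ?hx.
Qed.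

Lemma star_mulmx K c x : star K.+1 c x -> star K (c * Th) (B *m x).
Proof.
move=> hx j i jK; rewrite mulmxA mulmxE -exprSr -mulrA -exprS; exact: hx.
Qed.

Lemma star_le K c c' x : c <= c' -> star K c x -> star K c' x.
Proof. by move=> cc h j i jK; apply: (le_trans (h j i jK)); rewrite ler_wpM2r ?exprn_ge0. Qed.

Lemma dot_le (u x : 'cV[R]_n) c : (forall i, `|u i 0| <= 1) -> (forall i, `|x i 0| <= c) ->
  `|dot u x| <= n%:R * c.
Proof.
move=> u1 xc; apply: (le_trans (ler_norm_sum _ _ _)).
rewrite -[n in leRHS]card_ord mulr_natl -sumr_const; apply: ler_sum => i _.
by rewrite normrM -[leRHS]mul1r ler_pM ?normr_ge0.
Qed.

Lemma star_noise K c x : (K < k)%N -> star K.+1 c x -> star K (c * eta) (Rm *m x).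
Proof.
move=> Kk hx.
have n0' : 0 < n%:R :> R by rewrite ltr0n.
have -> : Rm *m x = dinv *: (B *m x) + (e1 / n%:R * dot one x) *: one + (- e2) *: x.
  by rewrite noise_mulmx scaleNr.
apply: (@star_le _ (`|dinv| * (c * Th) + `|e1 / n%:R * dot one x| * 1 + `|- e2| * c)).
  have h : `|dot one x| <= n%:R * c.
    apply: dot_le => i; last exact: star_entry hx.
    by rewrite mxE normr1.
  rewrite mulr1 normrN (ger0_norm dinv0) normrM normrM normfV (@ger0_norm _ n%:R) //.
  have : `|e1| / n%:R * `|dot one x| <= `|e1| * c.
    rewrite -mulrA ler_wpM2l ?normr_ge0 // mulrC ler_pdivrMr // mulrC //.
  by rewrite /eta; lra.
apply: starD; [apply: starD; apply: starZ|apply: starZ].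
- exact: star_mulmx.
- exact: starW (ltnW Kk) star_one.
- exact: starW (leqnSn K) hx.
Qed.

Lemma star_signal K c x : (K <= k)%N -> star K c x -> star K (g * c) (M *m x).
Proof.
move=> Kk hx; rewrite signal_mulmx.
have n0' : 0 < n%:R :> R by rewrite ltr0n.
apply: (@star_le _ (`|g / n%:R * dot s x| * 1)).
  have h : `|dot s x| <= n%:R * c.
    apply: dot_le => i; last exact: star_entry hx.
    by rewrite s1.
  rewrite mulr1 normrM normrM normfV (@ger0_norm _ n%:R) // (ger0_norm g0).
  by rewrite -mulrA ler_wpM2l // mulrC ler_pdivrMr // mulrC.
exact/starZ/(starW Kk star_s).
Qed.

Lemma star_A K c x : (K < k)%N -> star K.+1 c x -> star K (c * (g + eta)) (A *m x).
Proof.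
move=> Kk hx; rewrite mulmxDl; apply: (@star_le _ (c * eta + g * c)); first by lra.
apply: starD; first exact: star_noise.
by apply: star_signal; [exact: ltnW|exact: starW hx].
Qed.

Lemma eta_ge0 : 0 <= eta.
Proof. by rewrite /eta !addr_ge0 ?mulr_ge0 ?normr_ge0. Qed.

Lemma dot_ss : dot s s = n%:R.
Proof.
rewrite /dot (eq_bigr (fun=> 1)) ?sumr_const ?card_ord // => i _.
by rewrite -expr2 -(real_normK (num_real _)) s1 expr1n.
Qed.

(** As [M s = g s], the new error is [Rm (A^j s) + M (A^j s - g^j s)], and
    [(g + eta)^j eta + g ((g + eta)^j - g^j)] is [(g + eta)^(j+1) - g^(j+1)]. The first bound is
    carried along because [Rm] acts on [A^j s] itself. *)
Lemma signal_power j : (j <= k)%N ->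
  star (k - j) ((g + eta) ^+ j) (A ^+ j *m s) /\
  star (k - j) ((g + eta) ^+ j - g ^+ j) (A ^+ j *m s - g ^+ j *: s).
Proof.
have nn : n%:R != 0 :> R by rewrite pnatr_eq0 -lt0n.
elim: j => [|j IH] jk.
  rewrite !expr0 mul1mx scale1r !subrr subn0; split => // l i _.
  by rewrite mulmx0 mxE normr0 mul0r.
have [h1 h2] := IH (ltnW jk).
have e : (k - j = (k - j.+1).+1)%N by lia.
rewrite e in h1 h2; have kk : (k - j.+1 < k)%N by lia.
split; first by rewrite exprSr exprS -mulmxE -mulmxA; exact: star_A.
have -> : A ^+ j.+1 *m s - g ^+ j.+1 *: s =
    Rm *m (A ^+ j *m s) + M *m (A ^+ j *m s - g ^+ j *: s).
  rewrite [A ^+ j.+1]exprS -mulmxE -mulmxA mulmxDl mulmxBr -addrA; congr (_ + (_ - _)).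
  by rewrite -scalemxAr signal_mulmx dot_ss divfK // scalerA exprSr.
apply: (@star_le _ ((g + eta) ^+ j * eta + g * ((g + eta) ^+ j - g ^+ j))).
  by rewrite !exprS; lra.
apply: starD; first exact: star_noise.
by apply: star_signal; [exact: ltnW|exact: starW (leqnSn _) h2].
Qed.

Lemma signal_entry i : `|(A ^+ k *m s) i 0 - g ^+ k * s i 0| <= (g + eta) ^+ k - g ^+ k.
Proof.
have [_ h] := signal_power (leqnn k).
by have := star_entry i h; rewrite [X in `|X|]mxE [X in _ + X]mxE [X in _ - X]mxE.
Qed.

Lemma noise_mx_tr : Rm^T = Rm.
Proof. by rewrite /noise_mx linearB linearD !linearZ /= Bs rank1_tr trmx1. Qed.

Lemma noise_power_s j : (j <= k)%N -> star (k - j) (eta ^+ j) (Rm ^+ j *m s).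
Proof.
elim: j => [|j IH] jk; first by rewrite !expr0 mul1mx subn0.
have h := IH (ltnW jk); have e : (k - j = (k - j.+1).+1)%N by lia.
rewrite e in h; rewrite exprSr exprS -mulmxE -mulmxA; apply: star_noise => //; lia.
Qed.

(** A basis vector [e_i] has no useful [star] bound, but the signal sees [Rm^j e_i] only through
    [<s, Rm^j e_i> = (Rm^j s)_i], by symmetry of [Rm], and [noise_power_s] bounds this. The factor
    [g / n] then spreads the difference over all coordinates. *)
Lemma noise_power_entry i j : (j <= k)%N ->
  star (k - j) (((g + eta) ^+ j - eta ^+ j) / n%:R)
    (A ^+ j *m delta_mx i 0 - Rm ^+ j *m delta_mx i 0).
Proof.
have n0' : 0 < n%:R :> R by rewrite ltr0n.
elim: j => [|j IH] jk.
  move=> l t _; rewrite !expr0 !subrr mulmx0 mxE normr0 !mul0r //.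
have h := IH (ltnW jk); have e : (k - j = (k - j.+1).+1)%N by lia.
rewrite e in h; have kk : (k - j.+1 < k)%N by lia.
set x : 'cV[R]_n := delta_mx i 0 in h *.
have -> : A ^+ j.+1 *m x - Rm ^+ j.+1 *m x =
    A *m (A ^+ j *m x - Rm ^+ j *m x) + M *m (Rm ^+ j *m x).
  rewrite !exprS -!mulmxE -!mulmxA mulmxBr [X in _ = _ - X + _]mulmxDl.
  by rewrite opprD addrA subrK.
have hd : dot s (Rm ^+ j *m x) = (Rm ^+ j *m s) i 0.
  rewrite -dot_mulmx_sym ?trmx_exp ?noise_mx_tr //.
  rewrite /dot (bigD1 i) //= big1 ?addr0 => [|l /negbTE li].
    by rewrite /x [delta_mx _ _ _ _]mxE !eqxx mulr1.
  by rewrite /x [delta_mx _ _ _ _]mxE li mulr0.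
have hd2 : `|dot s (Rm ^+ j *m x)| <= eta ^+ j.
  by rewrite hd; exact: star_entry (noise_power_s (ltnW jk)).
apply: (@star_le _ (((g + eta) ^+ j - eta ^+ j) / n%:R * (g + eta) +
   `|g / n%:R * dot s (Rm ^+ j *m x)| * 1)).
  rewrite mulr1 normrM (@ger0_norm _ (g / n%:R)) ?divr_ge0 //.
  apply: (@le_trans _ _ (((g + eta) ^+ j - eta ^+ j) / n%:R * (g + eta) + g / n%:R * eta ^+ j)).
    by rewrite lerD2l ler_wpM2l ?divr_ge0.
  by rewrite !exprS le_eqVlt; apply/orP; left; apply/eqP; field; rewrite gt_eqF.
apply: starD; first exact: star_A.
by rewrite signal_mulmx; apply/starZ/(starW _ star_s)/ltnW.
Qed.

Lemma enorm_delta i : euclid_norm (delta_mx i 0 : 'cV[R]_n) = 1.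
Proof.
apply/eqP; rewrite -(eqrXn2 (n := 2)) ?enorm_ge0 ?ler01 // enorm_sqr expr1n.
rewrite /dot (bigD1 i) //= big1 ?addr0.
  by rewrite !mxE !eqxx mulr1.
by move=> l /negbTE il; rewrite !mxE il mul0r.
Qed.

Lemma noise_op_le nu : 0 <= nu -> op_le B nu -> op_le Rm (dinv * nu + `|e1| + `|e2|).
Proof.
move=> nu0 hB x; have n0' : 0 < n%:R :> R by rewrite ltr0n.
rewrite noise_mulmx; apply: (le_trans (enormD _ _)); rewrite enormN !enormZ 2!mulrDl.
rewrite lerD2r; apply: (le_trans (enormD _ _)); rewrite !enormZ.
apply: lerD; first by rewrite ger0_norm // -mulrA ler_wpM2l.
have on : euclid_norm one = Num.sqrt n%:R.
  rewrite /euclid_norm (eq_bigr (fun=> 1)) ?sumr_const ?card_ord // => i _.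
  by rewrite mxE expr1n.
rewrite normrM normrM normfV (@ger0_norm _ n%:R) // -!mulrA ler_wpM2l ?normr_ge0 //.
rewrite mulrC ler_pdivrMr //; have := cauchy_schwarz one x; rewrite on => h.
apply: (le_trans (ler_wpM2r (sqrtr_ge0 _) h)).
by rewrite mulrAC -expr2 sqr_sqrtr ?ler0n // mulrC.
Qed.

(** The power of the noise alone is measured by its operator norm, which can avoid the logarithm in
    [Th]. Everything else passes through [s] at least once and has the factor [1 / n] in its
    entries. *)
Lemma row_norm_bound i kap : 0 <= kap -> op_le Rm kap ->
  euclid_norm (A ^+ k *m delta_mx i 0) <= kap ^+ k + (g + eta) ^+ k / Num.sqrt n%:R.
Proof.
move=> kap0 hR; set x : 'cV[R]_n := delta_mx i 0.
have n0' : 0 < n%:R :> R by rewrite ltr0n.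
rewrite -[A ^+ k *m x](subrK (Rm ^+ k *m x)) addrC; apply: (le_trans (enormD _ _)).
apply: lerD.
  by apply: (le_trans (op_le_exp _ _ kap0 hR)); rewrite enorm_delta mulr1.
have bk : 0 <= (g + eta) ^+ k by rewrite exprn_ge0 // addr_ge0 ?eta_ge0.
have -> : (g + eta) ^+ k / Num.sqrt n%:R = Num.sqrt n%:R * ((g + eta) ^+ k / n%:R).
  have sq0 : Num.sqrt n%:R != 0 :> R by rewrite gt_eqF // sqrtr_gt0.
  have sq2 : Num.sqrt n%:R ^+ 2 = n%:R :> R by rewrite sqr_sqrtr ?ler0n.
  move: (Num.sqrt _) sq0 sq2 => sq sq0 <-; by field.
apply: enorm_le; first by rewrite divr_ge0 // ltW.
move=> l; apply: (le_trans (star_entry l (noise_power_entry i (leqnn k)))).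
by rewrite ler_pM2r ?invr_gt0 // gerBl exprn_ge0 ?eta_ge0.
Qed.

End Perturbation.

(** * The block model *)

Section BlockModel.
Variables (R : realType) (n : nat) (S : {set 'I_n}) (p q : R).
Hypotheses (n_even : ~~ odd n) (cardS : #|S| = n./2) (n0 : (0 < n)%N).
Implicit Type a : {ffun 'I_n * 'I_n -> bool}.

(* Configurations are indexed by all ordered pairs; probability [0] removes those
   that are not of the form [i < j]. *)
Definition edge_prob (e : 'I_n * 'I_n) : R :=
  if (e.1 < e.2)%N then (if (e.1 \in S) == (e.2 \in S) then p else q) else 0.

Definition sgnv : 'cV[R]_n := \col_i (if i \in S then 1 else -1).

Definition onev : 'cV[R]_n := const_mx 1.

Definition graph_adj a : 'M[R]_n := symmx (fun e => (a e)%:R).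

(** [2 |E| / n] as a quadratic form, to which the decomposition of the adjacency matrix applies. *)
Definition graph_degree a : R := dot onev (graph_adj a *m onev) / n%:R.

Definition graph_conv a : 'M[R]_n :=
  (graph_degree a)^-1 *: graph_adj a - n%:R^-1 *: const_mx 1.

Lemma sgnv_norm i : `|sgnv i 0| = 1.
Proof. by rewrite mxE; case: ifP; rewrite ?normrN normr1. Qed.

Lemma dot_onev_sgnv : dot onev sgnv = 0.
Proof.
rewrite /dot (bigID (mem S)) /=.
rewrite (eq_bigr (fun=> 1)) => [|i iS]; last by rewrite !mxE iS mulr1.
rewrite [X in _ + X](eq_bigr (fun=> -1)) => [|i iS]; last first.
  by rewrite !mxE (negbTE iS) mul1r.
rewrite !sumr_const mulNrn; apply/eqP; rewrite subr_eq0; apply/eqP; congr (_%:R).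
have -> : #|[pred i | i \notin S]| = #|~: S| by apply: eq_card => i; rewrite !inE.
have := cardsCs S; rewrite card_ord cardS => h; move: (odd_double_half n).
by rewrite (negbTE n_even) -addnn; have := max_card (mem (~: S)); rewrite card_ord; lia.
Qed.

Lemma onev_onev : onev *m onev^T = const_mx 1 :> 'M[R]_n.
Proof. by apply/matrixP => i j; rewrite !mxE big_ord1 !mxE mulr1. Qed.

(** On the diagonal the two rank-one terms add up to [p], while the graph has no loops; hence the
    multiple of the identity. *)
Lemma graph_adj_decomp a : graph_adj a = cmx edge_prob a +
  ((p + q) / 2) *: (onev *m onev^T) + ((p - q) / 2) *: (sgnv *m sgnv^T) - p *: 1%:M.
Proof.
apply/matrixP => i j; rewrite onev_onev ![in RHS]mxE big_ord1 !mxE /edge_prob /centered /=.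
have [->|ij] := eqVneq i j.
  by rewrite ltnn; case: (j \in S) => /=; field.
case: ltngtP => [h|h|/val_inj e]; last by rewrite e eqxx in ij.
  by case: (i \in S); case: (j \in S) => /=; field.
by case: (i \in S); case: (j \in S) => /=; field.
Qed.

Lemma dot_onev : dot onev onev = n%:R.
Proof.
rewrite /dot (eq_bigr (fun=> 1)) ?sumr_const ?card_ord // => i _.
by rewrite mxE mulr1.
Qed.

Lemma graph_degreeE a : graph_degree a =
  n%:R * (p + q) / 2 - p + dot onev (cmx edge_prob a *m onev) / n%:R.
Proof.
have nn : n%:R != 0 :> R by rewrite pnatr_eq0 -lt0n.
rewrite /graph_degree graph_adj_decomp mulmxBl !mulmxDl -!scalemxAl !rank1_mulmx mul1mx.
rewrite -[- (p *: onev)]scaleNr !dotDr !dotZr dot_onev dot_onev_sgnv (dotC sgnv) dot_onev_sgnv.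
by field.
Qed.

(** Subtracting [J / n] leaves, along [onev], only the relative error of the empirical degree
    against [n (p + q) / 2]. *)
Lemma graph_conv_decomp a :
  let d := graph_degree a in
  graph_conv a =
  noise_mx (cmx edge_prob a) d^-1 (n%:R * (p + q) / 2 / d - 1) (p / d) +
  signal_mx sgnv (n%:R * (p - q) / 2 / d).
Proof.
have nn : n%:R != 0 :> R by rewrite pnatr_eq0 -lt0n.
move=> d; rewrite /graph_conv -/d graph_adj_decomp /noise_mx /signal_mx -/onev onev_onev.
apply/matrixP => i j; rewrite !mxE; move: (d^-1) => di.
set x := (1 *+ _); set y := \sum_(_ < _) _; set z := (if _ then _ else _).
by field.
Qed.

Variables (k : nat) (cT : R) (a : {ffun 'I_n * 'I_n -> bool}).
Let np := n%:R * p.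
Let ell : R := ln n%:R.
Let nu := Num.sqrt (spec_cst R * np).
Let Th := cT * Num.sqrt (np * ell).
Let B := cmx edge_prob a.
Let gam := (p - q) / (p + q).
Let g := n%:R * (p - q) / 2 / graph_degree a.

Hypotheses (q0 : 0 <= q) (p1 : p <= 1) (k1 : (1 <= k)%N) (ell0 : 0 < ell) (np0 : 0 < np).
Hypotheses (nu1 : 1 <= nu) (nu32 : 32 * nu <= np) (nuTh : nu <= Th) (cT0 : 0 < cT).
Hypothesis hgam : 256 * cT * k%:R * Num.sqrt (ell / np) <= gam.
Hypotheses (hB : op_le B nu).
Hypothesis star_s : star B Th k 1 sgnv.
Hypothesis star_1 : star B Th k 1 onev.

Lemma graph_power_bounds :
  [/\ 0 < g, gam / 2 <= g,
      forall i, 3 / 4 * g ^+ k <= sgnv i 0 * (graph_conv a ^+ k *m sgnv) i 0 &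
      forall i, euclid_norm (graph_conv a ^+ k *m delta_mx i 0) <=
        (16 * nu / np) ^+ k + 5 / 4 * g ^+ k / Num.sqrt n%:R].
Proof.
move: q0 p1 ell0 np0 nu1 nu32 nuTh cT0 hgam => q0' p1' ell0' np0' nu1' nu32' nuTh' cT0' hgam'.
have nR : 0 < n%:R :> R by rewrite ltr0n.
have p_gt0 : 0 < p by move: np0'; rewrite /np pmulr_rgt0.
have kR : 1 <= k%:R :> R by rewrite ler1n.
have sq_gt0 : 0 < Num.sqrt (ell / np) by rewrite sqrtr_gt0 divr_gt0.
have gam0 : 0 < gam by apply: lt_le_trans hgam'; rewrite !mulr_gt0 ?ltr0n.
have pq0 : 0 < p + q by lra.
have qp : 0 < p - q by move: gam0; rewrite /gam pmulr_lgt0 // invr_gt0.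
set d := graph_degree a; set dbar := n%:R * (p + q) / 2.
have db1 : np / 2 <= dbar by rewrite /dbar /np; nra.
set w := dot onev (cmx edge_prob a *m onev) / n%:R.
have wn : `|w| <= nu.
  rewrite /w normrM normfV (@ger0_norm _ n%:R) // ler_pdivrMr //.
  apply: (le_trans (cauchy_schwarz _ _)).
  have h := hB onev; have -> : nu * n%:R = euclid_norm onev * (nu * euclid_norm onev).
    by rewrite mulrCA -expr2 enorm_sqr dot_onev.
  by rewrite ler_wpM2l ?enorm_ge0.
have dE : d = dbar - p + w by rewrite /d graph_degreeE.
have [wl wr] : - nu <= w /\ w <= nu by move: wn; rewrite ler_norml => /andP.
have d1 : np / 4 <= d by lra.
have d2 : d <= 9 / 8 * dbar by lra.
have d0 : 0 < d by lra.
have di : d^-1 <= 4 / np.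
  by rewrite -[d^-1]mul1r ler_pdivrMr // mulrAC ler_pdivlMr //; lra.
have di0 : 0 < d^-1 by rewrite invr_gt0.
have e1b : `|dbar / d - 1| <= 8 * nu / np.
  have -> : dbar / d - 1 = (dbar - d) * d^-1 by field; rewrite gt_eqF.
  rewrite normrM (ger0_norm (ltW di0)).
  have -> : 8 * nu / np = (2 * nu) * (4 / np) by ring.
  apply: ler_pM; rewrite ?normr_ge0 ?(ltW di0) //.
  by rewrite ler_norml; apply/andP; split; lra.
have e2b : `|p / d| <= 4 * nu / np.
  have pd0 : 0 <= p / d by apply: divr_ge0; exact: ltW.
  rewrite (ger0_norm pd0).
  have -> : 4 * nu / np = nu * (4 / np) by ring.
  by apply: ler_pM; rewrite ?(ltW p_gt0) ?(ltW di0) //; lra.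
have gE : g = gam * (dbar / d).
  by rewrite /g /gam -/d /dbar; field; rewrite !gt_eqF.
have gg : gam / 2 <= g.
  rewrite gE ler_wpM2l ?(ltW gam0) // ler_pdivlMr //; lra.
have g0 : 0 < g by lra.
have Th0 : 0 <= Th by lra.
set e := eta d^-1 (dbar / d - 1) (p / d) Th.
(* The three terms of [eta] are at most [4 Th / np], [8 nu / np] and [4 nu / np], together
   [16 Th / np]. In [hgam], 256 is [16 * 8 * 2], the 2 coming from [gam / 2 <= g]. *)
have eb : e <= g / (8 * k%:R).
  have s1 : Th / np = cT * Num.sqrt (ell / np).
    rewrite /Th -mulrA; congr (_ * _); apply/eqP.
    rewrite -(eqrXn2 (n := 2)) ?divr_ge0 ?sqrtr_ge0 ?(ltW np0') //.
    have h1 : 0 <= np * ell by apply: mulr_ge0; exact: ltW.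
    have h2 : 0 <= ell / np by apply: divr_ge0; exact: ltW.
    rewrite exprMn (sqr_sqrtr h1) (sqr_sqrtr h2) exprVn.
    by apply/eqP; field; rewrite gt_eqF.
  apply: (@le_trans _ _ (16 * (Th / np))).
    rewrite /e /eta.
    have h1 : d^-1 * Th <= 4 / np * Th by rewrite ler_wpM2r.
    have h2 : nu / np <= Th / np by rewrite ler_pM2r ?invr_gt0.
    have -> : 16 * (Th / np) = 4 / np * Th + 12 * (Th / np) by ring.
    by move: h1 h2 e1b e2b; lra.
  rewrite s1 ler_pdivlMr ?mulr_gt0 //; last lra.
  apply: le_trans gg; move: hgam'; set sq := Num.sqrt _.
  have -> : 16 * (cT * sq) * (8 * k%:R) = 128 * (cT * k%:R * sq) by ring.
  have -> : 256 * cT * k%:R * sq = 256 * (cT * k%:R * sq) by ring.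
  lra.
have e0 : 0 <= e by apply: eta_ge0 => //; exact: ltW.
(* [(1 + 1 / (8 k))^k <= expR (1/8) <= 1 + 1/8 + 2/64 <= 5/4]; this is what the factor [k] in [hgam]
   pays for. *)
have bk : (g + e) ^+ k <= 5 / 4 * g ^+ k.
  apply: (@le_trans _ _ ((g * (1 + (8 * k%:R)^-1)) ^+ k)).
    have h0 : 0 <= 1 + (8 * k%:R)^-1 :> R by rewrite addr_ge0 ?invr_ge0 ?mulr_ge0.
    apply: lerXn2r; rewrite ?nnegrE.
    - by apply: addr_ge0 => //; exact: ltW.
    - by apply: mulr_ge0 => //; exact: ltW.
    - by rewrite mulrDr mulr1 lerD2l.
  rewrite exprMn mulrC; apply: ler_wpM2r; first by apply: exprn_ge0; exact: ltW.
  apply: (@le_trans _ _ (expR (8 * k%:R)^-1 ^+ k)).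
    apply: lerXn2r; rewrite ?nnegrE ?expR_ge0 ?addr_ge0 ?invr_ge0 ?mulr_ge0 //.
    exact: expR_ge1Dx.
  rewrite -expRM_natl.
  have -> : k%:R * (8 * k%:R)^-1 = 8^-1 :> R by field; rewrite gt_eqF // ltr0n.
  have h : 8^-1 <= 2^-1 :> R by lra.
  by apply: (le_trans (expR_le_quad h)); lra.
split=> //.
- move=> i; have h := @signal_entry _ _ B sgnv d^-1 (dbar / d - 1) (p / d) g Th k n0
    sgnv_norm (ltW di0) (ltW g0) Th0 star_s star_1 i.
  rewrite -(graph_conv_decomp a) -/e in h.
  move: h; set X := (graph_conv a ^+ k *m sgnv) i 0 => h.
  have gk0 : 0 < g ^+ k by rewrite exprn_gt0.
  have h2 : `|X - g ^+ k * sgnv i 0| <= 4^-1 * g ^+ k by apply: (le_trans h); lra.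
  move: h2; rewrite ler_norml => /andP[h3 h4].
  by rewrite mxE; move: h3 h4; rewrite mxE; case: ifP => _; lra.
- move=> i.
  have hk : op_le (noise_mx B d^-1 (dbar / d - 1) (p / d)) (16 * nu / np).
    move=> x; have h := @noise_op_le _ _ B d^-1 (dbar / d - 1) (p / d) n0 (ltW di0) nu (sqrtr_ge0 _) hB x.
    apply: (le_trans h); rewrite ler_wpM2r ?enorm_ge0 //.
    have h1 : d^-1 * nu <= 4 / np * nu by rewrite ler_wpM2r ?sqrtr_ge0.
    have -> : 16 * nu / np = 4 / np * nu + 8 * nu / np + 4 * nu / np by ring.
    lra.
  have := @row_norm_bound _ _ B sgnv d^-1 (dbar / d - 1) (p / d) g Th k n0 (symmx_tr _)
    sgnv_norm (ltW di0) (ltW g0) Th0 star_s star_1 i _ _ hk.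
  rewrite -(graph_conv_decomp a) -/e => /(_ _) /le_trans; apply.
    by apply: divr_ge0; [apply: mulr_ge0 => //; exact: sqrtr_ge0 | exact: ltW].
  by rewrite lerD2l ler_pM2r ?invr_gt0 ?sqrtr_gt0.
Qed.

End BlockModel.

(** * Independence and integrals *)

Local Open Scope classical_set_scope.
Local Open Scope ring_scope.

Section IntegralTransfer.
Variable R : realType.
Import HBNNSimple.

Lemma integral_comp_weight_approx (d : measure_display) (T : measurableType d)
    (mu : {measure set T -> \bar R}) (X H : T -> R) (g : R -> R)
    (mg : measurable_fun setT (EFin \o g)) :
  measurable_fun setT X -> measurable_fun setT H ->
  (forall x, 0 <= H x) -> (forall x, 0 <= g x) ->
  (\int[mu]_x (g (X x) * H x)%:E =
   limn (fun n => \sum_(y \in range (nnsfun_approx measurableT mg n))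
     (y%:E * \int[mu]_x (\1_(nnsfun_approx measurableT mg n @^-1` [set y]) (X x) * H x)%:E)))%E.
Proof.
move=> mX mH H0 g0; pose h := nnsfun_approx measurableT mg.
have mhX n : measurable_fun setT (fun x => h n (X x)).
  by apply: measurableT_comp => //; exact: measurable_funP.
transitivity (limn (fun n => \int[mu]_x ((h n (X x) * H x)%:E))%E).
  rewrite -monotone_convergence //=; last first.
  - move=> x _ a b ab; rewrite lee_fin ler_wpM2r //.
    exact/lefP/nd_nnsfun_approx.
  - by move=> n x _; rewrite lee_fin mulr_ge0.
  - by move=> n; apply/measurable_EFinP; apply: measurable_funM.
  apply: eq_integral => x _; apply/esym/cvg_lim => //.
  under eq_fun do rewrite EFinM; rewrite EFinM; apply: cvgeZr => //.
  have := @cvg_nnsfun_approx _ _ _ _ measurableT _ mg (fun y _ => _) (X x) Logic.I.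
  by apply => y; rewrite lee_fin.
congr (limn _); apply/funext => n.
transitivity (\int[mu]_x (\sum_(y \in range (h n))
    (y * (\1_(h n @^-1` [set y]) (X x) * H x))%:E))%E.
  apply: eq_integral => x _; rewrite fimfunE fsumEFin //; congr (_%:E).
  by rewrite mulr_fsuml; apply: eq_fsbigr => y _; rewrite mulrA.
rewrite ge0_integral_fsum //=.
- apply: eq_fsbigr => y; rewrite inE => -[z _ <-].
  under eq_integral do rewrite EFinM.
  rewrite ge0_integralZl_EFin //.
  + by move=> x _; rewrite lee_fin mulr_ge0.
  + by apply/measurable_EFinP; apply: measurable_funM => //; apply: measurableT_comp.
- move=> y; apply/measurable_EFinP; apply: measurable_funM => //; apply: measurable_funM => //.
  by apply: measurableT_comp.
- move=> y x _; rewrite mulrA EFinM mule_ge0 ?lee_fin //.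
  by have := nnfun_muleindic_ge0 (h n) y (X x); rewrite -EFinM lee_fin.
Qed.

(** Agreement on indicators extends to [g] by simple approximation. The weights let it serve twice:
    for independence, with [H1] the product of the other factors and [H2] constant, and for Gaussian
    integrals, with [H2] a density. *)
Lemma integral_comp_weight_eq (d1 d2 : measure_display)
    (T1 : measurableType d1) (T2 : measurableType d2)
    (mu1 : {measure set T1 -> \bar R}) (mu2 : {measure set T2 -> \bar R})
    (X1 H1 : T1 -> R) (X2 H2 : T2 -> R) (g : R -> R) :
  measurable_fun setT X1 -> measurable_fun setT H1 -> (forall x, 0 <= H1 x) ->
  measurable_fun setT X2 -> measurable_fun setT H2 -> (forall x, 0 <= H2 x) ->
  measurable_fun setT g -> (forall x, 0 <= g x) ->
  (forall B, measurable B ->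
    \int[mu1]_x (\1_B (X1 x) * H1 x)%:E = \int[mu2]_x (\1_B (X2 x) * H2 x)%:E)%E ->
  (\int[mu1]_x (g (X1 x) * H1 x)%:E = \int[mu2]_x (g (X2 x) * H2 x)%:E)%E.
Proof.
move=> mX1 mH1 H10 mX2 mH2 H20 mg g0 h.
have mg' : measurable_fun setT (EFin \o g) by exact/measurable_EFinP.
rewrite (integral_comp_weight_approx _ mg') // (integral_comp_weight_approx _ mg') //.
by congr (limn _); apply/funext => n; apply: eq_fsbigr => y _; rewrite h.
Qed.

End IntegralTransfer.

(** * Expectation of a product of independent variables *)

Section Independence.
Variables (R : realType) (d : measure_display) (T : measurableType d).
Variables (P : probability T R) (I : finType) (J : {set I}) (X : I -> T -> R).
Hypothesis mX : forall i, measurable_fun setT (X i).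
Hypothesis indepX : mutual_indep P J X.

(** Induction on the list [s] of the indices whose factor need not be an indicator. With [s] empty
    this is [mutual_indep]; otherwise the factor at the head is exchanged for arbitrary indicators
    and [integral_comp_weight_eq] brings it back. *)
Let indep_integral_seq (s : seq I) (f : I -> R -> R) (c : I -> R) :
  (forall i, measurable_fun setT (f i)) -> (forall i x, 0 <= f i x) ->
  (forall i, i \in J -> (\int[P]_w (f i (X i w))%:E = (c i)%:E)%E) ->
  (forall i, i \notin s -> exists2 B, measurable B & f i = \1_B) ->
  (\int[P]_w (\prod_(i in J) f i (X i w))%:E = (\prod_(i in J) c i)%:E)%E.
Proof.
elim: s f c => [|x0 s IH] f c mf f0 fc fs.
  have /choice[B BP] : forall i, exists B, measurable B /\ f i = \1_B.
    by move=> i; have [//|B] := fs i; exists B.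
  have mB i : measurable (B i) by have [] := BP i.
  have mXB i : measurable (X i @^-1` B i).
    by rewrite -[_ @^-1` _]setTI; exact: mX.
  have -> : (fun w => (\prod_(i in J) f i (X i w))%:E) =
      (fun w => (\1_(\big[setI/setT]_(i in J) (X i @^-1` B i)) w)%:E).
    apply/funext => w; congr (_%:E); rewrite /indic.
    have [h|h] := boolP (w \in _); last first.
      have [i iJ wi] : exists2 i, i \in J & w \notin X i @^-1` B i.
        apply: contrapT => h'; move/negP: h; apply; rewrite inE -bigcap_seq_cond.
        move=> i /andP[_ iJ]; apply: contrapT => wi; apply: h'; exists i => //.
        by apply/negP; rewrite inE.
      rewrite (bigD1 i) //=; have [_ ->] := BP i; rewrite indicE.
      by rewrite (_ : _ \in _ = false) ?mul0r //; exact/negbTE.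
    apply: big1 => i iJ; have [_ ->] := BP i; rewrite indicE.
    have wi : B i (X i w).
      by move: h; rewrite inE -bigcap_seq_cond => /(_ i); apply; rewrite /= iJ mem_index_enum.
    by rewrite mem_set.
  have mI : measurable (\big[setI/setT]_(i in J) (X i @^-1` B i)).
    by apply: bigsetI_measurable => i _.
  rewrite (integral_indic P measurableT mI) setIT.
  transitivity (\big[*%E/1%E]_(i in J) P (X i @^-1` B i)); first exact: indepX.
  rewrite -prodEFin; apply: eq_bigr => i iJ.
  rewrite -fc //; have [_ ->] := BP i.
  by rewrite -[X in P X]setIT -(integral_indic P measurableT (mXB i)).
have c0 i : i \in J -> 0 <= c i.
  by move=> iJ; rewrite -lee_fin -fc //; apply: integral_ge0 => w _; rewrite lee_fin.
have [x0J|x0J] := boolP (x0 \in J); last first.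
  pose f' i := if i == x0 then \1_setT else f i.
  have ne i : i \in J -> (i == x0) = false.
    by move=> iJ; apply/negbTE/eqP => e; rewrite -e iJ in x0J.
  have -> : (fun w => (\prod_(i in J) f i (X i w))%:E) =
      (fun w => (\prod_(i in J) f' i (X i w))%:E).
    by apply/funext => w; congr (_%:E); apply: eq_bigr => i iJ; rewrite /f' ne.
  apply: IH.
  - by move=> i; rewrite /f'; case: ifP.
  - by move=> i x; rewrite /f'; case: ifP.
  - by move=> i iJ; rewrite /f' ne //; exact: fc.
  - move=> i si; rewrite /f'; case: eqP => [_|/eqP ix]; first by exists setT.
    by apply: fs; rewrite inE negb_or ix.
pose H w := \prod_(i in J | i != x0) f i (X i w).
pose C := \prod_(i in J | i != x0) c i.
have C0 : 0 <= C by apply: prodr_ge0 => i /andP[iJ _]; exact: c0.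
have mH : measurable_fun setT H.
  have -> : H = (fun w => \prod_i (if (i \in J) && (i != x0) then f i (X i w) else 1)).
    by apply/funext => w; rewrite /H big_mkcond.
  apply: measurable_prod => i _; case: ((i \in J) && (i != x0)); last exact: measurable_cst.
  by apply: measurableT_comp.
have -> : (fun w => (\prod_(i in J) f i (X i w))%:E) =
    (fun w => (f x0 (X x0 w) * H w)%:E).
  by apply/funext => w; rewrite (bigD1 x0).
(* Against functions of [X x0], the weight [H] acts as the constant [C]. *)
rewrite (@integral_comp_weight_eq _ _ _ _ _ P P (X x0) H (X x0) (cst C) (f x0)) //.
- under eq_integral do rewrite mulrC EFinM.
  rewrite ge0_integralZl_EFin // ?fc //.
  + by rewrite -EFinM (bigD1 x0) //= mulrC.
  + by move=> w _; rewrite lee_fin.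
  + by apply/measurable_EFinP; apply: measurableT_comp.
- by move=> w; apply: prodr_ge0.
move=> B mB; pose f' i := if i == x0 then \1_B else f i.
have mXB : measurable (X x0 @^-1` B) by rewrite -[_ @^-1` _]setTI; exact: mX.
have intB : (\int[P]_w (\1_B (X x0 w))%:E = P (X x0 @^-1` B))%E.
  by rewrite -[X in P X]setIT -(integral_indic P measurableT mXB).
have finB : P (X x0 @^-1` B) \is a fin_num by exact: fin_num_measure.
pose c' i := if i == x0 then fine (P (X x0 @^-1` B)) else c i.
have -> : (fun w => (\1_B (X x0 w) * H w)%:E) = (fun w => (\prod_(i in J) f' i (X i w))%:E).
  apply/funext => w; congr (_%:E); rewrite (bigD1 x0) //= /f' eqxx; congr (_ * _).
  by apply: eq_bigr => i /andP[_ /negbTE ->].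
rewrite (IH f' c').
- under eq_integral do rewrite mulrC EFinM.
  rewrite ge0_integralZl_EFin //.
  + rewrite intB (bigD1 x0) //= /c' eqxx mulrC EFinM fineK //; congr (_ * _)%E.
    by congr (_%:E); apply: eq_bigr => i /andP[_ /negbTE ->].
  + by apply/measurable_EFinP; apply: measurableT_comp.
- by move=> i; rewrite /f'; case: ifP.
- by move=> i x; rewrite /f'; case: ifP.
- move=> i iJ; rewrite /f' /c'; case: eqP => [->|_]; last exact: fc.
  by rewrite intB fineK.
- move=> i si; rewrite /f'; case: eqP => [_|/eqP ix]; first by exists B.
  by apply: fs; rewrite inE negb_or ix.
Qed.

Lemma integral_indep_prod (f : I -> R -> R) (c : I -> R) :
  (forall i, measurable_fun setT (f i)) -> (forall i x, 0 <= f i x) ->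
  (forall i, i \in J -> (\int[P]_w (f i (X i w))%:E = (c i)%:E)%E) ->
  (\int[P]_w (\prod_(i in J) f i (X i w))%:E = (\prod_(i in J) c i)%:E)%E.
Proof.
move=> mf f0 fc; apply: (indep_integral_seq (s := enum I)) => // i.
by rewrite mem_enum inE.
Qed.

End Independence.

Lemma integral_expR_normal (R : realType) (d : measure_display) (T : measurableType d)
    (P : probability T R) (Z : T -> R) (sigma t : R) :
  sigma != 0 -> measurable_fun setT Z ->
  (forall B, measurable B -> P (Z @^-1` B) = normal_prob 0 sigma B) ->
  (\int[P]_w (expR (t * Z w))%:E = (expR (t ^+ 2 * sigma ^+ 2 / 2))%:E)%E.
Proof.
move=> s0 mZ hZ.
have mexp : measurable_fun setT (fun x : R => expR (t * x)).
  by apply: measurableT_comp => //; exact: measurable_funM.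
transitivity (\int[P]_w (expR (t * Z w) * cst 1 w)%:E)%E.
  by apply: eq_integral => w _; rewrite mulr1.
rewrite (@integral_comp_weight_eq _ _ _ _ _ P lebesgue_measure Z (cst 1) id
   (normal_pdf 0 sigma) (fun x => expR (t * x))) //.
(* Completing the square: the tilted density is a multiple of the normal density of mean
   [t sigma^2]. *)
- transitivity (\int[lebesgue_measure]_x ((expR (t ^+ 2 * sigma ^+ 2 / 2))%:E *
      (normal_pdf (t * sigma ^+ 2) sigma x)%:E))%E.
    apply: eq_integral => x _; rewrite -EFinM; congr (_%:E).
    rewrite !normal_pdfE // mulrCA [RHS]mulrCA; congr (_ * _).
    rewrite /normal_fun -!expRD; congr expR.
    by field.
  rewrite ge0_integralZl_EFin // ?integral_normal_pdf ?mule1 ?expR_ge0 //.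
  + by move=> x _; rewrite lee_fin normal_pdf_ge0.
  + by apply/measurable_EFinP; exact: measurable_normal_pdf.
- exact: measurable_normal_pdf.
- exact: normal_pdf_ge0.
move=> B mB; have mZB : measurable (Z @^-1` B) by rewrite -[_ @^-1` _]setTI; exact: mZ.
transitivity (P (Z @^-1` B)).
  under eq_integral do rewrite mulr1.
  by rewrite -[X in P X]setIT -(integral_indic P measurableT mZB).
rewrite hZ // /normal_prob [LHS]integral_mkcond; apply: eq_integral => x _.
by rewrite epatch_indic /= -EFinM mulrC.
Qed.

Lemma measure_bigsetU_le (R : realType) (d : measure_display) (T : measurableType d)
    (P : {measure set T -> \bar R}) (I : Type) (s : seq I) (F : I -> set T) :
  (forall i, measurable (F i)) ->
  (P (\big[setU/set0]_(i <- s) F i) <= \sum_(i <- s) P (F i))%E.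
Proof.
move=> mF; elim: s => [|x s IH]; first by rewrite !big_nil measure0.
rewrite !big_cons; apply: (le_trans (measureU2 _ _ _)) => //.
  by apply: bigsetU_measurable => i _.
by rewrite leeD2l.
Qed.

(** * The Gaussian noise *)

(** Pairs that are not of the form [i < j] are set to [false], in agreement with their probability 0
    in [edge_prob]. *)
Definition cfg (R : realType) (T : Type) (n : nat) (e : 'I_n -> 'I_n -> T -> R) (w : T) :
    {ffun 'I_n * 'I_n -> bool} :=
  [ffun x : 'I_n * 'I_n => (x.1 < x.2)%N && (e x.1 x.2 w == 1)].

Definition noise_form (R : realType) (T : Type) (n m : nat) (Z : 'I_n -> 'I_m -> T -> R)
    (c : 'I_n -> 'I_m -> R) (w : T) : R :=
  \sum_i \sum_l c i l * Z i l w.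

Section CsbmTail.
Variables (R : realType) (n m : nat) (S : {set 'I_n}) (p q sigma : R).
Variables (d : measure_display) (T : measurableType d) (P : probability T R).
Variables (e : 'I_n -> 'I_n -> T -> R) (Z : 'I_n -> 'I_m -> T -> R).
Hypotheses (model : csbm_model P S p q sigma e Z) (sigma0 : sigma != 0).
Implicit Type a : {ffun 'I_n * 'I_n -> bool}.
Local Notation cfg := (cfg e).
Local Notation noise_form := (noise_form Z).

Let me_ i j : measurable_fun setT (e i j).
Proof. by case: model. Qed.

Let mZ i l : measurable_fun setT (Z i l).
Proof. by case: model. Qed.

Let eqset (b : bool) : set R := [set v | (v == 1) = b].

Let eqsetE b : eqset b = if b then [set 1] else ~` [set 1].
Proof.
apply/seteqP; split=> v; rewrite /eqset; case: b => /=.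
- by move/eqP.
- by move=> /negbT/eqP.
- by move=> ->; rewrite eqxx.
- by move=> /eqP/negbTE.
Qed.

Let meqset b : measurable (eqset b).
Proof. by rewrite eqsetE; case: b => //; apply: measurableC. Qed.

Lemma measurable_cfg a : measurable [set w | cfg w = a].
Proof.
have -> : [set w | cfg w = a] = \big[setI/setT]_(x : 'I_n * 'I_n) [set w | cfg w x = a x].
  rewrite -bigcap_seq; apply/seteqP; split=> w /=; first by move=> wa x _; rewrite /= wa.
  by move=> h; apply/ffunP => x; apply: h; exact: mem_index_enum.
apply: bigsetI_measurable => x _.
have -> : [set w | cfg w x = a x] =
    if (x.1 < x.2)%N then e x.1 x.2 @^-1` eqset (a x) else [set w | false = a x].
  by apply/seteqP; split=> w; rewrite /cfg /eqset /= ffunE; case: ifP.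
case: ifP => _; first by rewrite -[_ @^-1` _]setTI; exact: me_.
case: (a x); last by rewrite (_ : [set _ | _] = setT) //; apply/seteqP; split.
by rewrite (_ : [set _ | _] = set0) //; apply/seteqP; split.
Qed.

Lemma measurable_noise_form c : measurable_fun setT (noise_form c).
Proof.
apply: measurable_sum => i; apply: measurable_sum => l.
by apply: measurable_funM.
Qed.

(** Chernoff's bound jointly with the graph: the indicator of the configuration and the exponential
    of the noise form one product over independent coordinates, so the expectation factorises.
    Summing over [a] later replaces conditioning on the graph. *)
Lemma noise_form_tail a (c : 'I_n -> 'I_m -> R) (lam t : R) :
  0 <= lam -> (forall x, 0 <= edge_prob S p q x <= 1) ->
  (P ([set w | cfg w = a] `&` [set w | (t <= noise_form c w)%R]) <=
   (cfg_weight (edge_prob S p q) a *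
    expR (lam ^+ 2 * sigma ^+ 2 * (\sum_i \sum_l c i l ^+ 2) / 2 - lam * t))%:E)%E.
Proof.
move=> lam0 r01; set A := _ `&` _.
have mA : measurable A.
  apply: measurable_fun_le; [exact: measurable_cfg|exact: measurable_cst|].
  exact/measurable_funTS/measurable_noise_form.
(* A configuration with an edge outside [i < j] never occurs; otherwise the edge factors of the
   product over the relevant indices multiply to [cfg_weight]. *)
have [[x xa xlt]|ok] := pselect (exists2 x, a x & ~~ (x.1 < x.2)%N).
  have -> : A = set0.
    apply/seteqP; split=> // w -[/= wa _]; move: xa.
    by rewrite -wa ffunE (negbTE xlt).
  by rewrite measure0 lee_fin mulr_ge0 ?expR_ge0 ?cfg_weight_ge0.
have [_ _ ind eP ZP] := model.
pose f (x : csbm_index n m) : R -> R := match x with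
  | inl ij => \1_(eqset (a ij))
  | inr il => fun v => expR (lam * c il.1 il.2 * v) end.
pose cc (x : csbm_index n m) : R := match x with
  | inl ij => bern (edge_prob S p q ij) (a ij)
  | inr il => expR ((lam * c il.1 il.2) ^+ 2 * sigma ^+ 2 / 2) end.
have mX i : measurable_fun setT (csbm_family e Z i) by case: i => x /=.
have mf i : measurable_fun setT (f i).
  case: i => x /=; first exact: measurable_indic.
  by apply: measurableT_comp => //; exact: measurable_funM.
have f0 i v : 0 <= f i v by case: i => x //=; exact: expR_ge0.
have key := @integral_indep_prod _ _ _ P _ _ _ mX ind f cc mf f0.
have {}key : (\int[P]_w (\prod_(i in csbm_relevant n m) f i (csbm_family e Z i w))%:E =
    (\prod_(i in csbm_relevant n m) cc i)%:E)%E.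
  apply: key => -[ij|il]; rewrite inE /=; last first.
    by move=> _; apply: integral_expR_normal => //; exact: ZP.
  move=> ij12; have [e1 _] := eP _ _ ij12.
  have mE b : measurable (e ij.1 ij.2 @^-1` eqset b).
    by rewrite -[_ @^-1` _]setTI; exact: me_.
  transitivity (P (e ij.1 ij.2 @^-1` eqset (a ij))).
    by rewrite -[X in P X]setIT -(integral_indic P measurableT (mE _)).
  rewrite /edge_prob ij12; case: (a ij); rewrite eqsetE //=.
  rewrite -preimage_setC probability_setC ?e1 //.
  by have := mE true; rewrite eqsetE.
have prodE : \prod_(i in csbm_relevant n m) cc i =
    cfg_weight (edge_prob S p q) a * expR (lam ^+ 2 * sigma ^+ 2 * (\sum_i \sum_l c i l ^+ 2) / 2).
  rewrite big_sumType /=; congr (_ * _).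
    rewrite /cfg_weight big_mkcond; apply: eq_bigr => x _; rewrite inE.
    case: ifP => // /negbT xlt; rewrite /edge_prob (negbTE xlt).
    case ax : (a x); last by rewrite /bern subr0.
    by case: ok; exists x.
  rewrite (eq_bigl xpredT) => [|x]; last by rewrite inE.
  rewrite -expR_sum; congr expR.
  rewrite mulr_sumr mulr_suml.
  rewrite -(pair_bigA _ (fun i l => (lam * c i l) ^+ 2 * sigma ^+ 2 / 2)) /=.
  apply: eq_bigr => i _; rewrite mulr_sumr mulr_suml; apply: eq_bigr => l _.
  by ring.
rewrite prodE in key.
rewrite expRD mulrA EFinM -key muleC.
rewrite -ge0_integralZl_EFin ?expR_ge0 //; last 2 first.
- by move=> w _; rewrite lee_fin; apply: prodr_ge0.
- apply/measurable_EFinP.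
  have -> : (fun w => \prod_(i in csbm_relevant n m) f i (csbm_family e Z i w)) =
     (fun w => \prod_i (if i \in csbm_relevant n m then f i (csbm_family e Z i w) else 1)).
    by apply/funext => w; exact: big_mkcond.
  apply: measurable_prod => i _; case: (i \in csbm_relevant n m); last exact: measurable_cst.
  by apply: measurableT_comp.
rewrite -[A]setIT -(integral_indic P measurableT mA).
apply: ge0_le_integral => //.
- by apply/measurable_EFinP; exact: measurable_indic.
- apply/measurable_EFinP; apply: measurable_funM => //.
  have -> : (fun w => \prod_(i in csbm_relevant n m) f i (csbm_family e Z i w)) =
     (fun w => \prod_i (if i \in csbm_relevant n m then f i (csbm_family e Z i w) else 1)).
    by apply/funext => w; exact: big_mkcond.
  apply: measurable_prod => i _; case: (i \in csbm_relevant n m); last exact: measurable_cst.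
  by apply: measurableT_comp.
move=> w _; rewrite indicE; have [wA|_] := boolP (w \in A); last first.
  by rewrite lee_fin mulr_ge0 ?expR_ge0 //; apply: prodr_ge0.
rewrite -EFinM lee_fin; move: wA; rewrite inE => -[/= wa wt].
rewrite big_sumType /= [X in _ * (X * _)]big1 ?mul1r; last first.
  move=> x; rewrite inE => xlt; rewrite indicE mem_set //= /eqset /=.
  by rewrite -wa ffunE xlt.
rewrite (eq_bigl xpredT) => [|x]; last by rewrite inE.
rewrite -expR_sum -expRD; apply: (le_trans _ (expR_ge1Dx _)); rewrite lerDl.
rewrite -(pair_bigA _ (fun i l => lam * c i l * Z i l w)) /=.
have -> : \sum_i \sum_j lam * c i j * Z i j w = lam * noise_form c w.
  rewrite mulr_sumr; apply: eq_bigr => i _; rewrite mulr_sumr; apply: eq_bigr => l _.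
  by rewrite mulrA.
by rewrite addrC subr_ge0 ler_wpM2l.
Qed.

(** Threshold and coefficients depend on the graph, so the complement of [E] is cut into the events
    [F a], on each of which they are constant. *)
Lemma csbm_event_bound (good : pred {ffun 'I_n * 'I_n -> bool})
    (tau : {ffun 'I_n * 'I_n -> bool} -> R)
    (c : {ffun 'I_n * 'I_n -> bool} -> 'I_n -> 'I_n -> 'I_m -> R) (ell : R) :
  (forall x, 0 <= edge_prob S p q x <= 1) -> 0 < ell ->
  (forall a, good a -> 0 < tau a) ->
  (forall a i, good a ->
     (\sum_i' \sum_l c a i i' l ^+ 2) * (6 * ell * sigma ^+ 2) <= tau a ^+ 2) ->
  let E := [set w | good (cfg w) /\ forall i, `|noise_form (c (cfg w) i) w| < tau (cfg w)] in
  measurable E /\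
  ((1 - (Pr (edge_prob S p q) (predC good) + 2 * n%:R * expR (- (3 * ell))))%:E <= P E)%E.
Proof.
move=> r01 ell0 tau0 cb E; set r := edge_prob S p q.
pose F a : set T := [set w | cfg w = a] `&`
  (if good a then \big[setU/set0]_(i < n)
    ([set w | tau a <= noise_form (c a i) w] `|`
     [set w | tau a <= noise_form (fun i' l => - c a i i' l) w]) else setT).
have formN a i w : noise_form (fun i' l => - c a i i' l) w = - noise_form (c a i) w.
  rewrite /noise_form -sumrN; apply: eq_bigr => i' _; rewrite -sumrN.
  by apply: eq_bigr => l _; rewrite mulNr.
have mle t cf : measurable [set w | t <= noise_form cf w].
  rewrite -[X in measurable X]setTI; apply: measurable_fun_le => //.
  exact: measurable_noise_form.
have mF a : measurable (F a).
  apply: measurableI; first exact: measurable_cfg.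
  by case: ifP => // _; apply: bigsetU_measurable => i _; exact: measurableU.
have EC : ~` E = \big[setU/set0]_a F a.
  rewrite -bigcup_seq; apply/seteqP; split=> w.
    move=> nE; exists (cfg w); first exact: mem_index_enum.
    split=> //; case: ifP => // gw; apply: contrapT => nU; apply: nE; split=> // i.
    rewrite ltNge; apply/negP => ti; apply: nU.
    rewrite -bigcup_seq; exists i; first exact: mem_index_enum.
    by move: ti; rewrite ler_normr => /orP[h|h]; [left|right; rewrite /= formN].
  move=> [a _ [/= wa]]; case: ifP => ga; last first.
    by move=> _ [gw _]; rewrite wa ga in gw.
  rewrite -bigcup_seq => -[i _ ti] [_ /(_ i)]; rewrite wa ltNge => /negP; apply.
  by rewrite ler_normr; apply/orP; case: ti => /=; [left|rewrite formN; right].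
have mE : measurable E.
  by rewrite -[E]setCK EC; apply/measurableC/bigsetU_measurable => a _.
split=> //.
have PF a : (P (F a) <= (cfg_weight r a * ((~~ good a)%:R + 2 * n%:R * expR (- (3 * ell))))%:E)%E.
  (* The zero form at threshold 0 turns the tail bound into [P (cfg = a) <= cfg_weight r a]. *)
  rewrite /F; case ga : (good a) => /=; last first.
    rewrite setIT; have h := @noise_form_tail a (fun _ _ => 0) 0 0 (lexx 0) r01.
    move: h; rewrite expr0n /= !mul0r subr0 expR0 mulr1 => h.
    apply: (@le_trans _ _ (cfg_weight r a)%:E); last first.
      rewrite lee_fin ler_peMr ?cfg_weight_ge0 // lerDl.
      by rewrite mulr_ge0 ?expR_ge0 // mulr_ge0.
    apply: le_trans h; apply: le_measure; rewrite ?inE; first exact: measurable_cfg.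
      by apply: measurableI => //; exact: measurable_cfg.
    move=> w wa; split=> //=; rewrite /noise_form big1 // => i _.
    by rewrite big1 // => l _; rewrite mul0r.
  rewrite add0r; rewrite -bigcup_seq setI_bigcupr bigcup_seq.
  apply: (le_trans (measure_bigsetU_le P _ _)).
    by move=> i; apply: measurableI; [exact: measurable_cfg|exact: measurableU].
  have one cf : (\sum_i' \sum_l cf i' l ^+ 2) * (6 * ell * sigma ^+ 2) <= tau a ^+ 2 ->
      (P ([set w | cfg w = a] `&` [set w | (tau a <= noise_form cf w)%R]) <=
       (cfg_weight r a * expR (- (3 * ell)))%:E)%E.
    move=> hc; have ta := tau0 a ga.
    (* The choice [lam = 6 ell / tau a] makes the quadratic term at most [3 ell] and the linear one
       [6 ell]. *)
    have l0 : 0 <= 6 * ell / tau a by rewrite divr_ge0 ?(ltW ta) // mulr_ge0 // ltW.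
    apply: (le_trans (noise_form_tail a cf (tau a) l0 r01)).
    rewrite lee_fin ler_wpM2l ?cfg_weight_ge0 // ler_expR.
    have -> : 6 * ell / tau a * tau a = 6 * ell by field; rewrite gt_eqF.
    set s := \sum_i' _ in hc *.
    have -> : (6 * ell / tau a) ^+ 2 * sigma ^+ 2 * s / 2 =
      (s * (6 * ell * sigma ^+ 2)) * (3 * ell / tau a ^+ 2).
      by field; rewrite gt_eqF.
    have h2 : 0 <= 3 * ell / tau a ^+ 2 by rewrite divr_ge0 ?sqr_ge0 // mulr_ge0 // ltW.
    have := ler_wpM2r h2 hc.
    have -> : tau a ^+ 2 * (3 * ell / tau a ^+ 2) = 3 * ell by field; rewrite gt_eqF.
    lra.
  apply: (@le_trans _ _ (\sum_(i < n) (cfg_weight r a * (2 * expR (- (3 * ell))))%:E)%E); last first.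
    rewrite sumEFin lee_fin sumr_const card_ord -mulr_natr; rewrite le_eqVlt; apply/orP; left; apply/eqP.
    by ring.
  apply: lee_sum => i _; rewrite setIUr.
  apply: (le_trans (measureU2 _ _ _)); try by apply: measurableI => //; exact: measurable_cfg.
  have h1 := one _ (cb a i ga).
  have h2 : (P ([set w | cfg w = a] `&` [set w | (tau a <= noise_form (fun i' l => - c a i i' l) w)%R]) <=
       (cfg_weight r a * expR (- (3 * ell)))%:E)%E.
    apply: one; rewrite (eq_bigr (fun i' => \sum_l c a i i' l ^+ 2)); first exact: cb.
    by move=> i' _; apply: eq_bigr => l _; rewrite sqrrN.
  apply: (le_trans (leeD h1 h2)); rewrite -EFinD lee_fin; lra.
have PC : (P (~` E) <= (Pr r (predC good) + 2 * n%:R * expR (- (3 * ell)))%:E)%E.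
  rewrite EC; apply: (le_trans (measure_bigsetU_le P _ mF)).
  apply: (le_trans (lee_sum _ (fun a _ => PF a))).
  rewrite sumEFin lee_fin -/(Ex r (fun a => (~~ good a)%:R + 2 * n%:R * expR (- (3 * ell)))).
  by rewrite ExD Ex_cst.
have fE : P E \is a fin_num by exact: fin_num_measure.
move: PC; rewrite probability_setC // -(fineK fE) -EFinB !lee_fin; lra.
Qed.

End CsbmTail.

(** * Assembly *)

(** 26 is what [row_bad_tail] requires; the second term ensures [2 nu <= Th]. *)
Definition entry_cst (R : realType) : R := 26 + 2 * Num.sqrt (spec_cst R).

(** * Probability and consequences of a good graph *)

Section GoodGraphs.
Variables (R : realType) (n : nat) (S : {set 'I_n}) (p q : R) (k t : nat).
Hypotheses (p0 : 0 <= p) (p1 : p <= 1) (q0 : 0 <= q) (qp : q <= p).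
Let ell : R := ln n%:R.
Let np := n%:R * p.
Let Th := entry_cst R * Num.sqrt (np * ell).
Let r := edge_prob S p q.

Lemma edge_prob_le x : 0 <= r x <= p.
Proof.
rewrite /r /edge_prob; case: ifP => _; last by rewrite lexx p0.
by case: ifP => _; rewrite ?p0 ?q0 ?lexx ?qp.
Qed.

(** Stated through a trace and finitely many row events, whose probabilities are available; the norm
    and entry bounds follow deterministically. *)
Definition good_graph (a : {ffun 'I_n * 'I_n -> bool}) : bool :=
  (\tr (cmx r a ^+ (2 * 2 ^ t)) < (spec_cst R * np) ^+ (2 ^ t)) &&
  ~~ [exists ij : 'I_n * 'I_k, row_bad r Th (sgnv R S) ij.1 ij.2 a ||
                               row_bad r Th (onev R n) ij.1 ij.2 a].

Hypotheses (ell1 : 1 <= ell) (np64 : 64 * ell <= np).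
Hypotheses (t1 : ell <= (2 ^ t)%:R) (t2 : (2 ^ t)%:R <= np) (kn : (k <= n)%N).

Lemma good_graph_prob : Pr r (predC good_graph) <= 10 / n%:R ^+ 2.
Proof.
move: ell1 np64 => ell1' np64'.
have r01 x : 0 <= r x <= 1 by have /andP[-> h] := edge_prob_le x; rewrite (le_trans h).
have np1 : 1 <= np by lra.
have n1 : 1 <= n%:R :> R.
  have np0 : 0 < np by lra.
  have : (0 < n)%N by rewrite lt0n; apply/eqP => e; move: np0; rewrite /np e mul0r ltxx.
  by rewrite ler1n.
have n0 : 0 < n%:R :> R by lra.
pose bad1 a := (spec_cst R * np) ^+ (2 ^ t) <= \tr (cmx r a ^+ (2 * 2 ^ t)).
pose bad2 v a := [exists ij : 'I_n * 'I_k, row_bad r Th v ij.1 ij.2 a].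
have b1 : Pr r bad1 <= 6 / n%:R ^+ 2 by exact: (spectral_tail edge_prob_le p0 p1).
have b2 v : Pr r (bad2 v) <= 2 / n%:R ^+ 2.
  apply: (le_trans (Pr_exists r01 _)).
  have h (ij : 'I_n * 'I_k) : Pr r (row_bad r Th v ij.1 ij.2) <= 2 * expR (- (5 * ell)).
    apply: (row_bad_tail edge_prob_le p0 p1) => //; last by rewrite -/ell; lra.
    by rewrite /entry_cst lerDl mulr_ge0 ?sqrtr_ge0.
  apply: (le_trans (ler_sum _ (fun ij _ => h ij))).
  rewrite sumr_const card_prod !card_ord -[leLHS]mulr_natr natrM.
  have -> : expR (- (5 * ell)) = n%:R ^- 5.
    by rewrite expRN expRM_natl lnK ?posrE.
  have kn' : k%:R <= n%:R :> R by rewrite ler_nat.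
  have -> : 2 / n%:R ^+ 2 = 2 * n%:R ^- 5 * (n%:R * n%:R * n%:R) :> R.
    by field; rewrite gt_eqF.
  rewrite ler_wpM2l ?mulr_ge0 ?invr_ge0 ?exprn_ge0 //.
  have := ler_wpM2l (ltW n0) kn'; nra.
apply: (@le_trans _ _ (Pr r (predU bad1 (predU (bad2 (sgnv R S)) (bad2 (onev R n)))))).
  apply: le_Pr => // a; rewrite /= /good_graph negb_and negbK -leNgt => /orP[h|].
    by apply/orP; left.
  move=> /existsP[ij /orP[h|h]]; apply/orP; right; apply/orP; [left|right];
  by apply/existsP; exists ij.
apply: (le_trans (Pr_U r01 _ _)); have := Pr_U r01 (bad2 (sgnv R S)) (bad2 (onev R n)).
have := b1; have := b2 (sgnv R S); have := b2 (onev R n); lra.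
Qed.

Hypotheses (n_even : ~~ odd n) (cardS : #|S| = n./2) (k1 : (1 <= k)%N).
Hypothesis np_big : 1024 * spec_cst R <= np.
Hypothesis hgam : 256 * entry_cst R * k%:R * Num.sqrt (ell / np) <= (p - q) / (p + q).

Lemma good_graph_bounds a : good_graph a ->
  let g := n%:R * (p - q) / 2 / graph_degree R a in
  [/\ 0 < g, (p - q) / (p + q) / 2 <= g,
      forall i, 3 / 4 * g ^+ k <= sgnv R S i 0 * (graph_conv R a ^+ k *m sgnv R S) i 0 &
      forall i, euclid_norm (graph_conv R a ^+ k *m delta_mx i 0) <=
        (16 * Num.sqrt (spec_cst R * np) / np) ^+ k + 5 / 4 * g ^+ k / Num.sqrt n%:R].
Proof.
move: ell1 np64 np_big => ell1' np64' np_big'.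
case/andP=> htr /existsP hex.
have np0 : 0 < np by lra.
have n0 : (0 < n)%N by rewrite lt0n; apply/eqP => e; move: np0; rewrite /np e mul0r ltxx.
have s0 := spec_cst_gt0 R.
have s1 : 1 <= spec_cst R.
  rewrite /spec_cst /dense_cst; have h8 : 1 <= expR 8 :> R by rewrite -expR0 ler_expR.
  have h4 : 1 <= expR 4 :> R by rewrite -expR0 ler_expR.
  have h40 : 1 <= 2 ^+ 40 :> R by rewrite exprn_ege1 // ler1n.
  by nra.
set nu := Num.sqrt (spec_cst R * np).
have nu1 : 1 <= nu.
  by rewrite -sqrtr1 ler_wsqrtr //; nra.
have nu2 : nu ^+ 2 = spec_cst R * np by rewrite sqr_sqrtr // mulr_ge0 // ltW.
have nu32 : 32 * nu <= np.
  rewrite -(ler_pXn2r (n := 2)) ?nnegrE ?mulr_ge0 ?sqrtr_ge0 //; try exact: ltW.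
  rewrite exprMn nu2; nra.
have nuTh : 2 * nu <= Th.
  rewrite /Th /nu /entry_cst sqrtrM ?(ltW s0) // [Num.sqrt (np * ell)]sqrtrM ?(ltW np0) //.
  have e1 : 1 <= Num.sqrt ell by rewrite -sqrtr1 ler_wsqrtr.
  have := sqrtr_ge0 (spec_cst R); have := sqrtr_ge0 np; move: e1.
  set x := Num.sqrt (spec_cst R); set y := Num.sqrt np; set z := Num.sqrt ell => z1 y0 x0.
  have h1 : 0 <= 2 * x * y by rewrite !mulr_ge0.
  have h2 : 0 <= 26 * (y * z) by rewrite !mulr_ge0 //; lra.
  have := ler_wpM2l h1 z1; nra.
have hB : op_le (cmx r a) nu.
  by apply: spectral_op_le htr; exact: ltW.
have hstar (v : 'cV[R]_n) : (forall i, `|v i 0| <= 1) ->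
    (forall ij : 'I_n * 'I_k, ~~ row_bad r Th v ij.1 ij.2 a) -> star (cmx r a) Th k 1 v.
  move=> v1 nb j i jk; rewrite mul1r.
  apply: (@power_entry_bound _ _ _ (symmx_tr _) (cmx_diag _ _) nu Th v k) => //.
    exact: sqrtr_ge0.
  move=> i0 j0 j0k h1 h2; rewrite leNgt; apply/negP => h3.
  have := nb (i0, Ordinal j0k); rewrite /row_bad /= h1 (ltW h3) andbT /=.
  by move/negP; apply; apply/forallP.
apply: (@graph_power_bounds R n S p q n_even cardS n0 k (entry_cst R) a) => //.
- exact: lt_le_trans ltr01 ell1'.
- have h := sqrtr_ge0 (spec_cst R * np); rewrite -/nu; rewrite -/np -/ell -/Th; lra.
- by rewrite /entry_cst; have := sqrtr_ge0 (spec_cst R); lra.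
- apply: hstar => [i|ij]; first by rewrite sgnv_norm.
  by apply/negP => h; apply: hex; exists ij; rewrite h.
- apply: hstar => [i|ij]; first by rewrite mxE normr1.
  by apply/negP => h; apply: hex; exists ij; rewrite h orbT.
Qed.

End GoodGraphs.

(** * From the sample space to configurations *)

Section Realization.
Variables (R : realType) (T : Type) (n m : nat).
Variables (S : {set 'I_n}) (e : 'I_n -> 'I_n -> T -> R) (Z : 'I_n -> 'I_m -> T -> R).
Variables (mu nu : 'cV[R]_m) (w : T).

Lemma adjacency_cfg : adjacency e w = graph_adj R (cfg e w).
Proof.
apply/matrixP => i j; rewrite !mxE !ffunE /=.
by case: ifP => // _; case: ifP.
Qed.

Lemma num_edges_cfg : num_edges e w = (\sum_x cfg e w x)%N.
Proof.
rewrite /num_edges -sum1_card big_mkcond; apply: eq_bigr => x _; rewrite ffunE.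
rewrite (_ : (x \in _) = (x.1 < x.2)%N && (e x.1 x.2 w == 1)); first by case: (_ && _).
by apply/idP/idP => [/set_mem|h] //; exact: mem_set.
Qed.

Lemma avg_degree_cfg : avg_degree e w = graph_degree R (cfg e w).
Proof.
rewrite /avg_degree /graph_degree; congr (_ / _); rewrite dot_symmx num_edges_cfg.
rewrite natrM natr_sum mulr_sumr; apply: eq_bigr => x _; rewrite ffunE !mxE.
by case: (x.1 < x.2)%N => /=; [case: (e x.1 x.2 w == 1) => /=|]; ring.
Qed.

Lemma conv_matrix_cfg : conv_matrix e w = graph_conv R (cfg e w).
Proof. by rewrite /conv_matrix adjacency_cfg avg_degree_cfg. Qed.

Lemma iter_mulmx (A : 'M[R]_n) k v : iter k (fun v => A *m v) v = A ^+ k *m v :> 'cV[R]_n.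
Proof.
elim: k => [|k IH]; first by rewrite expr0 mul1mx.
by rewrite iterS IH exprS -mulmxE mulmxA.
Qed.

Definition dir : 'cV[R]_m := (euclid_norm (mu - nu))^-1 *: (mu - nu).

Definition noise_vec : 'cV[R]_n := \col_i \sum_l Z i l w * dir l 0.

(** Projecting on the unit vector [dir] and subtracting the midpoint of the projected means leaves
    half the distance, with the sign of the class, as signal. *)
Lemma projected_features : euclid_norm (mu - nu) != 0 ->
  features S mu nu Z w *m dir + (- (dot mu dir + dot nu dir) / 2) *: const_mx 1 =
  (euclid_norm (mu - nu) / 2) *: sgnv R S + noise_vec.
Proof.
set de := euclid_norm _ => de0.
have dd : dot mu dir - dot nu dir = de.
  have -> : dot mu dir - dot nu dir = dot (mu - nu) dir.
    by rewrite -[- nu]scaleN1r dotDl dotZl mulN1r.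
  by rewrite /dir -/de dotZr -enorm_sqr -/de expr2 mulKf.
apply/colP => i; rewrite !mxE.
have -> : \sum_j features S mu nu Z w i j * dir j 0 =
    (if i \in S then dot mu dir else dot nu dir) + \sum_l Z i l w * dir l 0.
  rewrite (fun_if (fun x => x + _)) /dot -!big_split /=.
  by case: ifP => iS; apply: eq_bigr => l _; rewrite mxE iS mulrDl.
by rewrite -dd; case: ifP => _; field.
Qed.

Lemma noise_vec_form (A : 'M[R]_n) i :
  (A *m noise_vec) i 0 = noise_form Z (fun i' l => A i i' * dir l 0) w.
Proof.
rewrite mxE; apply: eq_bigr => i' _; rewrite mxE mulr_sumr; apply: eq_bigr => l _.
by ring.
Qed.

Lemma noise_form_sqr (A : 'M[R]_n) i : euclid_norm (mu - nu) != 0 -> A^T = A ->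
  \sum_i' \sum_l (A i i' * dir l 0) ^+ 2 = euclid_norm (A *m delta_mx i 0) ^+ 2.
Proof.
move=> de0 As; rewrite enorm_sqr -colE.
have d1 : dot dir dir = 1.
  by rewrite /dir dotZl dotZr -enorm_sqr expr2 mulrA -[X in _ * X](mulfK de0); field.
apply: eq_bigr => i' _; rewrite mxE -[A in RHS]As !mxE.
transitivity (A i i' ^+ 2 * dot dir dir); last by rewrite d1 mulr1 expr2.
by rewrite mulr_sumr; apply: eq_bigr => l _; rewrite exprMn -expr2.
Qed.

(** The signal is at least [de / 2] times [3/4 g]; this is the origin of 3/8 in the noise
    threshold. *)
Lemma separable_cfg k (g : R) : 0 < euclid_norm (mu - nu) ->
  let A := graph_conv R (cfg e w) ^+ k in
  (forall i, 3 / 4 * g <= sgnv R S i 0 * (A *m sgnv R S) i 0) ->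
  (forall i, `|noise_form Z (fun i' l => A i i' * dir l 0) w| <
             3 / 8 * euclid_norm (mu - nu) * g) ->
  separable_after k S mu nu e Z w.
Proof.
set de := euclid_norm _ => de0 A hs hn.
exists dir, (- (dot mu dir + dot nu dir) / 2) => y; left.
have yE i : y i 0 = de / 2 * (A *m sgnv R S) i 0 +
    noise_form Z (fun i' l => A i i' * dir l 0) w.
  rewrite /y iter_mulmx projected_features ?gt_eqF // conv_matrix_cfg -/A -noise_vec_form.
  by rewrite mulmxDr -scalemxAr [LHS]mxE [X in X + _]mxE.
split=> i iS; move: (hs i) (hn i); rewrite yE ltr_norml [sgnv R S i 0]mxE.
  rewrite iS mul1r; set X := (A *m _) i 0 => h1 /andP[h2 h3].
  have := ler_wpM2l (ltW de0) h1; lra.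
rewrite (negbTE iS) mulN1r; set X := (A *m _) i 0 => h1 /andP[h2 h3].
have := ler_wpM2l (ltW de0) h1; lra.
Qed.

End Realization.

Lemma graph_conv_tr (R : realType) (n : nat) (a : {ffun 'I_n * 'I_n -> bool}) :
  (graph_conv R a)^T = graph_conv R a.
Proof. by rewrite /graph_conv linearB !linearZ /= symmx_tr trmx_const. Qed.

(** [D] is the signal-to-noise ratio. Both terms [kap^k] and [g^k / sqrt n], times [sqrt ell], are
    at most [g^k D / 16]; with weights 1 and 5/4 they sum to [9/64 D g^k], and
    [6 (9/64)^2 <= (3/8)^2]. *)
Lemma separation_arith (R : realType) (n k : nat) (p gam g D : R) :
  let ell : R := ln n%:R in let np := n%:R * p in
  (0 < n)%N -> 0 < ell -> 0 < np -> 0 < gam -> gam / 2 <= g -> 0 <= D ->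
  16 * Num.max (Num.sqrt (ell / n%:R))
     ((32 * Num.sqrt (spec_cst R) / (gam * Num.sqrt np)) ^+ k * Num.sqrt ell) <= D ->
  ((16 * Num.sqrt (spec_cst R * np) / np) ^+ k + 5 / 4 * g ^+ k / Num.sqrt n%:R) ^+ 2 *
    (6 * ell) <= (3 / 8 * D * g ^+ k) ^+ 2.
Proof.
move=> ell np n0 ell0 np0 gam0 gg D0 hD.
have nR : 0 < n%:R :> R by rewrite ltr0n.
have g0 : 0 < g by lra.
have gk : 0 <= g ^+ k by rewrite exprn_ge0 // ltW.
have h1 : 16 * Num.sqrt (ell / n%:R) <= D.
  by apply: le_trans hD; rewrite ler_wpM2l // le_max lexx.
have h2 : 16 * ((32 * Num.sqrt (spec_cst R) / (gam * Num.sqrt np)) ^+ k * Num.sqrt ell) <= D.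
  by apply: le_trans hD; rewrite ler_wpM2l // le_max lexx orbT.
have sn0 : 0 < Num.sqrt np by rewrite sqrtr_gt0.
(* Origin of [C]: [gam / 2], a lower bound for [g], is pulled out of the noise norm. *)
have kE : 16 * Num.sqrt (spec_cst R * np) / np =
    gam / 2 * (32 * Num.sqrt (spec_cst R) / (gam * Num.sqrt np)).
  rewrite sqrtrM ?(ltW (spec_cst_gt0 R)) // -[X in _ / X](@sqr_sqrtr _ np) ?(ltW np0) //.
  by field; rewrite !gt_eqF.
have hk : (16 * Num.sqrt (spec_cst R * np) / np) ^+ k * Num.sqrt ell <= g ^+ k * (D / 16).
  rewrite kE; set c := 32 * _ / _ in h2 *; rewrite exprMn -mulrA.
  have c0 : 0 <= c.
    apply: divr_ge0; first by rewrite mulr_ge0 ?sqrtr_ge0.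
    by apply: mulr_ge0; exact: ltW.
  have gam2 : 0 <= gam / 2 by rewrite divr_ge0 // ltW.
  apply: ler_pM.
  - exact: exprn_ge0.
  - by apply: mulr_ge0; [exact: exprn_ge0|exact: sqrtr_ge0].
  - by apply: lerXn2r => //; rewrite nnegrE; exact: ltW.
  - by rewrite ler_pdivlMr // mulrC.
have hg : g ^+ k / Num.sqrt n%:R * Num.sqrt ell <= g ^+ k * (D / 16).
  rewrite -mulrA ler_wpM2l //.
  have -> : (Num.sqrt n%:R)^-1 * Num.sqrt ell = Num.sqrt (ell / n%:R).
    by rewrite sqrtrM ?(ltW ell0) // sqrtrV ?ler0n // mulrC.
  by rewrite ler_pdivlMr // mulrC.
set kap := 16 * _ / np in hk *.
have kap0 : 0 <= kap by rewrite divr_ge0 ?(ltW np0) // mulr_ge0 ?sqrtr_ge0.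
have kapk : 0 <= kap ^+ k by rewrite exprn_ge0.
have gn : 0 <= g ^+ k / Num.sqrt n%:R by rewrite divr_ge0 ?sqrtr_ge0.
have -> : (kap ^+ k + 5 / 4 * g ^+ k / Num.sqrt n%:R) ^+ 2 * (6 * ell) =
    6 * (kap ^+ k * Num.sqrt ell + 5 / 4 * (g ^+ k / Num.sqrt n%:R * Num.sqrt ell)) ^+ 2.
  rewrite -[ell in LHS](@sqr_sqrtr _ ell) ?(ltW ell0) //.
  by field; rewrite gt_eqF // sqrtr_gt0.
set x := kap ^+ k * _ + _.
have x0 : 0 <= x.
  by apply: addr_ge0; [rewrite mulr_ge0 ?sqrtr_ge0|rewrite !mulr_ge0 ?sqrtr_ge0 ?invr_ge0].
have xb : x <= 9 / 64 * (D * g ^+ k) by rewrite /x; lra.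
have y0 : 0 <= D * g ^+ k by rewrite mulr_ge0.
have -> : 3 / 8 * D * g ^+ k = 3 / 8 * (D * g ^+ k) by rewrite mulrA.
move: (D * g ^+ k) xb y0 => y xb y0.
have : x ^+ 2 <= (9 / 64 * y) ^+ 2.
  by apply: lerXn2r => //; rewrite nnegrE mulr_ge0 // divr_ge0.
have : 0 <= y ^+ 2 by exact: sqr_ge0.
rewrite !exprMn; lra.
Qed.

Lemma exists_pow2_between (R : realType) (x : R) : 1 <= x ->
  exists t : nat, x <= (2 ^ t)%:R /\ (2 ^ t)%:R <= 2 * (x + 1).
Proof.
move=> x1; have /andP[h1 h2] := Num.Theory.truncn_itv (le_trans ler01 x1).
set m := Num.truncn x in h1 h2; have m1 : (0 < m)%N.
  by rewrite lt0n; apply/eqP => m0; move: h2; rewrite m0; lra.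
exists (up_log 2 m.+1).
have /andP[g1 g2] := up_log_bounds (isT : (1 < 2)%N) (m1 : (1 < m.+1)%N).
split; first by apply: (le_trans (ltW h2)); rewrite ler_nat.
have : (2 ^ up_log 2 m.+1 <= 2 * m.+1)%N.
  case: (up_log 2 m.+1) g1 => [|t] /= g1; first by lia.
  by rewrite expnS; lia.
rewrite -(ler_nat R) natrM -natr1; lra.
Qed.

(** Separability is an existential over [w] and [b], so the probability is stated through a
    measurable set [E] of separable outcomes. *)
Theorem theorem2 :
  forall R : realType,
  exists c0 C : R, 0 < c0 /\ 0 < C /\
  forall Kk : R, 0 < Kk ->
  exists (csep cprob : R) (N0 : nat), 0 < csep /\ 0 < cprob /\
  forall (n : nat), (N0 <= n)%N -> ~~ odd n ->
  forall (m : nat) (S : {set 'I_n}), #|S| = n./2 ->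
  forall (p q sigma : R) (mu nu : 'cV[R]_m) (k : nat),
    0 <= q -> q <= 1 -> 0 <= p -> p <= 1 -> 0 < sigma ->
    (1 <= k)%N -> k%:R <= Kk * ln n%:R ->
    let gamma := (p - q) / (p + q) in
    c0 * k%:R * Num.sqrt (ln n%:R / (n%:R * p)) <= gamma ->
    (ln n%:R) ^+ 3 / n%:R <= p ->
    csep * Num.max (Num.sqrt (ln n%:R / n%:R))
                   ((C / (gamma * Num.sqrt (n%:R * p))) ^+ k * Num.sqrt (ln n%:R))
      <= euclid_norm (mu - nu) / sigma ->
  forall (d : measure_display) (T : measurableType d) (P : probability T R)
         (e : 'I_n -> 'I_n -> T -> R) (Z : 'I_n -> 'I_m -> T -> R),
    csbm_model P S p q sigma e Z ->
    exists E : set T, measurable E /\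
      E `<=` [set w | separable_after k S mu nu e Z w] /\
      ((1 - n%:R `^ (- cprob))%:E <= P E)%E.
Proof.
move=> R; have s0 := spec_cst_gt0 R.
have ss0 : 0 < Num.sqrt (spec_cst R) by rewrite sqrtr_gt0.
have ec0 : 26 <= entry_cst R by rewrite /entry_cst; lra.
exists (256 * entry_cst R), (32 * Num.sqrt (spec_cst R)).
split; first lra; split; first lra.
move=> Kk _; pose L0 : R := 8 + 1024 * spec_cst R.
(* [csep] is the 16 of [separation_arith]. The failure probability is at most [10 / n^2] for the
   graph plus [2 / n^2] for the noise, hence at most [1 / n] for [n >= 12]. [ln n >= L0] yields
   [64 ell <= ell^3] and [1024 spec_cst <= np]. *)
exists 16, 1, ((Num.truncn (expR L0)).+1 + 12)%N; split=> //; split=> //.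
move=> n nN n_even m S cardS p q sigma mu nu k q0 q1 p0 p1 sig0 k1 _ gamma hgam hp hsep.
move=> d T P e Z model.
set ell : R := ln n%:R in hgam hp hsep; set np := n%:R * p in hgam hsep.
have n12 : 12 <= n%:R :> R by rewrite (ler_nat R 12) (leq_trans _ nN) // leq_addl.
have n0 : (0 < n)%N by rewrite (leq_trans _ nN).
have nR : 0 < n%:R :> R by lra.
have ellL : L0 <= ell.
  rewrite -ler_expR lnK ?posrE //; apply: (le_trans (ltW (Num.Theory.truncnS_gt _))).
  by rewrite ler_nat (leq_trans _ nN) // leq_addr.
clear nN.
have ell8 : 8 <= ell by rewrite /L0 in ellL; lra.
have np3 : ell ^+ 3 <= np by move: hp; rewrite ler_pdivrMr // mulrC.
have ell3 : 64 * ell <= ell ^+ 3.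
  have -> : ell ^+ 3 = ell ^+ 2 * ell by rewrite -exprSr.
  by rewrite ler_wpM2r ?expr2; nra.
have np64 : 64 * ell <= np by lra.
have np0 : 0 < np by lra.
have np_big : 1024 * spec_cst R <= np by rewrite /L0 in ellL; lra.
have p_gt0 : 0 < p by move: np0; rewrite /np pmulr_rgt0.
have kR : 1 <= k%:R :> R by rewrite ler1n.
have sq0 : 0 < Num.sqrt (ell / np) by rewrite sqrtr_gt0 divr_gt0 //; lra.
have ec_gt0 : 0 < entry_cst R by exact: lt_le_trans ec0.
have gam0 : 0 < gamma by apply: lt_le_trans hgam; rewrite !mulr_gt0 ?ltr0n.
have pq0 : 0 < p + q by lra.
have qp : q <= p.
  by move: gam0; rewrite /gamma pmulr_lgt0 ?invr_gt0 // subr_gt0 => /ltW.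
have gam1 : gamma <= 1 by rewrite /gamma ler_pdivrMr // mul1r; lra.
(* [gamma <= 1] turns the lower bound on [gamma] into [k sqrt (ell / np) <= 1], and
   [sqrt (ell / np) >= 1 / n]. *)
have kn : (k <= n)%N.
  rewrite -(ler_nat R).
  have sqn : n%:R^-1 <= Num.sqrt (ell / np).
    rewrite -(ler_pXn2r (n := 2)) ?nnegrE ?invr_ge0 ?(ltW sq0) ?(ltW nR) //.
    rewrite sqr_sqrtr; last by apply: divr_ge0; lra.
    rewrite ler_pdivlMr // exprVn mulrC ler_pdivrMr ?exprn_gt0 //.
    have npn : np <= n%:R by rewrite /np ler_piMr // ltW.
    apply: (le_trans npn); rewrite expr2; nra.
  have h : k%:R * n%:R^-1 <= 1 :> R.
    apply: le_trans gam1; apply: le_trans hgam.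
    have h1 : k%:R * n%:R^-1 <= k%:R * Num.sqrt (ell / np) by rewrite ler_wpM2l.
    have h2 : 0 <= k%:R * Num.sqrt (ell / np) by rewrite mulr_ge0 // ltW.
    have -> : 256 * entry_cst R * k%:R * Num.sqrt (ell / np) =
      256 * entry_cst R * (k%:R * Num.sqrt (ell / np)) by ring.
    nra.
  by move: h; rewrite ler_pdivrMr // mul1r.
have [t [t1 t2]] : exists t : nat, ell <= (2 ^ t)%:R /\ (2 ^ t)%:R <= 2 * (ell + 1).
  by apply: exists_pow2_between; lra.
have t2' : (2 ^ t)%:R <= np by lra.
have ell1 : 1 <= ell by lra.
have ell0 : 0 < ell by lra.
have rle := edge_prob_le S p0 q0 qp.
have r01 x : 0 <= edge_prob S p q x <= 1 by have /andP[-> h] := rle x; rewrite (le_trans h).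
have bnd a := @good_graph_bounds R n S p q k t p0 p1 q0 ell1 np64 n_even cardS k1 np_big hgam a.
set de := euclid_norm (mu - nu) in hsep.
have D0 : 0 < de / sigma.
  apply: lt_le_trans hsep; apply: mulr_gt0 => //; rewrite lt_max; apply/orP; left.
  by rewrite sqrtr_gt0 divr_gt0.
have de0 : 0 < de by move: D0; rewrite pmulr_lgt0 // invr_gt0.
pose A (a : {ffun 'I_n * 'I_n -> bool}) := graph_conv R a ^+ k.
pose g (a : {ffun 'I_n * 'I_n -> bool}) := (n%:R * (p - q) / 2 / graph_degree R a) ^+ k.
pose tau (a : {ffun 'I_n * 'I_n -> bool}) := 3 / 8 * de * g a.
pose c (a : {ffun 'I_n * 'I_n -> bool}) (i i' : 'I_n) (l : 'I_m) := A a i i' * dir mu nu l 0.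
have As a : (A a)^T = A a by apply: trmx_exp; exact: graph_conv_tr.
have tau0 a : good_graph S p q k t a -> 0 < tau a.
  move=> /bnd[g0 _ _ _]; rewrite /tau mulr_gt0 ?exprn_gt0 // mulr_gt0 //; lra.
have cb a i : good_graph S p q k t a ->
    (\sum_i' \sum_l c a i i' l ^+ 2) * (6 * ell * sigma ^+ 2) <= tau a ^+ 2.
  move=> /bnd[g0 gg _ /(_ i) hr].
  rewrite (noise_form_sqr i (lt0r_neq0 de0) (As a)).
  have ar := separation_arith n0 ell0 np0 gam0 gg (ltW D0) hsep.
  have -> : tau a ^+ 2 = (3 / 8 * (de / sigma) * g a) ^+ 2 * sigma ^+ 2.
    by rewrite /tau; field; rewrite gt_eqF.
  rewrite mulrA ler_wpM2r ?sqr_ge0 //; apply: le_trans ar.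
  rewrite ler_wpM2r ?mulr_ge0 ?(ltW ell0) //.
  by apply: lerXn2r; rewrite ?nnegrE ?enorm_ge0 // (le_trans _ hr) ?enorm_ge0.
have [mE PE] := @csbm_event_bound R n m S p q sigma d T P e Z model (lt0r_neq0 sig0)
   (good_graph S p q k t) tau c ell r01 ell0 tau0 cb.
exists [set w | good_graph S p q k t (cfg e w) /\
  forall i, `|noise_form Z (c (cfg e w) i) w| < tau (cfg e w)].
split=> //; split.
  move=> w [/bnd [_ _ hs _] hn].
  exact: (@separable_cfg _ _ _ _ S e Z mu nu w k (g (cfg e w))).
apply: le_trans PE; rewrite lee_fin lerD2l lerN2 powRN powRr1 ?ler0n //.
have := @good_graph_prob R n S p q k t p0 p1 q0 qp ell1 np64 t1 t2' kn.
have -> : expR (- (3 * ell)) = n%:R ^- 3 by rewrite expRN expRM_natl lnK ?posrE.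
have -> : 2 * n%:R * n%:R ^- 3 = 2 / n%:R ^+ 2 :> R by field; rewrite gt_eqF.
have : 12 / n%:R ^+ 2 <= n%:R^-1 :> R.
  rewrite ler_pdivrMr ?exprn_gt0 // expr2 mulKf ?gt_eqF //.
lra.
Qed.
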